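(* Let $F$ be an arbitrary field. Then every $z$-coordinate of the free associative algebra $F\langle x,y,z\rangle$ is stably tame. That is, if $f\in F\langle x,y,z\rangle$ is such that $(f,g,z)$ is an $F$-automorphism of $F\langle x,y,z\rangle$ for some $g\in F\langle x,y,z\rangle$, then $f$ is a stably tame coordinate.
   Context: $F\langle x_1,\dots,x_n\rangle$ is the free associative unital $F$-algebra on $x_1,\dots,x_n$. All automorphisms are $F$-algebra automorphisms. An $n$-tuple $(f_1,\dots,f_n)$ denotes the endomorphism $x_i\mapsto f_i$. An automorphism is elementary if it fixes all of the variables except one, and tame if it is a product (composition) of elementary automorphisms. An automorphism $(f_1,\dots,f_n)$ of $F\langle x_1,\dots,x_n\rangle$ is stably tame if there is a nonnegative integer $m$ such that the automorphism $(f_1,\dots,f_n,x_{n+1},\dots,x_{n+m})$ of $F\langle x_1,\dots,x_{n+m}\rangle$ is tame. An element $f\in F\langle x_1,\dots,x_n\rangle$ is a coordinate if $(f,f_2,\dots,f_n)$ is an automorphism for some $f_2,\dots,f_n\in F\langle x_1,\dots,x_n\rangle$; the coordinate $f$ is stably tame if $(f,f_2,\dots,f_n)$ is a stably tame automorphism for some such $f_2,\dots,f_n$. A coordinate $f$ is an $x_n$-coordinate if there is an automorphism of the form $(f,f_2,\dots,f_{n-1},x_n)$; for $F\langle x,y,z\rangle$ this gives the notion of $z$-coordinate. *)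

(* Defs.v *)
From HB Require Import structures.
From mathcomp Require Import all_boot all_order all_algebra.
From mathcomp Require Import xfinmap monalg.

Set Implicit Arguments.
Unset Strict Implicit.
Unset Printing Implicit Defensive.

Import GRing.Theory.
Local Open Scope ring_scope.

(* The elements of {fmonom 'I_n} are the words in n letters, so this is
   F<x_1, ..., x_n>, with the variables indexed by 'I_n, that is, from 0. *)
Notation free_algebra F n := {malg F[{fmonom 'I_n}]}.

Definition fvar (F : fieldType) (n : nat) (i : 'I_n) : free_algebra F n :=
  << fmu i >>.
Arguments fvar {F n} i.

Definition word_eval (F : fieldType) (n p : nat)
    (f : n.-tuple (free_algebra F p)) (w : {fmonom 'I_n}) : free_algebra F p :=
  \prod_(i <- w) tnth f i.

(* The F-algebra morphism x_i |-> f_i. For p = n it is the endomorphism denoted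
   by the n-tuple f; the general case also yields the inclusion of
   F<x_1, ..., x_n> into F<x_1, ..., x_(n+m)>. *)
Definition fsubst (F : fieldType) (n p : nat)
    (f : n.-tuple (free_algebra F p)) (a : free_algebra F n) :
    free_algebra F p :=
  mmap (fun c : F => c%:MP) (word_eval f) a.

Section FsubstTheory.
Variables (F : fieldType) (n p : nat) (f : n.-tuple (free_algebra F p)).

Fact word_eval_mmorphism : mmorphism (word_eval f).
Proof.
split=> [w1 w2|]; rewrite /word_eval; first by rewrite fmM big_cat.
by rewrite fm1 big_nil.
Qed.

HB.instance Definition _ :=
  isMultiplicative.Build _ _ (word_eval f) word_eval_mmorphism.

Fact fsubst_is_zmod_morphism : zmod_morphism (fsubst f).
Proof. exact: (@mmap_is_additive _ _ _ (@malgC _ F) (word_eval f)). Qed.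

HB.instance Definition _ := GRing.isZmodMorphism.Build
  (free_algebra F n) (free_algebra F p) (fsubst f) fsubst_is_zmod_morphism.

Fact malgC_comm (c : F) (a : free_algebra F p) : GRing.comm c%:MP a.
Proof.
apply/malgP => w; rewrite mul_malgC mcoeffZ {2}(monalgE a) mulr_suml raddf_sum.
rewrite [a in LHS](monalgE a) raddf_sum mulr_sumr; apply: eq_bigr => u _ /=.
by rewrite malgM_def fgmulUU mulm1 !mcoeffU mulrnAr mulrC.
Qed.

Fact fsubst_is_monoid_morphism : monoid_morphism (fsubst f).
Proof.
have [|fM f1] := (@commr_mmap_is_multiplicative _ _ _ (@malgC _ F) (word_eval f)).
  by move=> g w w'; apply: malgC_comm.
by split; [exact: f1 | exact: fM].
Qed.

HB.instance Definition _ := GRing.isMonoidMorphism.Build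
  (free_algebra F n) (free_algebra F p) (fsubst f) fsubst_is_monoid_morphism.

Fact fsubst_is_scalable : scalable (fsubst f).
Proof.
move=> c a; rewrite -[RHS]mul_malgC.
exact: (@mmapZ _ _ _ (@malgC _ F) (word_eval f)).
Qed.

HB.instance Definition _ := GRing.isScalable.Build
  F (free_algebra F n) (free_algebra F p) _ (fsubst f) fsubst_is_scalable.

Lemma fsubstX (i : 'I_n) : fsubst f (fvar i) = tnth f i.
Proof.
rewrite /fsubst (@mmapU _ _ _ (@malgC _ F)) /= mul1r.
by rewrite /word_eval fmU big_seq1.
Qed.
End FsubstTheory.

Definition automorphism (F : fieldType) (n : nat)
    (f : n.-tuple (free_algebra F n)) : Prop :=
  bijective (fsubst f).

Definition elementary (F : fieldType) (n : nat)
    (f : n.-tuple (free_algebra F n)) : Prop :=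
  automorphism f /\ exists i : 'I_n, forall j, j != i -> tnth f j = fvar j.

Definition tame (F : fieldType) (n : nat)
    (f : n.-tuple (free_algebra F n)) : Prop :=
  exists2 s : seq (n.-tuple (free_algebra F n)),
    {in s, forall e, elementary e}
    & fsubst f =1 foldr (fun e phi => fsubst e \o phi) id s.

(* F<x_1, ..., x_n> -> F<x_1, ..., x_(n+m)>, x_i |-> x_i *)
Definition finclude (F : fieldType) (n m : nat) :
    free_algebra F n -> free_algebra F (n + m) :=
  fsubst [tuple fvar (lshift m i) | i < n].

(* (f_1, ..., f_n, x_(n+1), ..., x_(n+m)) *)
Definition stabilization (F : fieldType) (n m : nat)
    (f : n.-tuple (free_algebra F n)) : (n + m).-tuple (free_algebra F (n + m)) :=
  [tuple of map_tuple (@finclude F n m) f ++ [tuple fvar (rshift n k) | k < m]].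

Definition stably_tame (F : fieldType) (n : nat)
    (f : n.-tuple (free_algebra F n)) : Prop :=
  automorphism f /\ exists m : nat, tame (stabilization m f).

Definition coordinate (F : fieldType) (n : nat)
    (f : free_algebra F n.+1) : Prop :=
  exists t : n.-tuple (free_algebra F n.+1), automorphism [tuple of f :: t].

Definition stably_tame_coordinate (F : fieldType) (n : nat)
    (f : free_algebra F n.+1) : Prop :=
  exists t : n.-tuple (free_algebra F n.+1), stably_tame [tuple of f :: t].

(* The algebra has n.+2 variables, the last of which is fvar ord_max. *)
Definition last_var_coordinate (F : fieldType) (n : nat)
    (f : free_algebra F n.+2) : Prop :=
  exists t : n.-tuple (free_algebra F n.+2),
    automorphism [tuple of f :: rcons t (fvar ord_max)].

Definition z_coordinate (F : fieldType) (f : free_algebra F 3) : Prop :=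
  last_var_coordinate f.

Lemma z_coordinateP (F : fieldType) (f : free_algebra F 3) :
  z_coordinate f <-> exists g, automorphism [tuple f; g; fvar ord_max].
Proof.
split=> [[t]|[g fg]].
  case/tupleP: t => g t; rewrite (tuple0 t) => fg; exists g.
  by congr automorphism: fg; apply: val_inj.
by exists [tuple g]; congr automorphism: fg; apply: val_inj.
Qed.

Lemma stably_tame_coordinateW (F : fieldType) (n : nat)
  (f : free_algebra F n.+1) : stably_tame_coordinate f -> coordinate f.
Proof. by case=> t [ft _]; exists t. Qed.

(* Main.v *)
Require Import Defs.
From HB Require Import structures.
From mathcomp Require Import all_boot all_order all_algebra.
From mathcomp Require Import finmap zify ring lra.
From mathcomp Require Import xfinmap monalg.
From Stdlib Require Import Classical.

(* F[s, t] acts on F<x, y, z> by s^j t^k . u = z^j u z^k; z gets degree 0 and x, y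
   degree 1. Let (f, g, z) be an automorphism and M the maximum of the degrees of
   f and g.
   If M <= 1 then f and g are given by a matrix in GL_2(F[s, t]) up to a
   translation. Higman's linearization and the Euclidean algorithm in F[s] make
   such a matrix stably a product of elementary and constant diagonal matrices,
   that is, of elementary automorphisms.
   If M >= 2, evaluating the leading form of a component of the inverse at the
   leading forms of f and g shows that these are p.h and q.h with p, q coprime.
   Write f = a + p.W and g = b + q.W with a, b of degree at most the degree e of
   q.f - p.g, and let al, be be the components of degree e of a, b. Comparing Fox
   derivatives in an inverse relation P(f, g) = x gives h c(z) = V(al, be) with V
   invariant under (x, y) |-> (x + p.w, y + q.w); the reversal of words gives also
   c'(z) h = V'(al, be). As c(t) and c'(s) are coprime, h = T(al, be) for an
   invariant T. Then (f - p.T(f, g), g - q.T(f, g), z) has smaller degree, and it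
   differs from (f, g, z) by (x + p.T, y + q.T, z), which is, with one variable w
   more, a commutator of w |-> w + T and (x, y) |-> (x + p.w, y + q.w). *)

(** The obstacle is that [F[s, t]] acts on both ends of a word. Fox derivatives are therefore taken
    over [F[t]], with [z] augmented to [t]: modulo the left ideal of [z - t] the powers of [z] at
    the right end become scalars, and the action becomes left multiplication in a domain. The price
    is the factor [c(z)] to the right of [h], which the reversal serves to remove. The relation for
    [h] comes from a deformation. At the generic point [(a + p.W, b + q.W)] one component [P] of the
    inverse is kept and a new letter [y4] is added to the other; this moves the point to some
    [(X, Y)] with the same value of [P]. The top form of that value is [Z(q.a - p.b, W)], and it
    does not change when [q.a - p.b] and [W] are replaced by the top forms belonging to [(X, Y)],
    not both of which are free of [y4]. The position of the first [y4] in the words forces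
    [c0 D0 = D1 K] for the two derivatives of an element obtained from [Z]. As [Z] vanishes at
    [(q.al - p.be, h)], this expresses [c0 h] by [K], whose weight [M - e] is too small for it to
    contain [W]. *)

Set Implicit Arguments.
Unset Strict Implicit.
Unset Printing Implicit Defensive.

Import Order.TTheory GRing.Theory Num.Theory.
Local Open Scope ring_scope.

(** * The free algebra and its evaluations *)

(* Failing unification problems unfold the product of [{malg R[{fmonom I}]}] and
   become very slow; hence this interface and its sealed instance. *)
Record free_alg (R : comNzRingType) (n : nat) := FreeAlg {
  fa_alg : lalgType R;
  fa_mon : seq 'I_n -> fa_alg;
  fa_coef : seq 'I_n -> fa_alg -> R;
  fa_supp : fa_alg -> seq (seq 'I_n);
  fa_mon1 : fa_mon [::] = 1;
  fa_monM : forall s t, fa_mon (s ++ t) = fa_mon s * fa_mon t;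
  fa_scalerAr : forall c u v, c *: (u * v) = u * (c *: v) :> fa_alg;
  fa_coefP : forall s c u v, fa_coef s (c *: u + v) = c * fa_coef s u + fa_coef s v;
  fa_coef_mon : forall s t, fa_coef s (fa_mon t) = (t == s)%:R;
  fa_supp_uniq : forall u, uniq (fa_supp u);
  fa_mem_supp : forall u s, (s \in fa_supp u) = (fa_coef s u != 0);
  fa_decomp : forall u, u = \sum_(s <- fa_supp u) fa_coef s u *: fa_mon s
}.

Section Concrete.
Variables (R : comNzRingType) (n : nat).
Local Notation A := {malg R[{fmonom 'I_n}]}.

Definition malg_supp (u : A) : seq (seq 'I_n) := [seq fmonom_val w | w <- msupp u].

Fact fmonom_val_inj : injective (@fmonom_val 'I_n).
Proof. by case=> v [w] /= ->. Qed.

Fact malg_mon1 : << FMonom [::] >> = 1 :> A.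
Proof. by congr (<< _ >>); apply: fmonom_val_inj; rewrite fm1. Qed.

Fact malg_monM (s t : seq 'I_n) :
  << FMonom (s ++ t) >> = << FMonom s >> * << FMonom t >> :> A.
Proof.
rewrite malgM_def fgmulUU mulr1; congr (<< _ >>).
by apply: fmonom_val_inj; rewrite fmM.
Qed.

Fact malg_scalerAr c (u v : A) : c *: (u * v) = u * (c *: v).
Proof.
rewrite -!mul_malgC mulrA; suff -> : c%:MP * u = u * c%:MP by rewrite mulrA.
apply/malgP => w; rewrite mul_malgC mcoeffZ {2}(monalgE u) mulr_suml raddf_sum.
rewrite [u in LHS](monalgE u) raddf_sum mulr_sumr; apply: eq_bigr => x _ /=.
by rewrite malgM_def fgmulUU mulm1 !mcoeffU mulrnAr mulrC.
Qed.

Fact malg_coefP s c (u v : A) :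
  (c *: u + v)@_(FMonom s) = c * u@_(FMonom s) + v@_(FMonom s).
Proof. by rewrite mcoeffD mcoeffZ. Qed.

Fact malg_coef_mon (s t : seq 'I_n) : (<< FMonom t >> : A)@_(FMonom s) = (t == s)%:R.
Proof. by rewrite mcoeffU. Qed.

Fact malg_supp_uniq u : uniq (malg_supp u).
Proof. by rewrite map_inj_uniq ?fset_uniq //; apply: fmonom_val_inj. Qed.

Fact malg_mem_supp (u : A) s : (s \in malg_supp u) = (u@_(FMonom s) != 0).
Proof.
rewrite mcoeff_neq0; apply/mapP/idP => [[[t] tu ->]//|su].
by exists (FMonom s).
Qed.

Fact malg_decomp (u : A) :
  u = \sum_(s <- malg_supp u) u@_(FMonom s) *: << FMonom s >>.
Proof.
rewrite big_map {1}(monalgE u); apply: eq_bigr => -[s] _ /=.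
by apply/malgP => t; rewrite mcoeffZ !mcoeffU mulrnAr mulr1.
Qed.

Definition malg_free_alg : free_alg R n :=
  FreeAlg malg_mon1 malg_monM malg_scalerAr malg_coefP malg_coef_mon malg_supp_uniq
    malg_mem_supp malg_decomp.
End Concrete.

Fact seal_key : unit. Proof. exact: tt. Qed.
Definition sealed_alg := locked_with seal_key malg_free_alg.

Definition FA (R : comNzRingType) n : lalgType R := fa_alg (sealed_alg R n).

Section Basis.
Variables (R : comNzRingType) (n : nat).
Local Notation A := (FA R n).
Implicit Types (u v : A) (s t : seq 'I_n) (P Q : seq 'I_n -> Prop).

Definition mon s : A := fa_mon (sealed_alg R n) s.
Definition cf s u : R := fa_coef s u.

Lemma mon0 : mon [::] = 1. Proof. exact: fa_mon1. Qed.
Lemma monM s t : mon (s ++ t) = mon s * mon t. Proof. exact: fa_monM. Qed.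
Lemma cfD s u v : cf s (u + v) = cf s u + cf s v.
Proof. by rewrite -[u]scale1r /cf fa_coefP mul1r scale1r. Qed.
Lemma cf0 s : cf s 0 = 0.
Proof. by apply: (addIr (cf s 0)); rewrite -cfD !add0r. Qed.
Lemma cfZ s c u : cf s (c *: u) = c * cf s u.
Proof. by have := fa_coefP s c u 0; rewrite -!/(cf s _) cf0 !addr0. Qed.
Lemma cfN s u : cf s (- u) = - cf s u.
Proof. by rewrite -scaleN1r cfZ mulN1r. Qed.
Lemma cfB s u v : cf s (u - v) = cf s u - cf s v.
Proof. by rewrite cfD cfN. Qed.
Lemma cf_mon s t : cf s (mon t) = (t == s)%:R. Proof. exact: fa_coef_mon. Qed.

Lemma cf_sum s (J : Type) (r : seq J) (F : J -> A) :
  cf s (\sum_(j <- r) F j) = \sum_(j <- r) cf s (F j).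
Proof. by elim/big_rec2: _ => [|j x y _ <-]; rewrite ?cf0 ?cfD. Qed.

Lemma fa_eq u v : (forall s, cf s u = cf s v) -> u = v.
Proof.
move=> uv; apply/eqP; rewrite -subr_eq0; apply/eqP; rewrite [LHS]fa_decomp big_seq big1 // => s.
by rewrite fa_mem_supp -/(cf s _) cfB uv subrr eqxx.
Qed.

Lemma fa_ind (C : A -> Prop) :
    C 0 -> (forall u v, C u -> C v -> C (u + v)) -> (forall c s, C (c *: mon s)) ->
  forall u, C u.
Proof. by move=> C0 CD CU u; rewrite [u]fa_decomp; elim/big_ind: _. Qed.

Definition supp P u := forall s, cf s u != 0 -> P s.

Lemma fa_suppind P (C : A -> Prop) :
    C 0 -> (forall u v, C u -> C v -> C (u + v)) ->
    (forall c s, P s -> C (c *: mon s)) ->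
  forall u, supp P u -> C u.
Proof.
move=> C0 CD CU u Pu; rewrite [u]fa_decomp big_seq.
elim/big_ind: _ => // s; rewrite fa_mem_supp => nz.
by apply: CU => //; apply: Pu.
Qed.

Lemma suppW P Q u : (forall s, P s -> Q s) -> supp P u -> supp Q u.
Proof. by move=> PQ Pu s /Pu/PQ. Qed.

Lemma supp0 P : supp P 0.
Proof. by move=> s; rewrite cf0 eqxx. Qed.

Lemma suppD P u v : supp P u -> supp P v -> supp P (u + v).
Proof.
move=> Pu Pv s; rewrite cfD; case: (eqVneq (cf s u) 0) => [->|/Pu //].
by rewrite add0r => /Pv.
Qed.

Lemma suppN P u : supp P u -> supp P (- u).
Proof. by move=> Pu s; rewrite cfN oppr_eq0 => /Pu. Qed.

Lemma suppB P u v : supp P u -> supp P v -> supp P (u - v).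
Proof. by move=> Pu Pv; apply: suppD => //; apply: suppN. Qed.

Lemma supp_sum P (J : Type) (r : seq J) (X : pred J) (F : J -> A) :
  (forall j, X j -> supp P (F j)) -> supp P (\sum_(j <- r | X j) F j).
Proof. by move=> PF; apply: big_ind => [|u v|]; [apply: supp0|apply: suppD|apply: PF]. Qed.

Lemma suppZ P c u : supp P u -> supp P (c *: u).
Proof.
move=> Pu s; rewrite cfZ; case: (eqVneq (cf s u) 0) => [->|/Pu //].
by rewrite mulr0 eqxx.
Qed.

Lemma supp_mon P s : P s -> supp P (mon s).
Proof. by move=> Ps t; rewrite cf_mon; case: (s =P t) => [<-|]//; rewrite eqxx. Qed.

Lemma suppU P c s : P s -> supp P (c *: mon s).
Proof. by move=> Ps; apply: suppZ; apply: supp_mon. Qed.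

Lemma supp1 P : P [::] -> supp P 1.
Proof. by rewrite -mon0; apply: supp_mon. Qed.

Lemma supp_and P Q u : supp P u -> supp Q u -> supp (fun s => P s /\ Q s) u.
Proof. by move=> Pu Qu s nz; split; [apply: Pu|apply: Qu]. Qed.

Lemma neq0_supp u : u != 0 -> exists s, cf s u != 0.
Proof.
move=> nz; case E: (fa_supp u) => [|s r].
  by rewrite [u]fa_decomp E big_nil eqxx in nz.
by exists s; rewrite -fa_mem_supp E mem_head.
Qed.

Lemma supp_contra u : supp (fun=> False) u -> u = 0.
Proof. by move=> Fu; apply/eqP; apply: contraT => /neq0_supp[s /Fu]. Qed.

Lemma fa_scaler c u v : c *: (u * v) = u * (c *: v).
Proof. exact: fa_scalerAr. Qed.

Lemma fa_comC c u : c%:A * u = u * c%:A.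
Proof. by rewrite -fa_scaler mulr1 -scalerAl mul1r. Qed.

Lemma mem_supp u s : (s \in fa_supp u) = (cf s u != 0).
Proof. exact: fa_mem_supp. Qed.

Lemma suppC P c : P [::] -> supp P c%:A.
Proof. by move=> P1; apply: suppZ; apply: supp1. Qed.

Lemma monU_mul c d s t : (c *: mon s) * (d *: mon t) = (c * d) *: mon (s ++ t).
Proof. by rewrite -fa_scaler -scalerAl -monM scalerA mulrC. Qed.

Lemma supp_mul P Q S u v : (forall s t, P s -> Q t -> S (s ++ t)) ->
  supp P u -> supp Q v -> supp S (u * v).
Proof.
move=> PQS Pu Qv; move: u Pu.
apply: fa_suppind => [|u w Hu Hw|c s Ps].
- by rewrite mul0r; apply: supp0.
- by rewrite mulrDl; apply: suppD.
move: v Qv; apply: fa_suppind => [|u w Hu Hw|d t Qt].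
- by rewrite mulr0; apply: supp0.
- by rewrite mulrDr; apply: suppD.
by rewrite monU_mul; apply: suppU; apply: PQS.
Qed.

End Basis.

(** * Additive and linear maps defined on words *)

Section Aext.
Variables (R : comNzRingType) (n : nat) (V : zmodType) (g : seq 'I_n -> R -> V).

(** The values are only additive in the coefficient, not linear: [gev] changes the coefficient ring,
    and [lam] turns a coefficient into a polynomial in [z]. *)
Definition aext (u : FA R n) : V :=
  locked_with seal_key (fun u : FA R n => \sum_(s <- fa_supp u) g s (cf s u)) u.

Hypothesis gB : forall s, zmod_morphism (g s).

Let g0 s : g s 0 = 0.
Proof. by rewrite -[0 in LHS](subrr 0) gB subrr. Qed.

Let gD s c d : g s (c + d) = g s c + g s d.
Proof. by rewrite -[c + d](opprK _) -[d in c + d]opprK opprK gB -[- d]sub0r gB g0 sub0r opprK. Qed.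

Lemma aextEw (d : seq (seq 'I_n)) u : uniq d -> {subset fa_supp u <= d} ->
  aext u = \sum_(s <- d) g s (cf s u).
Proof.
move=> ud ud'; rewrite /aext locked_withE.
rewrite [RHS](bigID (mem (fa_supp u))) /= [X in _ + X]big1 ?addr0 => [|s]; last first.
  by rewrite fa_mem_supp negbK => /eqP E; rewrite /cf E g0.
rewrite -[RHS]big_filter; apply: perm_big; apply: uniq_perm.
- exact: fa_supp_uniq.
- exact: filter_uniq.
by move=> s; rewrite mem_filter; case E: (s \in fa_supp u) => //=; rewrite ud'.
Qed.

Lemma aextD u v : aext (u + v) = aext u + aext v.
Proof.
pose d := undup (fa_supp u ++ fa_supp v ++ fa_supp (u + v)).
have du : uniq d by apply: undup_uniq.
have du1 : {subset fa_supp u <= d} by move=> s su; rewrite mem_undup !mem_cat su.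
have du2 : {subset fa_supp v <= d} by move=> s su; rewrite mem_undup !mem_cat su orbT.
have du3 : {subset fa_supp (u + v) <= d}.
  by move=> s su; rewrite mem_undup !mem_cat su !orbT.
rewrite (aextEw du du1) (aextEw du du2) (aextEw du du3).
by rewrite -big_split; apply: eq_bigr => s _; rewrite cfD gD.
Qed.

Lemma aextU c s : aext (c *: mon R s) = g s c.
Proof.
rewrite (@aextEw [:: s]) // => [|t]; first by rewrite big_seq1 cfZ cf_mon eqxx mulr1.
rewrite fa_mem_supp -/(cf t _) cfZ cf_mon inE.
by case: (s =P t) => [->|_]; rewrite ?eqxx // mulr0 eqxx.
Qed.

Lemma aext_mon s : aext (mon R s) = g s 1.
Proof. by rewrite -[mon R s]scale1r aextU. Qed.

Lemma aext0 : aext 0 = 0.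
Proof. by apply: (addIr (aext 0)); rewrite -aextD !add0r. Qed.

Lemma aextN u : aext (- u) = - aext u.
Proof. by apply/eqP; rewrite -addr_eq0 -aextD addNr aext0. Qed.

Lemma aextB u v : aext (u - v) = aext u - aext v.
Proof. by rewrite aextD aextN. Qed.
End Aext.

Section Lext.
Variables (R : comNzRingType) (n : nat) (V : lmodType R) (g : seq 'I_n -> V).

Definition lext : FA R n -> V := aext (fun s c => c *: g s).

Let gB s : zmod_morphism (fun c => c *: g s).
Proof. by move=> c d; rewrite scalerBl. Qed.

Lemma lext0 : lext 0 = 0. Proof. exact: aext0. Qed.
Lemma lextD u v : lext (u + v) = lext u + lext v. Proof. exact: aextD. Qed.
Lemma lextB u v : lext (u - v) = lext u - lext v. Proof. exact: aextB. Qed.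
Lemma lextU c s : lext (c *: mon R s) = c *: g s. Proof. exact: aextU. Qed.
Lemma lext_mon s : lext (mon R s) = g s. Proof. by rewrite [LHS]aext_mon // scale1r. Qed.
Lemma lextZ c u : lext (c *: u) = c *: lext u.
Proof.
move: u; apply: fa_ind => [|u v Hu Hv|d s]; first by rewrite scaler0 lext0 scaler0.
  by rewrite scalerDr !lextD Hu Hv scalerDr.
by rewrite scalerA !lextU scalerA.
Qed.
End Lext.

Section Proj.
Variables (R : comNzRingType) (n : nat) (P : pred (seq 'I_n)).
Implicit Types u v : FA R n.

Definition proj : FA R n -> FA R n := lext (fun s => if P s then mon R s else 0).

Lemma proj0 : proj 0 = 0. Proof. exact: lext0. Qed.
Lemma projD u v : proj (u + v) = proj u + proj v. Proof. exact: lextD. Qed.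
Lemma projB u v : proj (u - v) = proj u - proj v. Proof. exact: lextB. Qed.
Lemma projZ c u : proj (c *: u) = c *: proj u. Proof. exact: lextZ. Qed.

Lemma projU c s : proj (c *: mon R s) = if P s then c *: mon R s else 0.
Proof. by rewrite /proj lextU; case: (P s); rewrite ?scaler0. Qed.

Lemma cf_proj u s : cf s (proj u) = if P s then cf s u else 0.
Proof.
move: u; apply: fa_ind => [|u v Hu Hv|c t].
- by rewrite proj0 cf0 if_same.
- by rewrite projD !cfD Hu Hv; case: ifP => // _; rewrite addr0.
rewrite projU; case: (eqVneq t s) => [<-|ne].
  by case: ifP => // _; rewrite cf0.
rewrite cfZ cf_mon (negPf ne) mulr0 if_same.
by case: ifP => _; rewrite ?cf0 // cfZ cf_mon (negPf ne) mulr0.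
Qed.

Lemma proj_id u : supp P u -> proj u = u.
Proof.
move=> Pu; apply: fa_eq => s; rewrite cf_proj; case: ifP => // /negP nP.
by apply/esym/eqP; apply: contraT => /Pu.
Qed.

Lemma proj_0 u : supp (fun s => ~~ P s) u -> proj u = 0.
Proof.
move=> Pu; apply: fa_eq => s; rewrite cf_proj cf0; case: ifP => // Ps.
by apply/eqP; apply: contraT => /Pu; rewrite Ps.
Qed.

Lemma supp_proj u : supp P (proj u).
Proof. by move=> s; rewrite cf_proj; case: ifP => //; rewrite eqxx. Qed.

Lemma supp_projW (Q : seq 'I_n -> Prop) u : supp Q u -> supp Q (proj u).
Proof. by move=> Qu s; rewrite cf_proj; case: ifP => [_ /Qu|]; rewrite ?eqxx. Qed.

Lemma supp_projC (Q : seq 'I_n -> Prop) u :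
  supp Q u -> supp (fun s => Q s /\ ~~ P s) (u - proj u).
Proof.
move=> Qu s; rewrite cfB cf_proj; case: ifP => Ps; first by rewrite subrr eqxx.
by rewrite subr0 => /Qu.
Qed.
End Proj.

Section Letters.
Variables (R : comNzRingType) (n : nat).
Local Notation A := (FA R n).
Implicit Types (l : 'I_n) (s : seq 'I_n).

Definition lett l : A := mon R [:: l].

Lemma mon_rcons s l : mon R (rcons s l) = mon R s * lett l.
Proof. by rewrite -cats1 monM. Qed.

Lemma mon_cons s l : mon R (l :: s) = lett l * mon R s.
Proof. by rewrite -cat1s monM. Qed.

Lemma fa_rind (C : A -> Prop) :
    (forall u v, C u -> C v -> C (u + v)) -> (forall c u, C u -> C (c *: u)) ->
    C 1 -> (forall u l, C u -> C (u * lett l)) -> forall u, C u.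
Proof.
move=> CD CZ C1 Cr; apply: fa_ind => // [|c s].
  by rewrite -(scale0r (1 : A)); apply: CZ.
apply: CZ; elim/last_ind: s => [|s l IH]; first by rewrite mon0.
by rewrite mon_rcons; apply: Cr.
Qed.
End Letters.

Arguments lett {R n} l.

Section Gev.
Variables (R R' : comNzRingType) (phi : {rmorphism R -> R'}) (n n' : nat).
Variable U : 'I_n -> FA R' n'.
Implicit Types u v : FA R n.

(** The map [phi] on coefficients lets one notion cover both the substitutions over a fixed ring and
    the base change [bc] to polynomial coefficients. *)
Definition gev : FA R n -> FA R' n' :=
  aext (fun s c => phi c *: \prod_(i <- s) U i).

Let gB s : zmod_morphism (fun c => phi c *: \prod_(i <- s) U i).
Proof. by move=> c d; rewrite rmorphB scalerBl. Qed.

Lemma gev0 : gev 0 = 0. Proof. exact: aext0. Qed.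
Lemma gevD u v : gev (u + v) = gev u + gev v. Proof. exact: aextD. Qed.
Lemma gevN u : gev (- u) = - gev u. Proof. exact: aextN. Qed.
Lemma gevB u v : gev (u - v) = gev u - gev v. Proof. exact: aextB. Qed.
Lemma gevU c s : gev (c *: mon R s) = phi c *: \prod_(i <- s) U i.
Proof. exact: aextU. Qed.

Lemma gevZ c u : gev (c *: u) = phi c *: gev u.
Proof.
move: u; apply: fa_ind => [|u v Hu Hv|d s]; first by rewrite scaler0 gev0 scaler0.
  by rewrite scalerDr !gevD Hu Hv scalerDr.
by rewrite scalerA !gevU rmorphM scalerA.
Qed.

Lemma gev_mon s : gev (mon R s) = \prod_(i <- s) U i.
Proof. by rewrite -[mon R s]scale1r gevU rmorph1 scale1r. Qed.

Lemma gev1 : gev 1 = 1. Proof. by rewrite -mon0 gev_mon big_nil. Qed.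

Lemma gevC c : gev c%:A = (phi c)%:A. Proof. by rewrite gevZ gev1. Qed.

Lemma gevX l : gev (lett l) = U l. Proof. by rewrite gev_mon big_seq1. Qed.

Lemma gevM u v : gev (u * v) = gev u * gev v.
Proof.
move: u; apply: fa_ind => [|u w Hu Hw|c s].
- by rewrite mul0r gev0 mul0r.
- by rewrite mulrDl !gevD Hu Hw mulrDl.
move: v; apply: fa_ind => [|u w Hu Hw|d t].
- by rewrite mulr0 gev0 mulr0.
- by rewrite mulrDr !gevD Hu Hw mulrDr.
by rewrite monU_mul !gevU -fa_scaler -scalerAl scalerA big_cat mulrC rmorphM.
Qed.

Lemma gev_sum (J : Type) (r : seq J) (X : pred J) (F : J -> FA R n) :
  gev (\sum_(j <- r | X j) F j) = \sum_(j <- r | X j) gev (F j).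
Proof. by elim/big_rec2: _ => [|j x y _ <-]; rewrite ?gev0 ?gevD. Qed.

Lemma gev_unique (h : FA R n -> FA R' n') :
    {morph h : u v / u + v} -> h 1 = 1 -> (forall c u, h (c *: u) = phi c *: h u) ->
    (forall u l, h (u * lett l) = h u * U l) -> h =1 gev.
Proof.
move=> hD h1 hZ hM; apply: fa_rind => [u v|c u||u l].
- by rewrite hD gevD => -> ->.
- by rewrite hZ gevZ => ->.
- by rewrite h1 gev1.
by rewrite hM gevM gevX => ->.
Qed.
End Gev.

Section GevComp.
Variables (R R' R'' : comNzRingType).
Variables (phi : {rmorphism R -> R'}) (phi' : {rmorphism R' -> R''}).
Variables (phi'' : {rmorphism R -> R''}).
Hypothesis phiE : forall c, phi' (phi c) = phi'' c.
Variables (n n' n'' : nat).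

Lemma gev_comp (U : 'I_n -> FA R' n') (U' : 'I_n' -> FA R'' n'') u :
  gev phi' U' (gev phi U u) = gev phi'' (fun l => gev phi' U' (U l)) u.
Proof.
apply: (gev_unique (h := fun u => gev phi' U' (gev phi U u))) => [x y||c x|x l].
- by rewrite !gevD.
- by rewrite !gev1.
- by rewrite !gevZ phiE.
by rewrite !gevM gevX.
Qed.
End GevComp.

Section GevMisc.
Variables (R R' : comNzRingType) (phi : {rmorphism R -> R'}) (n n' : nat).

Lemma eq_gev (U U' : 'I_n -> FA R' n') : U =1 U' -> gev phi U =1 gev phi U'.
Proof.
move=> UU; apply: gev_unique => [u v||c u|u l]; first exact: gevD.
- exact: gev1.
- exact: gevZ.
by rewrite gevM gevX UU.
Qed.

Lemma gev_id (u : FA R n) : gev idfun lett u = u.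
Proof. by rewrite -(gev_unique (h := id)). Qed.
End GevMisc.

(** * Fox derivatives *)

Section Fox.
Variables (R : comNzRingType) (n : nat) (eta : 'I_n -> R).
Local Notation A := (FA R n).
Implicit Types (u v : A) (l m : 'I_n).

Definition aug : A -> R := aext (fun s c => c * \prod_(i <- s) eta i).

Let gB s : zmod_morphism (fun c : R => c * \prod_(i <- s) eta i).
Proof. by move=> c d; rewrite mulrBl. Qed.

Lemma aug0 : aug 0 = 0. Proof. exact: aext0. Qed.
Lemma augD u v : aug (u + v) = aug u + aug v. Proof. exact: aextD. Qed.
Lemma augB u v : aug (u - v) = aug u - aug v. Proof. exact: aextB. Qed.
Lemma augU c s : aug (c *: mon R s) = c * \prod_(i <- s) eta i.
Proof. exact: aextU. Qed.
Lemma augZ c u : aug (c *: u) = c * aug u.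
Proof.
move: u; apply: fa_ind => [|u v Hu Hv|d s]; first by rewrite scaler0 aug0 mulr0.
  by rewrite scalerDr !augD Hu Hv mulrDr.
by rewrite scalerA !augU mulrA.
Qed.
Lemma aug_mon s : aug (mon R s) = \prod_(i <- s) eta i.
Proof. by rewrite -[mon R s]scale1r augU mul1r. Qed.
Lemma aug1 : aug 1 = 1. Proof. by rewrite -mon0 aug_mon big_nil. Qed.
Lemma augC c : aug c%:A = c. Proof. by rewrite augZ aug1 mulr1. Qed.
Lemma augX l : aug (lett l) = eta l. Proof. by rewrite aug_mon big_seq1. Qed.
Lemma augM u v : aug (u * v) = aug u * aug v.
Proof.
move: u; apply: fa_ind => [|u w Hu Hw|c s].
- by rewrite mul0r aug0 mul0r.
- by rewrite mulrDl !augD Hu Hw mulrDl.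
move: v; apply: fa_ind => [|u w Hu Hw|d t].
- by rewrite mulr0 aug0 mulr0.
- by rewrite mulrDr !augD Hu Hw mulrDr.
by rewrite monU_mul !augU big_cat /= mulrACA.
Qed.

(* [r] is a word read backwards. *)
Fixpoint foxs l (r : seq 'I_n) : A :=
  if r is x :: r' then (if x == l then mon R (rev r') else 0) + eta x *: foxs l r'
  else 0.

(** Letters are removed at the right end, so these are the coefficients in the left ideal generated
    by the [lett l - eta l], which is the kernel of [aug] (see [fox_decomp]). *)
Definition fox l : A -> A := lext (fun s => foxs l (rev s)).

Lemma fox0 l : fox l 0 = 0. Proof. exact: lext0. Qed.
Lemma foxD l u v : fox l (u + v) = fox l u + fox l v. Proof. exact: lextD. Qed.
Lemma foxB l u v : fox l (u - v) = fox l u - fox l v. Proof. exact: lextB. Qed.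
Lemma foxZ l c u : fox l (c *: u) = c *: fox l u. Proof. exact: lextZ. Qed.
Lemma fox_mon l s : fox l (mon R s) = foxs l (rev s). Proof. exact: lext_mon. Qed.

Lemma fox1 l : fox l 1 = 0.
Proof. by rewrite -mon0 fox_mon. Qed.

Lemma foxMX l u m :
  fox l (u * lett m) = (if m == l then u else 0) + eta m *: fox l u.
Proof.
move: u; apply: fa_ind => [|u v Hu Hv|c s].
- by rewrite mul0r !fox0 scaler0 addr0 if_same.
- rewrite mulrDl !foxD Hu Hv addrACA scalerDr; congr (_ + _).
  by case: ifP; rewrite ?addr0.
rewrite -scalerAl -mon_rcons !foxZ !fox_mon rev_rcons /= revK scalerDr !scalerA mulrC.
by congr (_ + _); case: ifP => _; rewrite ?scaler0.
Qed.

Lemma foxX l m : fox l (lett m) = (m == l)%:R.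
Proof. by rewrite -[lett m]mul1r foxMX fox1 scaler0 addr0; case: eqP. Qed.

Lemma foxM l u v : fox l (u * v) = u * fox l v + aug v *: fox l u.
Proof.
move: v u; apply: fa_rind => [v w Hv Hw|c v Hv||v m Hv] u.
- by rewrite mulrDr !foxD Hv Hw augD scalerDl mulrDr addrACA.
- by rewrite -fa_scaler !foxZ Hv augZ scalerDr scalerA fa_scaler.
- by rewrite mulr1 fox1 mulr0 add0r aug1 scale1r.
rewrite mulrA foxMX Hv foxMX augM augX scalerDr scalerA mulrDr addrA.
rewrite fa_scaler mulrC; congr (_ + _ + _).
by case: eqP; rewrite ?mulr0.
Qed.

Lemma foxC l c : fox l c%:A = 0.
Proof. by rewrite foxZ fox1 scaler0. Qed.

Lemma fox_decomp u :
  u = (aug u)%:A + \sum_l fox l u * (lett l - (eta l)%:A).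
Proof.
move: u; apply: fa_rind => [u v Hu Hv|c u Hu||u m Hu].
- rewrite {1}Hu {1}Hv addrACA augD scalerDl; congr (_ + _).
  by rewrite -big_split; apply: eq_bigr => l _; rewrite foxD mulrDl.
- rewrite {1}Hu scalerDr augZ scalerA; congr (_ + _).
  by rewrite scaler_sumr; apply: eq_bigr => l _; rewrite foxZ scalerAl.
- rewrite aug1 big1 ?addr0 ?scale1r // => l _.
  by rewrite fox1 mul0r.
under eq_bigr => l _ do rewrite foxMX mulrDl -scalerAl.
rewrite big_split -scaler_sumr /= (bigD1 m) //= eqxx big1 ?addr0; last first.
  by move=> l /negPf nl; rewrite eq_sym nl mul0r.
rewrite augM augX mulrC -scalerA addrCA -scalerDr -Hu.
by rewrite mulrBr -fa_scaler mulr1 subrK.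
Qed.
End Fox.

(** * The anti-automorphism that reverses words *)

Section Reverse.
Variables (R : comNzRingType) (n : nat).
Local Notation A := (FA R n).
Implicit Types (u v : A) (l : 'I_n).

Definition rv : A -> A := lext (fun s => mon R (rev s)).

Lemma rv0 : rv 0 = 0. Proof. exact: lext0. Qed.
Lemma rvD u v : rv (u + v) = rv u + rv v. Proof. exact: lextD. Qed.
Lemma rvB u v : rv (u - v) = rv u - rv v. Proof. exact: lextB. Qed.
Lemma rvZ c u : rv (c *: u) = c *: rv u. Proof. exact: lextZ. Qed.
Lemma rv_mon s : rv (mon R s) = mon R (rev s). Proof. exact: lext_mon. Qed.

Lemma rvM u v : rv (u * v) = rv v * rv u.
Proof.
move: u; apply: fa_ind => [|u u' Hu Hu'|c s].
- by rewrite mul0r !rv0 mulr0.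
- by rewrite mulrDl !rvD Hu Hu' mulrDr.
move: v; apply: fa_ind => [|u u' Hu Hu'|d t].
- by rewrite mulr0 !rv0 mul0r.
- by rewrite mulrDr !rvD Hu Hu' mulrDl.
by rewrite monU_mul !rvZ !rv_mon monU_mul mulrC rev_cat.
Qed.

Lemma rvK : involutive rv.
Proof.
move=> u; move: u; apply: fa_ind => [|u u' Hu Hu'|c s]; first by rewrite !rv0.
  by rewrite !rvD Hu Hu'.
by rewrite !rvZ !rv_mon revK.
Qed.

Lemma rvX l : rv (lett l) = lett l. Proof. by rewrite rv_mon. Qed.
Lemma rv1 : rv 1 = 1. Proof. by rewrite -mon0 rv_mon. Qed.
Lemma rvC c : rv c%:A = c%:A. Proof. by rewrite rvZ rv1. Qed.

Lemma rv_eq0 u : (rv u == 0) = (u == 0).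
Proof. by rewrite -{1}rv0 (inj_eq (can_inj rvK)). Qed.
End Reverse.

Lemma gev_rv (R R' : comNzRingType) (phi : {rmorphism R -> R'}) n n'
  (U : 'I_n -> FA R' n') u :
  rv (gev phi U u) = gev phi (fun l => rv (U l)) (rv u).
Proof.
have E x : rv (gev phi U (rv x)) = gev phi (fun l => rv (U l)) x.
  apply: (gev_unique (h := fun u => rv (gev phi U (rv u)))) => [y y'||c y|y l].
  - by rewrite !(rvD, gevD).
  - by rewrite !(rv1, gev1).
  - by rewrite !(rvZ, gevZ).
  by rewrite !(rvM, gevM, rvX, gevX).
by rewrite -E rvK.
Qed.

(** * Weights *)

Lemma seq_max (Q : realFieldType) (T : eqType) (f : T -> Q) (s : seq T) x0 : x0 \in s ->
  exists2 x, x \in s & forall y, y \in s -> f y <= f x.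
Proof.
elim: s x0 => // x s IH x0 _; case: s IH => [_|x1 s /(_ x1 (mem_head _ _))[y ys my]].
  by exists x; rewrite ?inE // => y; rewrite inE => /eqP->.
case: (lerP (f x) (f y)) => xy.
  exists y => [|w]; first by rewrite in_cons ys orbT.
  by rewrite in_cons => /orP[/eqP->//|/my].
exists x => [|w]; first exact: mem_head.
by rewrite in_cons => /orP[/eqP->//|/my /le_trans-> //]; apply: ltW.
Qed.

Section Weights.
Variables (Q : realFieldType) (R : comNzRingType) (n : nat) (wt : 'I_n -> Q).
Local Notation A := (FA R n).
Implicit Types (u v : A) (w : seq 'I_n).

(** Weights lie in an ordered field and may be negative: the weight given to the letter [y4] in
    [choose_s] is a minimum of quotients of differences. *)
Definition wtw (w : seq 'I_n) : Q := \sum_(l <- w) wt l.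

Lemma wtwM w w' : wtw (w ++ w') = wtw w + wtw w'.
Proof. by rewrite /wtw big_cat. Qed.

Lemma wtw1 : wtw [::] = 0.
Proof. by rewrite /wtw big_nil. Qed.

Lemma wtwU l : wtw ([:: l]) = wt l.
Proof. by rewrite /wtw big_seq1. Qed.

Definition Fil m u := supp (fun w => wtw w <= m) u.
Definition Hom m u := supp (fun w => wtw w = m) u.
Definition comp m (u : A) : A := proj (fun w => wtw w == m) u.

Lemma Fil0 m : Fil m 0. Proof. exact: supp0. Qed.
Lemma FilD m u v : Fil m u -> Fil m v -> Fil m (u + v). Proof. exact: suppD. Qed.
Lemma FilB m u v : Fil m u -> Fil m v -> Fil m (u - v). Proof. exact: suppB. Qed.
Lemma FilZ m c u : Fil m u -> Fil m (c *: u). Proof. exact: suppZ. Qed.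
Lemma Hom0 m : Hom m 0. Proof. exact: supp0. Qed.
Lemma HomD m u v : Hom m u -> Hom m v -> Hom m (u + v). Proof. exact: suppD. Qed.
Lemma HomN m u : Hom m u -> Hom m (- u). Proof. exact: suppN. Qed.
Lemma HomB m u v : Hom m u -> Hom m v -> Hom m (u - v). Proof. exact: suppB. Qed.
Lemma HomZ m c u : Hom m u -> Hom m (c *: u). Proof. exact: suppZ. Qed.
Lemma comp0 m : comp m 0 = 0. Proof. exact: proj0. Qed.
Lemma compD m u v : comp m (u + v) = comp m u + comp m v. Proof. exact: projD. Qed.
Lemma compB m u v : comp m (u - v) = comp m u - comp m v. Proof. exact: projB. Qed.
Lemma compZ m c u : comp m (c *: u) = c *: comp m u. Proof. exact: projZ. Qed.
Lemma compU m c w : comp m (c *: mon R w) = if wtw w == m then (c *: mon R w) else 0.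
Proof. exact: projU. Qed.

Lemma HomFil m u : Hom m u -> Fil m u.
Proof. by apply: suppW => w ->. Qed.

Lemma FilW m m' u : m <= m' -> Fil m u -> Fil m' u.
Proof. by move=> le; apply: suppW => w /le_trans; apply. Qed.

Lemma FilM m k u v : Fil m u -> Fil k v -> Fil (m + k) (u * v).
Proof. by apply: supp_mul => w w' ? ?; rewrite wtwM lerD. Qed.

Lemma HomM m k u v : Hom m u -> Hom k v -> Hom (m + k) (u * v).
Proof. by apply: supp_mul => w w' <- <-; rewrite wtwM. Qed.

Lemma Hom1 : Hom 0 1.
Proof. by apply: supp1; rewrite wtw1. Qed.

Lemma HomX l : Hom (wt l) (lett l).
Proof. by apply: supp_mon; rewrite wtwU. Qed.

Lemma Hom_eq m m' u : Hom m u -> m = m' -> Hom m' u.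
Proof. by move=> ? <-. Qed.

Lemma Hom_comp m u : Hom m (comp m u).
Proof. by move=> w /supp_proj/eqP. Qed.

Lemma comp_id m u : Hom m u -> comp m u = u.
Proof. by move=> Hu; apply: proj_id; apply: suppW Hu => w ->. Qed.

Lemma comp_lt m k u : Fil k u -> k < m -> comp m u = 0.
Proof.
move=> Fu km; apply: proj_0; apply: suppW Fu => w wk; apply/eqP => wm.
by move: km; rewrite -wm ltNge wk.
Qed.

Lemma comp_ne m k u : Hom k u -> k <> m -> comp m u = 0.
Proof. by move=> Fu km; apply: proj_0; apply: suppW Fu => w ->; apply/eqP. Qed.

Lemma Fil_lt m u : Fil m u -> comp m u = 0 -> supp (fun w => wtw w < m) u.
Proof.
move=> Fu u0 w nz; rewrite lt_neqAle Fu // andbT; apply: contraNneq nz => wm.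
by have := congr1 (cf w) u0; rewrite cf_proj wm eqxx cf0 => ->.
Qed.

Lemma comp_mul m k u v : Fil m u -> Fil k v -> comp (m + k) (u * v) = comp m u * comp k v.
Proof.
move=> Fu Fv; move: u Fu; apply: fa_suppind => [|u u' Hu Hu'|c w wm].
- by rewrite mul0r !comp0 mul0r.
- by rewrite mulrDl !compD mulrDl -Hu -Hu'.
move: v Fv; apply: fa_suppind => [|v v' Hv Hv'|d w' wk].
- by rewrite mulr0 !comp0 mulr0.
- by rewrite mulrDr !compD mulrDr -Hv -Hv'.
rewrite monU_mul !compU wtwM.
case: (eqVneq (wtw w) m) => [->|nm].
  rewrite (inj_eq (addrI m)); case: eqP => _; last by rewrite mulr0.
  by rewrite monU_mul.
rewrite mul0r; case: eqP => // E; move: nm; rewrite -subr_eq0 => nm.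
by exfalso; move/eqP: nm; apply; lra.
Qed.

Lemma comp_mull m k u v : Hom m u -> comp (m + k) (u * v) = u * comp k v.
Proof.
move=> Hu; move: u Hu; apply: fa_suppind => [|u u' Hu Hu'|c w wm].
- by rewrite mul0r !comp0 mul0r.
- by rewrite mulrDl !compD mulrDl -Hu -Hu'.
move: v; apply: fa_ind => [|v v' Hv Hv'|d w'].
- by rewrite mulr0 !comp0 mulr0.
- by rewrite mulrDr !compD mulrDr -Hv -Hv'.
rewrite monU_mul !compU wtwM wm (inj_eq (addrI m)); case: eqP => _.
  by rewrite monU_mul.
by rewrite mulr0.
Qed.

Lemma top_exists u : u != 0 -> exists2 m, Fil m u & comp m u != 0.
Proof.
move=> nz; have [w0 nz0] := neq0_supp nz.
have [|w wu wmax] := @seq_max _ _ wtw (fa_supp u) w0; first by rewrite mem_supp.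
exists (wtw w) => [w'|]; first by rewrite -mem_supp => /wmax.
rewrite mem_supp in wu; apply: contraNneq wu => u0.
by have := congr1 (cf w) u0; rewrite cf_proj eqxx cf0 => ->.
Qed.

End Weights.

Section GevGraded.
Variables (R R' : comNzRingType) (phi : {rmorphism R -> R'}) (n n' : nat).
Variable U : 'I_n -> FA R' n'.
Variables (Q : realFieldType) (wt : 'I_n -> Q).
Local Notation A' := (FA R' n').

(** One induction for every notion of degree that adds up along products. It serves for [Hom] and,
    later, for the bound [Bd] on prefixes. *)
Lemma gev_graded (L : pred 'I_n) (G : Q -> A' -> Prop) :
    (forall a, G a 0) -> (forall a u v, G a u -> G a v -> G a (u + v)) ->
    (forall a c u, G a u -> G a (c *: u)) -> G 0 1 ->
    (forall a u l, L l -> G a u -> G (a + wt l) (u * U l)) ->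
  forall m u, Hom wt m u -> supp (fun w : seq 'I_n => all L w) u -> G m (gev phi U u).
Proof.
move=> G0 GD GZ G1 GM m u Hu Lu; move: u {Hu Lu}(supp_and Hu Lu).
apply: fa_suppind => [|u v Hu' Hv|c s [<-] Ls].
- by rewrite gev0.
- by rewrite gevD; apply: GD.
rewrite gevU; apply: GZ; move: Ls; rewrite /wtw => Ls; elim/last_ind: s Ls => [|s l IH].
  by rewrite !big_nil.
rewrite all_rcons => /andP[Ll Ls].
by rewrite -cats1 !big_cat !big_seq1; apply: GM => //; apply: IH.
Qed.

Variable wt' : 'I_n' -> Q.

Lemma Hom_gev m u : (forall l, Hom wt' (wt l) (U l)) -> Hom wt m u ->
  Hom wt' m (gev phi U u).
Proof.
move=> HU Hu; apply: (gev_graded (L := predT) (G := Hom wt')) (Hu) _ => //.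
- by move=> *; exact: Hom0.
- by move=> *; apply: HomD.
- by move=> *; apply: HomZ.
- exact: Hom1.
- by move=> a v l _ Ha; apply: HomM.
by move=> w _; apply: all_predT.
Qed.

Lemma FilU_gev (w : seq 'I_n) : (forall l, Fil wt' (wt l) (U l)) ->
  Fil wt' (wtw wt w) (\prod_(l <- w) U l).
Proof.
move=> FU; rewrite /wtw; elim: w => [|l s IH].
  by rewrite !big_nil; apply/HomFil/Hom1.
by rewrite !big_cons; apply: FilM.
Qed.

Lemma Fil_gev m u : (forall l, Fil wt' (wt l) (U l)) -> Fil wt m u ->
  Fil wt' m (gev phi U u).
Proof.
move=> FU; move: u; apply: fa_suppind => [|u v Hu Hv|c w wm].
- by rewrite gev0; exact: Fil0.
- by rewrite gevD; apply: FilD.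
by rewrite gevU; apply: FilZ; apply: FilW wm _; apply: FilU_gev.
Qed.

(** Passage to leading forms turns an identity between substitutions into one between leading forms.
    When the value on the left has a smaller degree than expected, the leading forms satisfy a
    relation. *)
Lemma comp_gev m u : (forall l, Fil wt' (wt l) (U l)) -> Fil wt m u ->
  comp wt' m (gev phi U u) = gev phi (fun l => comp wt' (wt l) (U l)) (comp wt m u).
Proof.
move=> FU; move: u; apply: fa_suppind => [|u v Hu Hv|c w wm].
- by rewrite !(gev0, comp0).
- by rewrite gevD !compD gevD -Hu -Hv.
rewrite gevU [LHS]compZ compU.
case: eqVneq => [<-|ne]; last first.
  rewrite (comp_lt (FilU_gev (w := w) FU)) ?gev0 ?scaler0 //.
  by rewrite lt_neqAle ne.
rewrite gevU; congr (_ *: _); rewrite /wtw.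
have FU' s : Fil wt' (\sum_(l <- s) wt l) (\prod_(l <- s) U l).
  exact: FilU_gev.
elim: w {wm} => [|l s IH]; first by rewrite !big_nil comp_id //; apply: Hom1.
by rewrite !big_cons -IH comp_mul //; apply: FU'.
Qed.

End GevGraded.

Section FoxSupp.
Variables (R : comNzRingType) (n : nat) (eta : 'I_n -> R).
Local Notation A := (FA R n).
Implicit Types (u v : A) (w : seq 'I_n) (l : 'I_n).

(** The letters to the right of the removed [l] have been replaced by their augmentations, so a term
    survives only if all of these are nonzero. *)
Lemma supp_fox (P Q : seq 'I_n -> Prop) l u :
    (forall s s', P (s ++ l :: s') -> all (fun x => eta x != 0) s' ->
       Q s) ->
  supp P u -> supp Q (fox eta l u).
Proof.
move=> PQ; move: u; apply: fa_suppind => [|u v Hu Hv|c s Ps].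
- by rewrite fox0; apply: supp0.
- by rewrite foxD; apply: suppD.
rewrite foxZ fox_mon; apply: suppZ.
have: forall r s', all (fun x => eta x != 0) s' -> P (rev r ++ s') ->
    supp Q (foxs eta l r).
  elim=> [|x r IH] s' es' Pr /=; first exact: supp0.
  rewrite rev_cons cat_rcons in Pr.
  apply: suppD.
    case: eqP Pr => [->|_] Pr; last exact: supp0.
    by apply: supp_mon; apply: PQ Pr es'.
  case: (eqVneq (eta x) 0) => [->|ex]; first by rewrite scale0r; apply: supp0.
  by apply: suppZ; apply: IH Pr => /=; rewrite ex.
by move/(_ (rev s) [::] isT); rewrite revK cats0; apply.
Qed.

Lemma aug_supp (P : seq 'I_n -> Prop) u :
  (forall w, P w -> has (fun x => eta x == 0) w) -> supp P u -> aug eta u = 0.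
Proof.
move=> P0; move: u; apply: fa_suppind => [|u v Hu Hv|c w /P0 h0].
- exact: aug0.
- by rewrite augD Hu Hv addr0.
rewrite augU.
have /hasP[x xw /eqP ex] := h0.
by rewrite (big_rem x xw) /= ex mul0r mulr0.
Qed.

(** Unlike the weights used below, the length counts [z] as well, so every derivative lowers it; it
    is the measure of the inductions on relations. *)
Definition Len k u := supp (fun w : seq 'I_n => (size w <= k)%N) u.

Lemma Len_fox k l u : Len k.+1 u -> Len k (fox eta l u).
Proof.
apply: supp_fox => s s'; rewrite size_cat /= addnS ltnS => le _.
by apply: leq_trans le; apply: leq_addr.
Qed.

Lemma Len0_fox l u : Len 0 u -> fox eta l u = 0.
Proof.
move=> L0; apply: supp_contra; apply: supp_fox L0 => s s'.
by rewrite size_cat addnS.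
Qed.

Lemma Len_exists u : exists k, Len k u.
Proof.
move: u; apply: fa_ind => [|u v [k Hu] [k' Hv]|c w].
- by exists 0%N; apply: supp0.
- exists (maxn k k'); apply: suppD.
    by apply: suppW Hu => w /leq_trans-> //; apply: leq_maxl.
  by apply: suppW Hv => w /leq_trans-> //; apply: leq_maxr.
by exists (size w); apply: suppU.
Qed.

Lemma Len0E u : Len 0 u -> u = (aug eta u)%:A.
Proof.
move=> L0; rewrite [LHS](fox_decomp eta) big1 ?addr0 // => l _.
by rewrite Len0_fox ?mul0r.
Qed.

Variables (Q : realFieldType) (wt : 'I_n -> Q).
Hypothesis wt_eta : forall l, eta l != 0 -> wt l = 0.

Lemma wtw_eta (s : seq 'I_n) : all (fun x => eta x != 0) s -> \sum_(l <- s) wt l = 0.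
Proof.
by move=> es; rewrite big_seq big1 // => l ls; apply: wt_eta; apply: (allP es).
Qed.

Lemma Hom_fox m l u : Hom wt m u -> Hom wt (m - wt l) (fox eta l u).
Proof.
apply: supp_fox => s s' <- es; rewrite /wtw big_cat big_cons /= (wtw_eta es).
by rewrite addr0 addrK.
Qed.

Lemma Hom_aug m u : Hom wt m u -> m <> 0 -> aug eta u = 0.
Proof.
move=> Hu m0; apply: aug_supp Hu => w wm; rewrite -[has _ _]negbK -all_predC.
by apply: contra_notN m0 => /wtw_eta h; rewrite -wm.
Qed.

End FoxSupp.

Section ReverseSupp.
Variables (R : comNzRingType) (n : nat).
Local Notation A := (FA R n).
Implicit Types (u v : A).

Lemma supp_rv (P Q : seq 'I_n -> Prop) u : (forall s, P s -> Q (rev s)) ->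
  supp P u -> supp Q (rv u).
Proof.
move=> PQ; move: u; apply: fa_suppind => [|u v Hu Hv|c s Ps].
- by rewrite rv0; apply: supp0.
- by rewrite rvD; apply: suppD.
by rewrite rvZ rv_mon; apply: suppU; apply: PQ.
Qed.

Lemma Hom_rv (Q : realFieldType) (wt : 'I_n -> Q) m u : Hom wt m u -> Hom wt m (rv u).
Proof.
apply: supp_rv => s <-; rewrite /wtw.
by apply: perm_big; rewrite perm_rev.
Qed.

Lemma Fil_rv (Q : realFieldType) (wt : 'I_n -> Q) m u : Fil wt m u -> Fil wt m (rv u).
Proof.
apply: supp_rv => s; rewrite /wtw.
by rewrite (perm_big (rev s)) // perm_sym perm_rev.
Qed.

Lemma comp_rv (Q : realFieldType) (wt : 'I_n -> Q) m u : comp wt m (rv u) = rv (comp wt m u).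
Proof.
move: u; apply: fa_ind => [|u v Hu Hv|c s].
- by rewrite !(rv0, comp0).
- by rewrite rvD !compD rvD -Hu -Hv.
rewrite rvZ rv_mon !compU (_ : wtw wt (rev s) = wtw wt s).
  by case: ifP => _; rewrite ?rvZ ?rv_mon ?rv0.
by rewrite /wtw; apply: perm_big; rewrite perm_rev.
Qed.

End ReverseSupp.

Definition lfree (R : comNzRingType) n (t : 'I_n) (u : FA R n) :=
  supp (fun w : seq 'I_n => t \notin w) u.

(** * Free algebras over a domain *)

Section Domain.
Variables (R : idomainType) (n : nat).
Local Notation A := (FA R n).
Implicit Types (u v : A) (w : seq 'I_n) (l : 'I_n).

(** A word of length [a + b] splits in only one way into words of the maximal lengths [a] and
    [b]. *)
Lemma cf_topM a b u v w w' : Len a u -> Len b v ->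
    size w = a -> size w' = b ->
  cf (w ++ w') (u * v) = cf w u * cf w' v.
Proof.
move=> La Lb sw sw'; move: u La; apply: fa_suppind => [|u u' Hu Hu'|c x xa].
- by rewrite mul0r !cf0 mul0r.
- by rewrite mulrDl !cfD Hu Hu' mulrDl.
move: v Lb; apply: fa_suppind => [|u u' Hu Hu'|d y yb].
- by rewrite mulr0 !cf0 mulr0.
- by rewrite mulrDr !cfD Hu Hu' mulrDr.
rewrite monU_mul !cfZ !cf_mon mulrACA -natrM; congr (_ * _%:R).
have [sx|nsx] := eqVneq (size (x)) (size w).
  by rewrite eqseq_cat //; case: (_ == _); case: (_ == _).
have xw : (x == w) = false by apply: contraNF nsx => /eqP->.
have xyw : (x ++ y == w ++ w') = false.
  apply: contraNF nsx => /eqP/(congr1 size); rewrite !size_cat => E.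
  rewrite -sw in xa; rewrite -sw' in yb.
  rewrite eqn_leq xa /=.
  by rewrite -(leq_add2r (size (y))) E leq_add2l.
by rewrite xw xyw ?mul0n ?muln0.
Qed.

Lemma fa_mulf_eq0 u v : u * v = 0 -> u = 0 \/ v = 0.
Proof.
move=> uv; case: (eqVneq u 0) => [|nu]; first by left.
case: (eqVneq v 0) => [|nv]; first by right.
have H (x : A) : x != 0 -> exists2 w, Len (size w) x & cf w x != 0.
  move=> /neq0_supp[w0]; rewrite -mem_supp => w0u.
  have [w wu wmax] := seq_max (fun w : seq 'I_n => (size w)%:R : rat) w0u.
  exists w => [w' nz'|]; last by rewrite -mem_supp.
  by move: (wmax w'); rewrite mem_supp => /(_ nz'); rewrite ler_nat.
have [w Lw nw] := H _ nu; have [w' Lw' nw'] := H _ nv.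
have /esym/eqP := cf_topM Lw Lw' (erefl _) (erefl _).
by rewrite uv cf0 mulf_eq0 (negPf nw) (negPf nw').
Qed.

Lemma fa_mulf_neq0 u v : u != 0 -> v != 0 -> u * v != 0.
Proof. by move=> nu nv; apply/eqP => /fa_mulf_eq0[] /eqP; apply/negP. Qed.

Lemma fa_mulfI u v v' : u != 0 -> u * v = u * v' -> v = v'.
Proof.
move=> nu /eqP; rewrite -subr_eq0 -mulrBr => /eqP/fa_mulf_eq0[/eqP|/eqP].
  by rewrite (negPf nu).
by rewrite subr_eq0 => /eqP.
Qed.

Lemma fa_mulIf u v v' : u != 0 -> v * u = v' * u -> v = v'.
Proof.
move=> nu /eqP; rewrite -subr_eq0 -mulrBl => /eqP/fa_mulf_eq0[/eqP|/eqP].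
  by rewrite subr_eq0 => /eqP.
by rewrite (negPf nu).
Qed.

Lemma faZ_neq0 (c : R) u : c != 0 -> u != 0 -> c *: u != 0.
Proof.
move=> nc /neq0_supp[w nw]; apply: contraNneq nw => /(congr1 (cf w)).
by rewrite cf0 cfZ => /eqP; rewrite mulf_eq0 (negPf nc).
Qed.

Lemma faZ_eq0 (c : R) u : c != 0 -> c *: u = 0 -> u = 0.
Proof. by move=> nc /eqP; apply: contraTeq => nu; apply: faZ_neq0. Qed.

Lemma Fil_mulf_le (Q : realFieldType) (wt : 'I_n -> Q) a b m u v : Fil wt m (u * v) -> Fil wt a u -> comp wt a u != 0 ->
  Fil wt b v -> comp wt b v != 0 -> a + b <= m.
Proof.
move=> Fm Fa na Fb nb; rewrite leNgt; apply/negP => lt.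
have := fa_mulf_neq0 na nb; rewrite -comp_mul //.
by rewrite (comp_lt Fm) ?eqxx.
Qed.

Lemma lfree_wt t w : (t \notin w) <-> wtw (fun l => (l == t)%:R : rat) w <= 0.
Proof.
rewrite /wtw; elim: w => [|l s IH]; first by rewrite big_nil.
have s0 : 0 <= \sum_(j <- s) (j == t)%:R :> rat by apply: sumr_ge0 => j _; apply: ler0n.
rewrite big_cons in_cons negb_or eq_sym; case: (l == t) => /=.
  by split=> //; move: s0; lra.
by rewrite add0r.
Qed.

(** The degree in [t] is a weight. In a domain top weights add up, and here they are nonnegative
    with sum at most 0. *)
Lemma lfree_mulf t u v : lfree t (u * v) -> u != 0 -> v != 0 -> lfree t u /\ lfree t v.
Proof.
move=> tuv nu nv; pose wt (l : 'I_n) : rat := (l == t)%:R.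
have F0 (x : A) : lfree t x <-> Fil wt 0 x.
  by split; apply: suppW => w /lfree_wt.
have ge0 m (x : A) : Fil wt m x -> comp wt m x != 0 -> 0 <= m.
  move=> Fm /neq0_supp[w]; rewrite cf_proj; case: (wtw wt w =P m) => [<- _|]; last by rewrite eqxx.
  by apply: sumr_ge0 => j _; apply: ler0n.
have [a Fa na] := top_exists wt nu; have [b Fb nb] := top_exists wt nv.
have := Fil_mulf_le (proj1 (F0 _) tuv) Fa na Fb nb.
move: (ge0 _ _ Fa na) (ge0 _ _ Fb nb) => a0 b0 ab.
by split; apply/F0; [apply: FilW Fa | apply: FilW Fb]; lra.
Qed.

End Domain.

(** * The action of F[s, t] *)

Section ZPoly.
Variables (R : comNzRingType) (n : nat) (z : 'I_n).
Local Notation A := (FA R n).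

Fact zp_comm : commr_rmorph (in_alg A) (lett z : A).
Proof. by move=> c; apply/commr_sym; apply: fa_comC. Qed.

Definition zp (p : {poly R}) : A := locked_with seal_key (horner_morph zp_comm) p.

Let zpEm p : zp p = horner_morph zp_comm p.
Proof. by rewrite /zp locked_withE. Qed.

Lemma zp0 : zp 0 = 0. Proof. by rewrite !zpEm (rmorph0 (horner_morph zp_comm)). Qed.
Lemma zp1 : zp 1 = 1. Proof. by rewrite !zpEm (rmorph1 (horner_morph zp_comm)). Qed.
Lemma zpD p q : zp (p + q) = zp p + zp q. Proof. by rewrite !zpEm (rmorphD (horner_morph zp_comm)). Qed.
Lemma zpB p q : zp (p - q) = zp p - zp q. Proof. by rewrite !zpEm (rmorphB (horner_morph zp_comm)). Qed.
Lemma zpN p : zp (- p) = - zp p. Proof. by rewrite !zpEm (rmorphN (horner_morph zp_comm)). Qed.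
Lemma zpM p q : zp (p * q) = zp p * zp q. Proof. by rewrite !zpEm (rmorphM (horner_morph zp_comm)). Qed.
Lemma zpX : zp 'X = lett z. Proof. by rewrite zpEm horner_morphX. Qed.
Lemma zpC c : zp c%:P = c%:A. Proof. by rewrite zpEm horner_morphC. Qed.

Lemma zp_ind (C : A -> Prop) : (forall c, C c%:A) ->
    (forall u v, C u -> C v -> C (u + v)) -> (forall u, C u -> C (u * lett z)) ->
  forall p, C (zp p).
Proof.
move=> CC CD CX p; elim/poly_ind: p => [|p c IH]; first by rewrite zp0; have := CC 0; rewrite scale0r.
by rewrite zpD zpM zpX zpC; apply: CD => //; apply: CX.
Qed.

Lemma zpE p : zp p = \sum_(i < size p) p`_i *: lett z ^+ i.
Proof.
rewrite -{1}[p]coefK poly_def.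
elim/big_rec2: _ => [|i y1 y2 _ <-]; first exact: zp0.
rewrite zpD -mul_polyC zpM zpC mulr_algl; congr (_ *: _ + _).
by elim: (i : nat) => [|j IH]; rewrite ?expr0 ?zp1 // !exprS zpM zpX IH.
Qed.

Lemma supp_zp (P : seq 'I_n -> Prop) p : P [::] -> (forall w, P w -> P (w ++ [:: z])) -> 
  supp P (zp p).
Proof.
move=> P1 Pz; apply: zp_ind => [c|u v|u Pu]; first exact: suppC.
  exact: suppD.
by apply: supp_mul (Pu) (supp_mon (P := fun w => w = [:: z]) _) => // w _ /Pz Pw ->.
Qed.

Lemma Hom_zp (Q : realFieldType) (wt : 'I_n -> Q) p : wt z = 0 -> Hom wt 0 (zp p).
Proof.
move=> wz; apply: supp_zp => [|w w0]; first exact: wtw1.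
by rewrite wtwM wtwU wz w0 addr0.
Qed.

Lemma rv_zp p : rv (zp p) = zp p.
Proof.
suff C (u : A) : rv u = u -> lett z * u = u * lett z -> rv (u * lett z) = u * lett z.
  have: rv (zp p) = zp p /\ lett z * zp p = zp p * lett z; last by case.
  apply: (zp_ind (C := fun u => rv u = u /\ lett z * u = u * lett z)).
  - by move=> c; rewrite rvC fa_comC.
  - by move=> u v [ru zu] [rw zv]; rewrite rvD ru rw mulrDr zu zv mulrDl.
  by move=> u [ru zu]; rewrite C // mulrA zu.
by move=> ru zu; rewrite rvM ru rvX.
Qed.

End ZPoly.

Lemma gevz_zp (R : comNzRingType) n n' (z : 'I_n) (z' : 'I_n')
    (U : 'I_n -> FA R n') p :
  U z = lett z' -> gev idfun U (zp z p) = zp z' p.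
Proof.
move=> Uz; elim/poly_ind: p => [|p c IH]; first by rewrite !zp0 gev0.
by rewrite !(zpD, zpM, zpX, zpC, gevD, gevM, gevX, gevC) IH Uz.
Qed.

Lemma zp_eq0 (R : comNzRingType) n (z : 'I_n) (p : {poly R}) : zp z p = 0 -> p = 0.
Proof.
have K q : aug (fun=> 'X) (gev polyC lett (zp z q)) = q.
  elim/poly_ind: q => [|q c IH]; first by rewrite zp0 gev0 aug0.
  by rewrite !(zpD, zpM, zpX, zpC, gevD, gevM, gevX, gevC, augD, augM, augX, augC) IH.
by move=> p0; rewrite -[p]K p0 gev0 aug0.
Qed.

(** * Powers of [z] at the right end as coefficients *)

Section Lambda.
Variables (R : comNzRingType) (n : nat) (z : 'I_n).
Local Notation A := (FA R n).
Local Notation AP := (FA {poly R} n).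
Implicit Types (u v : A) (x y : AP) .

Definition bc : A -> AP := gev polyC lett.

Lemma bc0 : bc 0 = 0. Proof. exact: gev0. Qed.
Lemma bcD u v : bc (u + v) = bc u + bc v. Proof. exact: gevD. Qed.
Lemma bcB u v : bc (u - v) = bc u - bc v. Proof. exact: gevB. Qed.
Lemma bcM u v : bc (u * v) = bc u * bc v. Proof. exact: gevM. Qed.
Lemma bcX l : bc (lett l) = lett l. Proof. exact: gevX. Qed.
Lemma bcC c : bc c%:A = c%:P%:A. Proof. exact: gevC. Qed.
Lemma bcU c w : bc (c *: mon R w) = (c%:P *: mon {poly R} w).
Proof.
rewrite /bc gevU /=; congr (_ *: _).
elim/last_ind: w => [|w l IH]; first by rewrite big_nil mon0.
by rewrite -cats1 big_cat big_seq1 IH monM.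
Qed.

Lemma supp_bc (P : seq 'I_n -> Prop) u : supp P u -> supp P (bc u).
Proof.
move: u; apply: fa_suppind => [|u v Hu Hv|c w Pw]; first by rewrite bc0; apply: supp0.
  by rewrite bcD; apply: suppD.
by rewrite bcU; apply: suppU.
Qed.

(** The quotient map by the left ideal of [z - 'X], which it kills ([lam_zX]). It is not
    multiplicative, only left linear over [bc] ([lam_bcM]). *)
Definition lam : AP -> A := aext (fun w (c : {poly R}) => mon R w * zp z c).

Let lamg_zmod w : zmod_morphism (fun c : {poly R} => mon R w * zp z c).
Proof. by move=> c d; rewrite zpB mulrBr. Qed.

Lemma lam0 : lam 0 = 0. Proof. exact: aext0. Qed.
Lemma lamD x y : lam (x + y) = lam x + lam y. Proof. exact: aextD. Qed.
Lemma lamB x y : lam (x - y) = lam x - lam y. Proof. exact: aextB. Qed.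
Lemma lamN x : lam (- x) = - lam x. Proof. exact: aextN. Qed.

Lemma lamU c w : lam (c *: mon {poly R} w) = mon R w * zp z c.
Proof. exact: aextU. Qed.

Lemma lamUM c w y : lam ((c *: mon {poly R} w) * y) = mon R w * lam y * zp z c.
Proof.
move: y; apply: fa_ind => [|u v Hu Hv|d w'].
- by rewrite mulr0 lam0 mulr0 mul0r.
- by rewrite mulrDr !lamD mulrDr mulrDl -Hu -Hv.
by rewrite monU_mul !lamU mulrC zpM !mulrA monM.
Qed.

Lemma lamZ c y : lam (c *: y) = lam y * zp z c.
Proof. by rewrite -mulr_algl -mon0 lamUM mon0 mul1r. Qed.

Lemma lam_mulr x y y' : lam y = lam y' -> lam (x * y) = lam (x * y').
Proof.
move=> E; move: x; apply: fa_ind => [|u v Hu Hv|d w].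
- by rewrite !mul0r.
- by rewrite !mulrDl !lamD Hu Hv.
by rewrite !lamUM E.
Qed.

Lemma lam_bcM u y : lam (bc u * y) = u * lam y.
Proof.
move: u; apply: fa_ind => [|u v Hu Hv|d w].
- by rewrite bc0 !mul0r lam0.
- by rewrite bcD !mulrDl !lamD Hu Hv.
by rewrite bcU lamUM zpC -fa_comC mulr_algl -scalerAl.
Qed.

Lemma lamC c : lam c%:A = zp z c.
Proof. by rewrite -mon0 lamU mon0 mul1r. Qed.

Lemma lam1 : lam 1 = 1.
Proof. by rewrite -[1]scale1r lamC zp1. Qed.

Lemma lam_bc u : lam (bc u) = u.
Proof. by rewrite -[bc u]mulr1 lam_bcM lam1 mulr1. Qed.

Lemma lam_bclam x y : lam (x * bc (lam y)) = lam (x * y).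
Proof. by apply: lam_mulr; rewrite lam_bc. Qed.

Lemma lam_zX x : lam (x * (lett z - 'X%:A)) = 0.
Proof.
rewrite (@lam_mulr _ _ 0) ?mulr0 ?lam0 // lamB lamC zpX.
by rewrite -bcX lam_bc subrr.
Qed.

Lemma supp_lam (P : seq 'I_n -> Prop) x : (forall w, P w -> P (w ++ [:: z])) ->
  supp P x -> supp P (lam x).
Proof.
move=> Pz; move: x; apply: fa_suppind => [|u v Hu Hv|c w Pw].
- by rewrite lam0; apply: supp0.
- by rewrite lamD; apply: suppD.
rewrite lamU.
apply: (@supp_mul R n (eq w) (fun s => P (w ++ s)) P (mon R w) (zp z c)).
- by move=> k l <-.
- exact: supp_mon.
by apply: supp_zp => [|s]; rewrite ?cats0 // catA; apply: Pz.
Qed.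

Lemma Hom_lam (Q : realFieldType) (wt : 'I_n -> Q) m x : wt z = 0 -> Hom wt m x -> Hom wt m (lam x).
Proof. by move=> wz; apply: supp_lam => w; rewrite wtwM wtwU wz addr0. Qed.

(* The Fox derivatives for the augmentation [z |-> 'X]; modulo the left ideal
   generated by [z - 'X], a trailing power of [z] becomes a coefficient. *)
Definition etaz (l : 'I_n) : {poly R} := if l == z then 'X else 0.

(** The normal form of [x] modulo the left ideal of [z - 'X], without its constant [aug (etaz z) x]:
    a combination of words that end in a letter other than [z] (see [rh_decomp]). *)
Definition rh x : AP :=
  locked_with seal_key (fun x => \sum_(l | l != z) fox etaz l x * lett l : AP) x.

Lemma rhE x : rh x = \sum_(l | l != z) fox etaz l x * lett l.
Proof. by rewrite /rh locked_withE. Qed.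

Lemma rh0 : rh 0 = 0.
Proof. by rewrite !rhE big1 // => l _; rewrite fox0 mul0r. Qed.
Lemma rhD x y : rh (x + y) = rh x + rh y.
Proof. by rewrite !rhE -big_split; apply: eq_bigr => l _; rewrite foxD mulrDl. Qed.
Lemma rhZ c x : rh (c *: x) = c *: rh x.
Proof. by rewrite !rhE scaler_sumr; apply: eq_bigr => l _; rewrite foxZ scalerAl. Qed.
Lemma rhN x : rh (- x) = - rh x.
Proof. by rewrite -scaleN1r rhZ scaleN1r. Qed.
Lemma rhB x y : rh (x - y) = rh x - rh y.
Proof. by rewrite rhD rhN. Qed.

Lemma rhM x y : rh (x * y) = x * rh y + aug etaz y *: rh x.
Proof.
rewrite !rhE mulr_sumr scaler_sumr -big_split /=; apply: eq_bigr => l _.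
by rewrite foxM mulrDl mulrA scalerAl.
Qed.

Lemma rhM0 x y : aug etaz y = 0 -> rh (x * y) = x * rh y.
Proof. by move=> y0; rewrite rhM y0 scale0r addr0. Qed.

Lemma rhX l : rh (lett l) = if l == z then 0 else lett l.
Proof.
rewrite rhE; case: eqVneq => [->|lz].
  by rewrite big1 // => m mz; rewrite foxX eq_sym (negPf mz) mul0r.
rewrite (bigD1 l) //= big1 ?addr0 => [|m /andP[_ ml]]; rewrite foxX ?eqxx ?mul1r //.
by rewrite eq_sym (negPf ml) mul0r.
Qed.

Lemma rhC c : rh c%:A = 0.
Proof. by rewrite !rhE big1 // => l _; rewrite foxC mul0r. Qed.

Lemma rh_decomp x : x = (aug etaz x)%:A + rh x + fox etaz z x * (lett z - 'X%:A).
Proof.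
rewrite {1}(fox_decomp etaz x) -addrA; congr (_ + _).
rewrite (bigD1 z) //= addrC [etaz z]/etaz eqxx rhE; congr (_ + _).
by apply: eq_bigr => l lz; rewrite /etaz (negPf lz) scale0r subr0.
Qed.

Lemma lam_rh x : aug etaz x = 0 -> lam (rh x) = lam x.
Proof.
by move=> x0; rewrite {2}(rh_decomp x) x0 scale0r add0r lamD lam_zX addr0.
Qed.

Lemma aug_bczp c : aug etaz (bc (zp z c)) = c.
Proof.
elim/poly_ind: c => [|p c IH]; first by rewrite zp0 bc0 aug0.
rewrite !(zpD, zpM, zpX, zpC, bcD, bcM, bcX, bcC, augD, augM, augX, augC) IH.
by rewrite /etaz eqxx.
Qed.

Lemma rh_bczp c : rh (bc (zp z c)) = 0.
Proof.
elim/poly_ind: c => [|p c IH]; first by rewrite zp0 bc0 rh0.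
by rewrite !(zpD, zpM, zpX, zpC, bcD, bcM, bcX, bcC, rhD, rhM, rhX, rhC) IH eqxx mulr0 scaler0 !addr0.
Qed.

(** A normal form depends only on the class modulo [z - 'X], so it does not matter whether the
    central variable has been replaced by [z] before. *)
Lemma rh_bclam y : rh (bc (lam y)) = rh y.
Proof.
move: y; apply: fa_ind => [|u v Hu Hv|c w].
- by rewrite lam0 bc0.
- by rewrite lamD bcD !rhD Hu Hv.
rewrite lamU bcM rhM rh_bczp mulr0 add0r aug_bczp -rhZ.
by rewrite -[mon R w]scale1r bcU scale1r.
Qed.

Lemma rh_zp (p : {poly {poly R}}) : rh (zp z p) = 0.
Proof.
elim/poly_ind: p => [|p c IH]; first by rewrite zp0 rh0.
by rewrite !(zpD, zpM, zpX, zpC, rhD, rhM, rhX, rhC) IH eqxx mulr0 scaler0 !addr0.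
Qed.

Lemma rh_zpM p y : rh (zp z p * y) = zp z p * rh y.
Proof. by rewrite rhM rh_zp scaler0 addr0. Qed.

(* The ring inverse, on words, of the substitution [lam]. *)
Definition sg u : AP := (aug etaz (bc u))%:A + rh (bc u).

Lemma lam_sg u : lam (sg u) = u.
Proof.
by rewrite -[RHS]lam_bc (rh_decomp (bc u)) [RHS]lamD lam_zX addr0.
Qed.

Lemma sg_zp u q : sg (u * zp z q) = q *: sg u.
Proof.
rewrite /sg bcM rhM augM rh_bczp mulr0 add0r aug_bczp scalerDr.
by rewrite mulrC scalerA.
Qed.

Lemma Hom_rh (Q : realFieldType) (wt : 'I_n -> Q) m x : wt z = 0 -> Hom wt m x -> Hom wt m (rh x).
Proof.
move=> wz Hx; rewrite rhE; apply: supp_sum => l lz.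
rewrite -/(Hom wt m _) -[m](subrK (wt l)); apply: HomM; last exact: HomX.
by apply: Hom_fox => // k; rewrite /etaz; case: (k =P z) => [->|]; rewrite ?eqxx.
Qed.

End Lambda.

Arguments etaz {R n} z l.

Section LamGev.
Variables (R : comNzRingType) (n n' : nat) (z : 'I_n) (z' : 'I_n').
Variable U : 'I_n -> FA R n'.

Lemma bc_gev u : bc (gev idfun U u) = gev idfun (fun l => bc (U l)) (bc u).
Proof.
rewrite /bc (gev_comp (phi'' := polyC)) // (gev_comp (phi'' := polyC)) //.
by apply: eq_gev => l; rewrite gevX.
Qed.

Hypothesis Uz : U z = lett z'.

Lemma lam_gev x : lam z' (gev idfun (fun l => bc (U l)) x) = gev idfun U (lam z x).
Proof.
move: x; apply: fa_ind => [|u v Hu Hv|c w]; first by rewrite lam0 !gev0 lam0.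
  by rewrite gevD lamD Hu Hv lamD gevD.
rewrite gevZ !lamZ gevM (gevz_zp _ Uz); congr (_ * _).
have -> : mon {poly R} w = bc (mon R w) by rewrite -[mon R w]scale1r bcU scale1r.
by rewrite -bc_gev !lam_bc.
Qed.
End LamGev.

(* Only the letter [z] itself contributes to the component along [z - 'X]. *)
Lemma rh_gev (R : comNzRingType) n n' (z : 'I_n) (z' : 'I_n')
    (U : 'I_n -> FA {poly R} n') x :
    U z = lett z' -> (forall l, l != z -> aug (etaz z') (U l) = 0) ->
  aug (etaz z') (gev idfun U x) = aug (etaz z) x /\
  rh z' (gev idfun U x) =
    \sum_(l | l != z) gev idfun U (fox (etaz z) l x) * rh z' (U l).
Proof.
move=> Uz U0; rewrite {1 3}(rh_decomp z x) !gevD gevM gevB gevX !gevC Uz.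
have aU y : aug (etaz z') (y * (lett z' - 'X%:A)) = 0.
  by rewrite augM augB augX augC /etaz eqxx subrr mulr0.
have rU y : rh z' (y * (lett z' - 'X%:A)) = 0.
  by rewrite rhM rhB rhX rhC eqxx augB augX augC /etaz eqxx !subrr scale0r mulr0 addr0.
have -> : gev idfun U (rh z x) = \sum_(l | l != z) gev idfun U (fox (etaz z) l x) * U l.
  by rewrite !rhE gev_sum; apply: eq_bigr => l _; rewrite gevM gevX.
rewrite !rhD !augD rU aU rhC augC !(add0r, addr0); split.
  elim/big_rec: _ => [|l y lz]; first by rewrite aug0 addr0.
  by rewrite augD augM U0 // mulr0 add0r.
elim/big_rec2: _ => [|l y1 y2 lz <-]; first exact: rh0.
by rewrite rhD rhM0 ?U0.
Qed.

Section Act.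
Variables (R : comNzRingType) (n : nat) (z : 'I_n).
Local Notation A := (FA R n).
Implicit Types (p q : {poly {poly R}}) (u v : A).

(* [p] acts by [s ^ j t ^ k . u = z ^ j u z ^ k], where [s] is the outer variable
   of [p] and [t] the inner one. *)
Definition act p u : A := locked_with seal_key (fun p u => lam z (zp z p * bc u)) p u.

Lemma actE p u : act p u = lam z (zp z p * bc u).
Proof. by rewrite /act locked_withE. Qed.

Lemma act0 p : act p 0 = 0. Proof. by rewrite !actE bc0 mulr0 lam0. Qed.
Lemma actD p u v : act p (u + v) = act p u + act p v.
Proof. by rewrite !actE bcD mulrDr lamD. Qed.
Lemma actB p u v : act p (u - v) = act p u - act p v.
Proof. by rewrite !actE bcB mulrBr lamB. Qed.
Lemma actDl p q u : act (p + q) u = act p u + act q u.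
Proof. by rewrite !actE zpD mulrDl lamD. Qed.
Lemma actBl p q u : act (p - q) u = act p u - act q u.
Proof. by rewrite !actE zpB mulrBl lamB. Qed.
Lemma actNl p u : act (- p) u = - act p u.
Proof. by rewrite !actE zpN mulNr lamN. Qed.
Lemma act0l u : act 0 u = 0. Proof. by rewrite !actE zp0 mul0r lam0. Qed.
Lemma act1l u : act 1 u = u. Proof. by rewrite !actE zp1 mul1r lam_bc. Qed.
Lemma actM p q u : act (p * q) u = act p (act q u).
Proof. by rewrite !actE lam_bclam zpM mulrA. Qed.
Lemma actN p u : act p (- u) = - act p u.
Proof. by rewrite -[- u]sub0r actB act0 sub0r. Qed.

Lemma actX u : act 'X u = lett z * u.
Proof. by rewrite !actE zpX -bcX lam_bcM lam_bc. Qed.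

Lemma actCl (c : {poly R}) u : act c%:P u = u * zp z c.
Proof. by rewrite !actE zpC mulr_algl lamZ lam_bc. Qed.

Lemma act_polyind (C : {poly {poly R}} -> Prop) :
    (forall c, C c%:P%:P) -> C 'X -> C 'X%:P ->
    (forall p q, C p -> C q -> C (p + q)) -> (forall p q, C p -> C q -> C (p * q)) ->
  forall p, C p.
Proof.
move=> Cc CX CY CD CM.
have C1 (c : {poly R}) : C c%:P.
  elim/poly_ind: c => [|c d IH]; first exact: (Cc 0).
  by rewrite polyCD polyCM; apply: (CD) => //; apply: CM.
by elim/poly_ind => [|p c IH]; [exact: (Cc 0) | apply: (CD) => //; apply: CM].
Qed.

Lemma actCCl (c : R) u : act c%:P%:P u = c *: u.
Proof. by rewrite actCl zpC -fa_comC mulr_algl. Qed.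

(** On normal forms the two-sided action is an ordinary left multiplication. When [R] is a domain,
    this is what allows one to cancel [p]. *)
Lemma act_rh p u : rh z (bc (act p u)) = zp z p * rh z (bc u).
Proof. by rewrite !actE rh_bclam rh_zpM. Qed.

End Act.

(** The action is generated by scalars and by the multiplications by [z] on the two sides. *)
Lemma act_comm (R : comNzRingType) n n' (z : 'I_n) (z' : 'I_n')
    (T : FA R n -> FA R n') :
    {morph T : u v / u + v} -> (forall c u, T (c *: u) = c *: T u) ->
    (forall u, T (lett z * u) = lett z' * T u) ->
    (forall u, T (u * lett z) = T u * lett z') ->
  forall p u, T (act z p u) = act z' p (T u).
Proof.
move=> TD TZ Tl Tr; apply: act_polyind => [c u|u|u|p q Hp Hq u|p q Hp Hq u].
- by rewrite !actCCl TZ.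
- by rewrite !actX Tl.
- by rewrite !actCl !zpX Tr.
- by rewrite !actDl TD Hp Hq.
by rewrite !actM Hp Hq.
Qed.

Section ActMore.
Variables (R : comNzRingType) (n n' : nat) (z : 'I_n) (z' : 'I_n').
Local Notation A := (FA R n).
Implicit Types (p q : {poly {poly R}}) (u v : A).

Lemma act_gev (U : 'I_n -> FA R n') p u : U z = lett z' ->
  gev idfun U (act z p u) = act z' p (gev idfun U u).
Proof.
move=> Uz; apply: act_comm => [x y|c x|x|x].
- exact: gevD.
- exact: gevZ.
- by rewrite gevM gevX Uz.
by rewrite gevM gevX Uz.
Qed.

Definition zinv (Q : pred (seq 'I_n)) :=
  forall w, Q (z :: w) = Q w /\ Q (w ++ [:: z]) = Q w.

Lemma act_proj Q p u : zinv Q -> proj Q (act z p u) = act z p (proj Q u).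
Proof.
move=> Qz; apply: act_comm => [x y|c x|x|x]; first exact: projD.
- exact: projZ.
- move: x; apply: fa_ind => [|x y Hx Hy|c w].
  + by rewrite mulr0 !proj0 mulr0.
  + by rewrite mulrDr !projD Hx Hy mulrDr.
  by rewrite -fa_scaler -mon_cons !projU (proj1 (Qz w)); case: ifP => _;
     rewrite ?mulr0 // mon_cons fa_scaler.
move: x; apply: fa_ind => [|x y Hx Hy|c w].
+ by rewrite mul0r !proj0 mul0r.
+ by rewrite mulrDl !projD Hx Hy mulrDl.
by rewrite -scalerAl -monM !projU (proj2 (Qz w)); case: ifP => _;
   rewrite ?mul0r // monM scalerAl.
Qed.

Lemma act_supp (Q : pred (seq 'I_n)) p u : zinv Q -> supp Q u -> supp Q (act z p u).
Proof. by move=> Qz Qu; rewrite -(proj_id Qu) -act_proj //; apply: supp_proj. Qed.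

Section Wt.
Variables (Q : realFieldType) (wt : 'I_n -> Q) (wz : wt z = 0).

Lemma zinv_wt (X : pred Q) : zinv (fun w => X (wtw wt w)).
Proof. by move=> w; rewrite -cat1s !wtwM !wtwU wz add0r addr0. Qed.

Lemma act_comp m p u : comp wt m (act z p u) = act z p (comp wt m u).
Proof. exact: (act_proj _ _ (zinv_wt (pred1 m))). Qed.

Lemma act_Hom m p u : Hom wt m u -> Hom wt m (act z p u).
Proof. by move=> Hu; rewrite -(comp_id Hu) -act_comp; apply: Hom_comp. Qed.

Lemma act_Fil m p u : Fil wt m u -> Fil wt m (act z p u).
Proof. exact: (act_supp (zinv_wt (fun x => x <= m))). Qed.
End Wt.

End ActMore.

Lemma act_lfree (R : idomainType) n (z t : 'I_n) p (u : FA R n) :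
  t != z -> lfree t u -> lfree t (act z p u).
Proof.
move=> tz; apply: act_supp => w; rewrite in_cons mem_cat !inE (negPf tz).
by rewrite orbF.
Qed.

Lemma rv_act (R : comNzRingType) n (z : 'I_n) p (u : FA R n) :
  rv (act z p u) = act z (swapXY p) (rv u).
Proof.
move: p u; apply: act_polyind => [c u|u|u|p q Hp Hq u|p q Hp Hq u].
- by rewrite swapXY_polyC map_polyC /= !actCCl rvZ.
- by rewrite swapXY_X actX actCl zpX rvM rvX.
- by rewrite swapXY_polyC map_polyX actX actCl zpX rvM rvX.
- by rewrite rmorphD /= !actDl rvD Hp Hq.
by rewrite mulrC rmorphM /= mulrC !actM Hp Hq -!actM mulrC.
Qed.

(** * Division by coprime pairs *)

Section Cop.
Variable S : comNzRingType.
Implicit Types p q : S.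

(** Coprimality in terms of syzygies. A coprime pair in [F[s, t]] need not satisfy a Bezout
    relation, and this form can be applied coefficient by coefficient in a free algebra. *)
Definition Cop p q := forall c d, q * c = p * d -> exists r, c = p * r /\ d = q * r.

Lemma cop_malg n p q (u v : FA S n) :
  Cop p q -> q *: u = p *: v -> exists w, u = p *: w /\ v = q *: w.
Proof.
move=> cpq E.
have H k : {r | (cf k u == p * r) && (cf k v == q * r)}.
  apply: sigW; have [|r [ur vr]] := cpq (cf k u) (cf k v); last first.
    by exists r; apply/andP; split; apply/eqP.
  by have := congr1 (cf k) E; rewrite !cfZ.
pose d := undup (fa_supp u ++ fa_supp v).
pose w : FA S n := \sum_(k <- d) sval (H k) *: mon S k.
have wE k : cf k w = if k \in d then sval (H k) else 0.
  rewrite cf_sum; case: ifP => kd.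
    rewrite (bigD1_seq k) ?undup_uniq //= cfZ cf_mon eqxx mulr1 big1 ?addr0 // => k' kk.
    by rewrite cfZ cf_mon (negPf kk) mulr0.
  rewrite big_seq big1 // => k' k'd; rewrite cfZ cf_mon.
  by case: (k' =P k) k'd kd => [->->//|_]; rewrite mulr0.
have d0 k : k \notin d -> cf k u = 0 /\ cf k v = 0.
  by rewrite mem_undup mem_cat negb_or !mem_supp !negbK => /andP[/eqP-> /eqP->].
exists w; split; apply: fa_eq => k; rewrite cfZ wE; case: ifP => [_|/negbT/d0[du dv]].
- by case: (H k) => r /= /andP[/eqP].
- by rewrite du mulr0.
- by case: (H k) => r /= /andP[_ /eqP].
by rewrite dv mulr0.
Qed.
End Cop.

(** The section [sg] of [lam] turns the right factors into scalars, to which [cop_malg] applies. *)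
Lemma cop_zp (R : comNzRingType) n (z : 'I_n) (p q : {poly R})
    (u v : FA R n) :
  Cop p q -> u * zp z q = v * zp z p -> exists w, u = w * zp z p /\ v = w * zp z q.
Proof.
move=> cpq E; have := congr1 (sg z) E; rewrite !sg_zp => /(cop_malg cpq)[w [uw vw]].
by exists (lam z w); rewrite -!lamZ -uw -vw !lam_sg.
Qed.

(** Normal forms make the action a left multiplication, and reversal moves the factors to the right,
    where [cop_zp] divides. The vanishing augmentations ensure that [rh] loses nothing of [u] and
    [v]. *)
Lemma cop_act (R : comNzRingType) n (z : 'I_n) (p q : {poly {poly R}})
    (u v : FA R n) :
    Cop p q -> aug (etaz z) (bc u) = 0 -> aug (etaz z) (bc v) = 0 ->
    act z q u = act z p v ->
  exists w, u = act z p w /\ v = act z q w.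
Proof.
move=> cpq u0 v0 E; have := congr1 (fun x => rv (rh z (bc x))) E.
rewrite /= !act_rh !rvM !rv_zp => /(cop_zp cpq)[w [uw vw]].
exists (lam z (rv w)); rewrite !actE !lam_bclam.
have uE : rh z (bc u) = zp z p * rv w by rewrite -[LHS]rvK uw rvM rv_zp.
have vE : rh z (bc v) = zp z q * rv w by rewrite -[LHS]rvK vw rvM rv_zp.
by rewrite -uE -vE !lam_rh // !lam_bc.
Qed.

(** * Coprime pairs in F[s, t] *)

Section PolyCop.
Variable F : fieldType.
Local Notation R := {poly F}.
Implicit Types (u v p q r : {poly R}) (c d : R).

Lemma irred_factor d : (1 < size d)%N -> exists2 p : R, irreducible_poly p & p %| d.
Proof.
have [n] := ubnP (size d); elim: n d => // n IH d /ltnSE dn d1.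
case: (classic (irreducible_poly d)) => [|nd]; first by exists d.
have [e [e1 [ed ned]]] : exists e : R, [/\ size e != 1%N, e %| d & ~~ (e %= d)].
  apply: NNPP => H; apply: nd; split=> // e e1 ed.
  by apply/negPn/negP => ned; apply: H; exists e.
have d0 : d != 0 by rewrite -size_poly_eq0 -lt0n (ltn_trans _ d1).
have e0 : e != 0 by apply: contraNneq d0 => e0; rewrite e0 dvd0p in ed.
have le : (size e < size d)%N.
  by rewrite ltn_neqAle dvdp_leq // andbT; apply: contraNneq ned => E; rewrite -dvdp_size_eqp // E.
have e2 : (1 < size e)%N by rewrite ltn_neqAle eq_sym e1 lt0n size_poly_eq0.
have [p ip pe] := IH e (leq_trans le dn) e2.
by exists p => //; apply: dvdp_trans ed.
Qed.

(* Gauss' lemma *)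
Lemma irred_polyC_mul (p : R) u v w : irreducible_poly p -> p%:P * w = u * v ->
  (exists u', u = p%:P * u') \/ (exists v', v = p%:P * v').
Proof.
move=> ip; have [n] := ubnP (size u + size v)%N; elim: n u v w => // n IH u v w /ltnSE le E.
case: (eqVneq u 0) => [->|u0]; first by left; exists 0; rewrite mulr0.
case: (eqVneq v 0) => [->|v0]; first by right; exists 0; rewrite mulr0.
have : p %| lead_coef u * lead_coef v.
  by rewrite -lead_coefM -E mul_polyC lead_coefZ dvdp_mulr.
(* If [p] divides a leading coefficient, the whole leading term is a multiple of [p] and can be
   subtracted. *)
have drop (x : {poly R}) (lx : R) : x != 0 -> lead_coef x = lx * p ->
    (size (x - p%:P * (lx%:P * 'X^((size x).-1)))%R < size x)%N.
  move=> x0 xE; have sx : size x = (size x).-1.+1 by rewrite prednK // lt0n size_poly_eq0.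
  rewrite {2}sx ltnS; apply/leq_sizeP => j; rewrite leq_eqVlt => /orP[/eqP<-|lj].
    by rewrite mulrA -polyCM coefB coefCM coefXn eqxx mulr1 -lead_coefE xE mulrC subrr.
  rewrite mulrA -polyCM coefB coefCM coefXn gtn_eqF // mulr0 subr0.
  by rewrite nth_default // sx.
have := irreducible_poly_coprime (lead_coef u) ip; case pu: (p %| lead_coef u) => /= cop.
  move=> _; have [lx xE] := dvdpP _ _ pu; have := drop u lx u0 xE.
  set u1 := u - _ => su; have [| |[u' u1E]|] := IH u1 v (w - lx%:P * 'X^((size u).-1) * v).
  - by rewrite (leq_trans _ le) // ltn_add2r.
  - by rewrite mulrBr E /u1 mulrBl !mulrA.
  - left; exists (u' + lx%:P * 'X^((size u).-1)).
    by rewrite mulrDr -u1E /u1 subrK.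
  by right.
rewrite (Gauss_dvdpr _ cop) => pv.
have [lx xE] := dvdpP _ _ pv; have := drop v lx v0 xE.
set v1 := v - _ => su; have [| ||[v' v1E]] := IH u v1 (w - u * (lx%:P * 'X^((size v).-1))).
- by rewrite (leq_trans _ le) // ltn_add2l.
- by rewrite mulrBr E /v1 mulrBr; congr (_ - _); rewrite mulrCA.
- by left.
right; exists (v' + lx%:P * 'X^((size v).-1)).
by rewrite mulrDr -v1E /v1 subrK.
Qed.

Lemma polyC_mulI (c : R) u v : c != 0 -> c%:P * u = c%:P * v -> u = v.
Proof. by move=> c0; apply: mulfI; rewrite polyC_eq0. Qed.

(** A Bezout relation with cleared denominators gives the common quotient [r] up to the factor [c].
    The irreducible factors of [c] are removed from [r] one by one: by Gauss' lemma, one that does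
    not divide [r] would divide both [p] and [q]. *)
Lemma prim_cop p q :
    (forall c, (1 < size c)%N -> ~ exists p' q', p = c%:P * p' /\ q = c%:P * q') ->
    (exists a b c, c != 0 /\ a * p + b * q = c%:P) ->
  Cop p q.
Proof.
move=> prim [a [b [c [c0 E]]]] X Y XY.
have EX : c%:P * X = p * (a * X + b * Y).
  by rewrite -E mulrDl mulrDr -!mulrA XY [p * (a * X)]mulrCA [p * (b * Y)]mulrCA.
have EY : c%:P * Y = q * (a * X + b * Y).
  by rewrite -E mulrDl mulrDr -!mulrA -XY [q * (a * X)]mulrCA [q * (b * Y)]mulrCA.
move: (a * X + b * Y) EX EY => r {E}.
have [n] := ubnP (size c); elim: n c c0 r => // n IH c c0 r /ltnSE le EX EY.
have [c1|c1] := leqP (size c) 1.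
  have ck := size1_polyC c1; set k := _`_0 in ck.
  have k0 : k != 0 by apply: contraNneq c0 => k0; rewrite ck k0.
  have cK x : (k^-1)%:P%:P * (c%:P * x) = x.
    by rewrite mulrA -polyCM ck -polyCM mulVf // mul1r.
  by exists ((k^-1)%:P%:P * r); rewrite !(mulrCA _ (k^-1)%:P%:P) -EX -EY !cK.
have [d id dc] := irred_factor c1.
have [c' cE] := dvdpP _ _ dc.
have d0 := irredp_neq0 id.
have c'0 : c' != 0 by apply: contraNneq c0 => c'0; rewrite cE c'0 mul0r.
have sc' : (size c' < size c)%N.
  by rewrite cE size_mul // ltn_predRL -addn1 ltn_add2l; case: id.
have cE' x : c%:P * x = d%:P * (c'%:P * x) by rewrite mulrA -polyCM [d * c']mulrC -cE.
have fin r' : r = d%:P * r' -> exists r0 : {poly R}, X = p * r0 /\ Y = q * r0.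
  move=> rE; apply: (IH c' c'0 r' (leq_trans sc' le)); apply: (polyC_mulI d0).
    by rewrite -cE' EX rE mulrCA.
  by rewrite -cE' EY rE mulrCA.
have pdvd : d%:P * (c'%:P * X) = p * r by rewrite -cE'.
have qdvd : d%:P * (c'%:P * Y) = q * r by rewrite -cE'.
have [[p' pE]|[r' rE]] := irred_polyC_mul id pdvd; last exact: fin rE.
have [[q' qE]|[r' rE]] := irred_polyC_mul id qdvd; last exact: fin rE.
by case: (prim d) => //; [case: id | exists p', q'].
Qed.

(** The cofactors of a pseudo-gcd satisfy a Bezout relation up to some [c] in [{poly F}]. Common
    factors from [{poly F}] are then divided out; each of them divides [c], so the degree of [c]
    drops. *)
Lemma cop_exists u v : (u != 0) || (v != 0) -> exists p q,
  [/\ Cop p q, (p != 0) || (q != 0) & v * p = u * q].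
Proof.
move=> uv0.
have [p [q [E [a [b [c [c0 Ec]]]]]]] : exists p q, v * p = u * q /\
    exists a b c, c != 0 /\ a * p + b * q = c%:P.
  have g0 : gcdp u v != 0 by rewrite gcdp_eq0 negb_and.
  have [[c k] /= c0 uE] := Pdiv.Idomain.dvdpP _ _ (dvdp_gcdl u v).
  have [[d l] /= d0 vE] := Pdiv.Idomain.dvdpP _ _ (dvdp_gcdr u v).
  have /Pdiv.Idomain.eqpP[[s t] /= /andP[s0 t0] gE] := Pdiv.Idomain.egcdpE u v.
  move: gE; set e := egcdp u v; set g := gcdp u v in g0 uE vE * => gE.
  rewrite -!mul_polyC in uE vE gE.
  exists (d%:P * k), (c%:P * l); split.
    have -> : v * (d%:P * k) = k * (d%:P * v) by ring.
    have -> : u * (c%:P * l) = l * (c%:P * u) by ring.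
    by rewrite uE vE; ring.
  exists (t%:P * e.1), (t%:P * e.2), (s * c * d); split; first by rewrite !mulf_neq0.
  apply: (mulIf g0).
  have -> : (t%:P * e.1 * (d%:P * k) + t%:P * e.2 * (c%:P * l)) * g =
      t%:P * d%:P * e.1 * (k * g) + t%:P * c%:P * e.2 * (l * g) by ring.
  rewrite -uE -vE !polyCM.
  have -> : s%:P * c%:P * d%:P * g = c%:P * d%:P * (s%:P * g) by ring.
  by rewrite gE; ring.
move: p q a b c c0 E Ec => p q a b c; have [n] := ubnP (size c).
elim: n p q a b c => // n IH p q a b c /ltnSE le c0 E Ec.
case: (classic (exists d, (1 < size d)%N /\ exists p' q', p = d%:P * p' /\ q = d%:P * q')).
  move=> [d [d1 [p' [q' [pE qE]]]]].
  have d0 : d != 0 by rewrite -size_poly_eq0 -lt0n (ltn_trans _ d1).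
  have E' : c%:P = d%:P * (a * p' + b * q') by rewrite -Ec pE qE; ring.
  have s1 : (size (a * p' + b * q')%R <= 1)%N.
    have nz : a * p' + b * q' != 0.
      by apply: contraNneq c0 => E0; rewrite E0 mulr0 in E'; move/eqP: E'; rewrite polyC_eq0.
    have := congr1 (fun x : {poly R} => size x) E'; rewrite /= size_polyC c0 mul_polyC.
    by rewrite size_scale // => <-.
  have cE := size1_polyC s1; set c' := _`_0 in cE.
  rewrite cE -polyCM in E'; have {}E' := polyC_inj E'.
  have c'0 : c' != 0 by apply: contraNneq c0 => c'0; rewrite E' c'0 mulr0.
  apply: (IH p' q' a b c') => //.
    by rewrite (leq_trans _ le) // E' size_mul // ltn_predRL addnC -addn1 ltn_add2l.
  by apply: (polyC_mulI d0); rewrite mulrCA -pE E qE mulrCA.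
move=> prim; exists p, q; split=> //.
  apply: prim_cop => [d d1 H|]; first by apply: prim; exists d.
  by exists a, b, c.
apply: contraNT c0; rewrite negb_or !negbK => /andP[/eqP p0 /eqP q0].
by rewrite -(@polyC_eq0 R) -Ec p0 q0 !mulr0 addr0.
Qed.

Lemma cop_swap p q : Cop p q -> Cop (swapXY p) (swapXY q).
Proof.
move=> cpq c d E; have [|r [cE dE]] := cpq (swapXY c) (swapXY d).
  by apply: (can_inj (@swapXYK F)); rewrite !rmorphM /= !swapXYK.
by exists (swapXY r); rewrite -!rmorphM -cE -dE /= !swapXYK.
Qed.

(* [c(s)] and [d(t)] *)
Lemma cop_vars c d : c != 0 -> d != 0 -> Cop (map_poly polyC c) d%:P.
Proof.
move=> c0 d0 X Y E.
pose c1 := map_poly polyC ((lead_coef c)^-1 *: c).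
have lc0 : lead_coef c != 0 by rewrite lead_coef_eq0.
have c1m : c1 \is monic.
  by rewrite /c1 map_monic monicE lead_coefZ mulVf.
have cE : map_poly polyC c = (lead_coef c)%:P%:P * c1.
  by rewrite /c1 map_polyZ -mul_polyC mulrA -!polyCM mulfV // mul1r.
have XE := Pdiv.RingMonic.rdivp_eq c1m X.
set r := Pdiv.CommonRing.rdivp X c1 in XE; set m := Pdiv.CommonRing.rmodp X c1 in XE.
have E' : d%:P * m = c1 * ((lead_coef c)%:P%:P * Y - d%:P * r).
  have : d%:P * (r * c1 + m) = (lead_coef c)%:P%:P * c1 * Y by rewrite -XE E cE.
  by move=> E2; rewrite mulrBr (mulrCA c1) mulrA -E2; ring.
(* As [d] is constant in the outer variable, [d * m] has the degree of the remainder [m], yet it is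
   a multiple of the monic [c1]. *)
have m0 : m = 0.
  apply/eqP; rewrite -size_poly_eq0; apply: contraT => sm.
  have := Pdiv.CommonRing.ltn_rmodp X c1; rewrite monic_neq0 // -/m => lt.
  have := congr1 (fun x : {poly R} => size x) E'; rewrite /= mul_polyC size_scale //.
  set w := _ - _; case: (eqVneq w 0) => [->|w0].
    by rewrite mulr0 size_poly0 => s0; rewrite s0 in sm.
  rewrite size_monicM // => s; move: lt; rewrite s.
  have : (0 < size w)%N by rewrite size_poly_gt0.
  by case: (size w) => // k _; rewrite addnS /= ltnNge leq_addr.
exists ((lead_coef c)^-1%:P%:P * r); split.
  rewrite [LHS]XE m0 addr0 cE.
  have -> : (lead_coef c)%:P%:P * c1 * ((lead_coef c)^-1%:P%:P * r) =
      ((lead_coef c)%:P%:P * (lead_coef c)^-1%:P%:P) * (r * c1) by ring.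
  by rewrite -!polyCM mulfV // mul1r.
have /eqP := E'; rewrite m0 mulr0 eq_sym mulf_eq0 (negPf (monic_neq0 c1m)) /= subr_eq0.
by move=> /eqP YE; rewrite mulrCA -YE mulrA -!polyCM mulVf // mul1r.
Qed.
End PolyCop.

(** * Removing letters from the right of a relation *)

Section Strips.
Variables (R : idomainType) (n : nat) (z : 'I_n) (Q : realFieldType) (wt : 'I_n -> Q).
Variable L : pred 'I_n.
Hypothesis wz : wt z = 0.
Hypothesis wpos : forall l, L l -> l != z -> 0 < wt l.
Local Notation A := (FA R n).
Local Notation strip := (fox (fun=> 0 : R)).
Implicit Types (u v a b : A) (l : 'I_n).

Definition inL u := supp (fun w : seq 'I_n => all L w) u.

Lemma all_wt (s : seq 'I_n) : all L s -> 0 <= wtw wt s.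
Proof.
rewrite /wtw; elim: s => [|l s IH] /=; first by rewrite big_nil.
case/andP=> Ll /IH s0; rewrite big_cons addr_ge0 //.
by case: (eqVneq l z) => [->|lz]; [rewrite wz | apply/ltW/wpos].
Qed.

Lemma Hom_ge0 m u : inL u -> Hom wt m u -> u != 0 -> 0 <= m.
Proof. by move=> Lu Hu /neq0_supp[s nz]; rewrite -(Hu _ nz); apply/all_wt/Lu. Qed.

Lemma Hom0_zp u : inL u -> Hom wt 0 u -> exists c, u = zp z c.
Proof.
move=> Lu Hu; move: u {Lu Hu}(supp_and Lu Hu).
apply: fa_suppind => [|u v [c ->] [d ->]|c s [Ls s0]].
- by exists 0; rewrite zp0.
- by exists (c + d); rewrite zpD.
suff [d ->] : exists d, mon R s = zp z d by exists (c%:P * d); rewrite zpM zpC mulr_algl.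
elim: s Ls s0 => [|l s IH] /=; first by exists 1; rewrite mon0 zp1.
case/andP=> Ll Ls; rewrite /wtw big_cons -/(wtw wt s) => ls0.
have s0 := all_wt Ls.
have lz : l = z by apply/eqP; apply/negPn/negP => /(wpos Ll) l0; move: ls0 s0 l0; lra.
have [|d sE] := IH Ls; first by move: ls0; rewrite lz wz add0r.
by exists ('X * d); rewrite mon_cons sE zpM zpX lz.
Qed.

Lemma strip_decomp u : aug (fun=> 0) u = 0 -> u = \sum_l strip l u * lett l.
Proof.
move=> u0; rewrite {1}(fox_decomp (fun=> 0) u) u0 scale0r add0r.
by under eq_bigr do rewrite subr0.
Qed.

Lemma strip_neq0 u : aug (fun=> 0) u = 0 -> u != 0 -> exists l, strip l u != 0.
Proof.
move=> u0 nu; apply: NNPP => H; case/eqP: nu; rewrite (strip_decomp u0) big1 // => l _.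
suff -> : strip l u = 0 by rewrite mul0r.
by apply/eqP/negPn/negP => nl; apply: H; exists l.
Qed.

Lemma Hom_aug0 m u : Hom wt m u -> m != 0 -> aug (fun=> 0 : R) u = 0.
Proof. by move=> Hu /eqP m0; apply: Hom_aug Hu m0 => l; rewrite eqxx. Qed.

Lemma Hom_strip m l u : Hom wt m u -> Hom wt (m - wt l) (strip l u).
Proof. by apply: Hom_fox => k; rewrite eqxx. Qed.

Lemma inL_fox eta l u : inL u -> inL (fox eta l u).
Proof. by apply: supp_fox => s s'; rewrite all_cat => /andP[]. Qed.

(** While [m] is nonzero, [a] and [b] have no constant term, so removing the same last letter from
    both keeps the relation and the difference [d] of the weights. This stops when [a] has weight 0,
    where it is a polynomial in [z]. *)
Lemma strip_rel m d u v a b : 0 <= d -> inL a -> inL b -> Hom wt m a -> Hom wt (m + d) b ->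
    a != 0 -> u * a + v * b = 0 ->
  exists c b', [/\ c != 0, inL b', Hom wt d b' & u * zp z c + v * b' = 0].
Proof.
move=> d0 Ia Ib Ha Hb na E; have [k La] := Len_exists a.
elim: k m a b La Ia Ib Ha Hb na E => [|k IH] m a b La Ia Ib Ha Hb na E;
  (case: (eqVneq m 0) => [mE|mN];
    [have [c aE] := Hom0_zp Ia (Hom_eq Ha mE); exists c, b; split=> //;
     [by apply: contraNneq na => c0; rewrite aE c0 zp0
     |by apply: (Hom_eq Hb); rewrite mE add0r | by rewrite -aE] |]).
  by case/eqP: na; rewrite (Len0E (fun=> 0) La) (Hom_aug0 Ha mN) scale0r.
have a0 := Hom_aug0 Ha mN; have m0 := Hom_ge0 Ia Ha na.
have b0 : aug (fun=> 0 : R) b = 0.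
  by apply: Hom_aug0 Hb _; apply: contraNneq mN => md; apply/eqP; move: m0 md d0; lra.
have [l nl] := strip_neq0 a0 na.
apply: (IH (m - wt l) (strip l a) (strip l b)) => //.
- exact: Len_fox.
- exact: inL_fox.
- exact: inL_fox.
- exact: Hom_strip.
- by apply: (Hom_eq (Hom_strip (l := l) Hb)); rewrite addrAC.
by have := congr1 (strip l) E; rewrite foxD !foxM a0 b0 !scale0r !addr0 fox0.
Qed.

(** Membership in the right ideal of [c] after extending [R] to its field of fractions: the leading
    coefficient that [strip_zp] has to divide by is nonzero but need not be a unit. *)
Definition up_to_scalar (c u : A) := exists (c0 : R) k, c0 != 0 /\ c0 *: u = c * k.

Lemma utsD c u v : up_to_scalar c u -> up_to_scalar c v -> up_to_scalar c (u + v).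
Proof.
move=> [c1 [k1 [n1 E1]]] [c2 [k2 [n2 E2]]]; exists (c1 * c2), (c2 *: k1 + c1 *: k2).
rewrite mulf_neq0 // mulrDr -!fa_scaler -E1 -E2 !scalerA scalerDr; split=> //.
by rewrite [c2 * c1]mulrC.
Qed.

Lemma utsZ c d u : up_to_scalar c u -> up_to_scalar c (d *: u).
Proof.
move=> [c1 [k1 [n1 E1]]]; exists c1, (d *: k1); split=> //.
by rewrite -fa_scaler -E1 !scalerA mulrC.
Qed.

Lemma uts0 c : up_to_scalar c 0.
Proof. by exists 1, 0; rewrite oner_neq0 scaler0 mulr0. Qed.

Lemma utsM c k : up_to_scalar c (c * k).
Proof. by exists 1, k; rewrite oner_neq0 scale1r. Qed.

Lemma uts_scale c d u : d != 0 -> up_to_scalar c (d *: u) -> up_to_scalar c u.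
Proof.
by move=> d0 [c1 [k [c10 E]]]; exists (c1 * d), k; rewrite mulf_neq0 // -scalerA.
Qed.

Lemma iter_stripD k u v : iter k (strip z) (u + v) = iter k (strip z) u + iter k (strip z) v.
Proof. by elim: k => //= k ->; rewrite foxD. Qed.

Lemma iter_stripZ k d u : iter k (strip z) (d *: u) = d *: iter k (strip z) u.
Proof. by elim: k => //= k ->; rewrite foxZ. Qed.

Lemma iter_strip0 k : iter k (strip z) 0 = 0.
Proof. by elim: k => //= k ->; rewrite fox0. Qed.

Lemma iter_stripX k i u : (i <= k)%N ->
  iter k (strip z) (u * lett z ^+ i) = iter (k - i) (strip z) u.
Proof.
elim: i k => [|i IH] [|k] //; first by rewrite expr0 mulr1.
  by rewrite expr0 mulr1.
rewrite ltnS => ik; rewrite subSS -IH // iterSr exprSr mulrA foxMX eqxx.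
by rewrite scale0r addr0.
Qed.

(* If [a * P(z)] lies in the right ideal of [c] then so does a multiple of [a]:
   strip [z]'s from the right, starting from the highest ones of [a]. *)
Lemma strip_zp d a (c : A) b p : p != 0 -> Hom wt d b -> d != 0 ->
  a * zp z p + c * b = 0 -> up_to_scalar c a.
Proof.
move=> p0 Hb d0 E; pose s := (size p).-1.
have sE : size p = s.+1 by rewrite prednK // size_poly_gt0.
have Hib k : Hom wt d (iter k (strip z) b).
  by elim: k => //= k IH; apply: (Hom_eq (Hom_strip (l := z) IH)); rewrite wz subr0.
have ib k : iter k (strip z) (c * b) = c * iter k (strip z) b.
  elim: k => //= k ->; rewrite foxM (Hom_aug0 (Hib k) d0) scale0r addr0 //.
have [N LN] := Len_exists a.
have Li k : iter (N.+1 + k) (strip z) a = 0.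
  elim: k => [|k IH]; last by rewrite addnS iterS IH fox0.
  rewrite addn0; elim: N a LN {E} => [|N IH] a La; first by rewrite /= Len0_fox.
  by rewrite iterSr IH //; apply: Len_fox.
(* Descending induction on [j]: after [s + j] strippings of the relation, the leading coefficient of
   [p] multiplies the [j]-fold stripping of [a], and the other terms contain more strippings of
   [a]. *)
have claim k : forall j, (N.+1 <= j + k)%N -> up_to_scalar c (iter j (strip z) a).
  elim: k => [|k IH] j le.
    by rewrite addn0 in le; rewrite -(subnKC le) Li; apply: uts0.
  apply: (@uts_scale _ p`_s); first by rewrite -[s]/((size p).-1) -lead_coefE lead_coef_eq0.
  have := congr1 (iter (s + j) (strip z)) E.
  rewrite iter_strip0 iter_stripD ib zpE mulr_sumr.
  have -> : iter (s + j) (strip z) (\sum_(i < size p) a * (p`_i *: lett z ^+ i)) =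
      \sum_(i < size p) p`_i *: iter (s + j - i) (strip z) a.
    elim/big_rec2: _ => [|i x y _ <-]; first by rewrite iter_strip0.
    rewrite iter_stripD -fa_scaler iter_stripZ iter_stripX //.
    by rewrite (leq_trans _ (leq_addr _ _)) // -ltnS -sE.
  rewrite sE big_ord_recr /= addKn; set S := \sum_(i < s) _; set B := c * _ => E2.
  have -> : p`_s *: iter j (strip z) a = B * (-1) + (-1) *: S.
    rewrite mulrN1 scaleN1r; apply/eqP; rewrite -subr_eq0 opprD !opprK.
    by rewrite addrCA addrC [_ + S]addrC E2.
  apply: utsD; first by rewrite -mulrA; apply: utsM.
  apply: utsZ; rewrite /S; elim/big_ind: _ => [|x y|i _]; [exact: uts0 | exact: utsD |].
  apply: utsZ; apply: IH; apply: leq_trans le _.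
  by rewrite addnS -addSn leq_add2r ltn_subRL ltn_add2r.
by have := claim N.+1 0%N; apply.
Qed.
End Strips.

(** * Leading forms of an automorphism *)

Section Select.
Variable T : Type.
Definition sel3 (a b c : T) (i : 'I_3) : T := nth a [:: a; b; c] i.
Definition sel5 (a b c d e : T) (i : 'I_5) : T := nth a [:: a; b; c; d; e] i.
End Select.

Notation x0 := (@Ordinal 3 0 isT).
Notation x1 := (@Ordinal 3 1 isT).
Notation x2 := (@Ordinal 3 2 isT).
Notation y0 := (@Ordinal 5 0 isT).
Notation y1 := (@Ordinal 5 1 isT).
Notation y2 := (@Ordinal 5 2 isT).
Notation y3 := (@Ordinal 5 3 isT).
Notation y4 := (@Ordinal 5 4 isT).

Lemma ord3P (P : 'I_3 -> Prop) : P x0 -> P x1 -> P x2 -> forall i, P i.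
Proof.
move=> P0 P1 P2 [[|[|[|//]]] lt]; [move: P0|move: P1|move: P2];
  by congr P; apply: val_inj.
Qed.

Lemma ord5P (P : 'I_5 -> Prop) : P y0 -> P y1 -> P y2 -> P y3 -> P y4 -> forall i, P i.
Proof.
move=> P0 P1 P2 P3 P4 [[|[|[|[|[|//]]]]] lt];
  [move: P0|move: P1|move: P2|move: P3|move: P4]; by congr P; apply: val_inj.
Qed.

Lemma sum3 (V : nmodType) (f : 'I_3 -> V) : \sum_i f i = f x0 + f x1 + f x2.
Proof.
rewrite !big_ord_recl big_ord0 addr0 addrA.
by congr (f _ + f _ + f _); apply: val_inj.
Qed.

Lemma sum3z (V : nmodType) (f : 'I_3 -> V) : \sum_(i | i != x2) f i = f x0 + f x1.
Proof. by rewrite big_mkcond sum3 /= addr0. Qed.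

Lemma sum5z (V : nmodType) (f : 'I_5 -> V) :
  \sum_(i | i != y2) f i = f y0 + f y1 + f y3 + f y4.
Proof.
rewrite big_mkcond !big_ord_recl big_ord0 /= !addr0 add0r !addrA.
by congr (f _ + f _ + f _ + f _); apply: val_inj.
Qed.

Section Sub3.
Variables (R : comNzRingType) (n : nat) (z : 'I_n).
Implicit Types (u v : FA R n) (Z : FA R 3).

Definition sub3 u v : FA R 3 -> FA R n := gev idfun (sel3 u v (lett z)).

Lemma sub3D u v Z1 Z2 : sub3 u v (Z1 + Z2) = sub3 u v Z1 + sub3 u v Z2.
Proof. exact: gevD. Qed.
Lemma sub3B u v Z1 Z2 : sub3 u v (Z1 - Z2) = sub3 u v Z1 - sub3 u v Z2.
Proof. exact: gevB. Qed.
Lemma sub3M u v Z1 Z2 : sub3 u v (Z1 * Z2) = sub3 u v Z1 * sub3 u v Z2.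
Proof. exact: gevM. Qed.
Lemma sub3C u v c : sub3 u v c%:A = c%:A. Proof. exact: gevC. Qed.
Lemma sub3_0 u v : sub3 u v 0 = 0. Proof. exact: gev0. Qed.
Lemma sub3z u v : sub3 u v (lett x2) = lett z. Proof. exact: gevX. Qed.
Lemma sub3_act u v p Z : sub3 u v (act x2 p Z) = act z p (sub3 u v Z).
Proof. exact: act_gev. Qed.
End Sub3.

Lemma sub3_id (R : comNzRingType) (Z : FA R 3) : sub3 x2 (lett x0) (lett x1) Z = Z.
Proof. by rewrite -[RHS]gev_id; apply: eq_gev; apply: ord3P. Qed.

Lemma gev_sub3 (R : comNzRingType) n n' (z : 'I_n) (z' : 'I_n') (U : 'I_n -> FA R n') u v Z :
  U z = lett z' -> gev idfun U (sub3 z u v Z) = sub3 z' (gev idfun U u) (gev idfun U v) Z.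
Proof.
move=> Uz; rewrite /sub3 (gev_comp (phi'' := idfun)) //.
by apply: eq_gev; apply: ord3P => //=; rewrite gevX Uz.
Qed.

Lemma bc_sub3 (R : comNzRingType) n (z : 'I_n) (u v : FA R n) Z :
  bc (sub3 z u v Z) = sub3 z (bc u) (bc v) (bc Z).
Proof. by rewrite /sub3 bc_gev; apply: eq_gev; apply: ord3P => //=; rewrite bcX. Qed.

Section Peel3.
Variables (F : idomainType) (n : nat) (z : 'I_n).
Local Notation R := {poly F}.
Local Notation D := (fox (etaz x2 : 'I_3 -> R)).
Implicit Types (u v : FA R n) (Z : FA R 3).

Lemma rh3 Z : rh x2 Z = D x0 Z * lett x0 + D x1 Z * lett x1.
Proof. by rewrite rhE sum3z. Qed.

Lemma peel3 u v Z : aug (etaz z) u = 0 -> aug (etaz z) v = 0 ->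
  aug (etaz z) (sub3 z u v Z) = aug (etaz x2) Z /\
  rh z (sub3 z u v Z) = sub3 z u v (D x0 Z) * rh z u + sub3 z u v (D x1 Z) * rh z v.
Proof.
move=> u0 v0; have [||-> ->] := @rh_gev F 3 n x2 z (sel3 u v (lett z)) Z => //.
  by apply: ord3P.
by rewrite sum3z.
Qed.

Lemma peel3_z Z : aug (etaz x2) Z = 0 -> D x0 Z = 0 -> D x1 Z = 0 ->
  Z = D x2 Z * (lett x2 - 'X%:A).
Proof.
by move=> a0 d0 d1; rewrite {1}(rh_decomp x2 Z) a0 rh3 d0 d1 !mul0r scale0r !add0r.
Qed.

Lemma zX_neq0 m (t : 'I_m) : lett t - 'X%:A != 0 :> FA R m.
Proof.
by apply/eqP => /(congr1 (fox (fun=> 0) t)); rewrite foxB foxX foxC eqxx subr0 fox0 => /eqP;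
   rewrite oner_eq0.
Qed.

(** If both derivatives vanish at the point, then a nonzero one of them is a shorter relation; if
    both are zero, [Z] is a left multiple of [z - 'X] and the cofactor is a shorter relation. [P]
    carries a property kept by derivation, such as homogeneity or the absence of a letter. *)
Lemma peel_vanish (P : FA R 3 -> Prop) u v Z :
    (forall Z l, P Z -> P (D l Z)) -> aug (etaz z) u = 0 -> aug (etaz z) v = 0 ->
    Z != 0 -> P Z -> sub3 z u v Z = 0 ->
  exists Z', [/\ P Z', sub3 z u v (D x0 Z') != 0 \/ sub3 z u v (D x1 Z') != 0 &
    sub3 z u v (D x0 Z') * rh z u + sub3 z u v (D x1 Z') * rh z v = 0].
Proof.
move=> PD u0 v0; have [k] := Len_exists Z.
elim: k Z => [|k IH] Z LZ nZ PZ Z0.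
  case/eqP: nZ; move: Z0; rewrite (Len0E (etaz x2) LZ) sub3C => /(congr1 (aug (etaz z))).
  by rewrite augC aug0 => ->; rewrite scale0r.
have [aZ rZ] := peel3 Z u0 v0; rewrite Z0 rh0 aug0 in aZ rZ.
have LD l : Len k (D l Z) by apply: Len_fox.
have [A0|nA0] := eqVneq (sub3 z u v (D x0 Z)) 0; last by exists Z; split=> //; left.
have [A1|nA1] := eqVneq (sub3 z u v (D x1 Z)) 0; last by exists Z; split=> //; right.
have [d0|n0] := eqVneq (D x0 Z) 0; last exact: IH (LD x0) n0 (PD _ _ PZ) A0.
have [d1|n1] := eqVneq (D x1 Z) 0; last exact: IH (LD x1) n1 (PD _ _ PZ) A1.
have Ez := peel3_z (esym aZ) d0 d1.
apply: (IH (D x2 Z) (LD _) _ (PD _ _ PZ)).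
  by apply: contraNneq nZ => E0; rewrite Ez E0 mul0r.
move: Z0; rewrite {1}Ez sub3M sub3B sub3C sub3z.
by case/fa_mulf_eq0 => // /eqP; rewrite (negPf (zX_neq0 z)).
Qed.
End Peel3.

Lemma aug_bc_Hom (F : comNzRingType) n (z : 'I_n) (Q : realFieldType) (wt : 'I_n -> Q) m
    (u : FA F n) : wt z = 0 -> Hom wt m u -> m != 0 -> aug (etaz z) (bc u) = 0.
Proof.
move=> wz Hu /eqP m0; have Hb : Hom wt m (bc u) by apply: supp_bc.
apply: Hom_aug Hb m0 => l.
by rewrite /etaz; case: (l =P z) => [->|]; rewrite ?eqxx.
Qed.

Lemma act_eq0 (F : idomainType) n (z : 'I_n) p (u : FA F n) :
  p != 0 -> aug (etaz z) (bc u) = 0 -> act z p u = 0 -> u = 0.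
Proof.
move=> p0 u0 E; have := act_rh z p u; rewrite E bc0 rh0 => /esym/fa_mulf_eq0[].
  by move/zp_eq0/eqP; rewrite (negPf p0).
by move=> r0; rewrite -(lam_bc z u) -lam_rh // r0 lam0.
Qed.

Section Top.
Variables (F : fieldType) (Q : realFieldType).
Local Notation R := {poly F}.
Implicit Types (f g P : FA F 3).

Definition w3 : 'I_3 -> Q := sel3 1 1 0.

Lemma wtw_scale (m : Q) (s : seq 'I_3) : wtw (sel3 m m 0) s = m * wtw w3 s.
Proof.
rewrite /wtw mulr_sumr; apply: eq_bigr => l _; move: l.
by apply: ord3P => /=; rewrite ?mulr1 ?mulr0.
Qed.

Lemma wtw3_nat (s : seq 'I_3) : exists k : nat, wtw w3 s = k%:R.
Proof.
rewrite /wtw; elim: s => [|l s [k IH]]; first by exists 0%N; rewrite big_nil.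
rewrite big_cons IH; move: l; apply: ord3P => /=.
- by exists k.+1; rewrite [RHS]mulrS.
- by exists k.+1; rewrite [RHS]mulrS.
by exists k; rewrite add0r.
Qed.

(** A derivative of the relation between the two leading forms is linear in their normal forms.
    Stripping letters makes its coefficients polynomials in [z], which gives a relation
    [c.fM + d.gM = 0] for the action. *)
Lemma top_gcd f g P (M : Q) : 1 < M -> Fil w3 M f -> Fil w3 M g ->
    sub3 x2 f g P = lett x0 \/ sub3 x2 f g P = lett x1 ->
  exists p q h, [/\ Cop p q, (p != 0) || (q != 0), Hom w3 M h,
    comp w3 M f = act x2 p h & comp w3 M g = act x2 q h].
Proof.
move=> M1 Ff Fg E.
have M0 : M != 0 by apply/eqP => M0; rewrite M0 in M1; move: M1; lra.
pose fM := comp w3 M f; pose gM := comp w3 M g.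
have HfM : Hom w3 M fM := @Hom_comp _ _ _ w3 M f.
have HgM : Hom w3 M gM := @Hom_comp _ _ _ w3 M g.
have nP : P != 0.
  apply/eqP => P0; move: E; rewrite P0 sub3_0.
  have nl (l : 'I_3) : 0 = lett l :> FA F 3 -> False.
    by move/(congr1 (aug (fun=> 1))); rewrite aug0 augX => /esym/eqP; rewrite oner_eq0.
  by case=> /nl.
have [N FN nZ] := top_exists (sel3 M M 0 : 'I_3 -> Q) nP.
set Z := comp _ N P in nZ.
(* For the weights [M], [M], [0] every word has a weight that is a natural multiple of [M > 1],
   hence never the weight 1 of a variable. *)
have N1 : N <> 1.
  have [s] := neq0_supp nZ; rewrite cf_proj; case: (_ =P N) => [<- _|_]; last by rewrite eqxx.
  rewrite wtw_scale; have [[|k] ->] := wtw3_nat s; first by rewrite mulr0; lra.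
  have : 1 <= k.+1%:R :> Q by rewrite ler1n.
  move=> k1; have : M * 1 <= M * k.+1%:R by rewrite ler_pM2l //; move: M1; lra.
  by rewrite mulr1 => le; move: M1; lra.
have U l : Fil w3 (sel3 M M 0 l) (sel3 f g (lett x2) l).
  by move: l; apply: ord3P => //=; apply: HomFil; apply: HomX.
have Z0 : sub3 x2 fM gM Z = 0.
  have := comp_gev idfun U FN; rewrite -/(sub3 x2 f g P).
  have -> : comp w3 N (sub3 x2 f g P) = 0.
    have N1' : 1 <> N by move=> /esym.
    case: E => ->; [have H1 := @HomX _ F _ w3 x0|have H1 := @HomX _ F _ w3 x1];
      exact: comp_ne H1 N1'.
  move=> /esym; rewrite -/Z => <-; apply: eq_gev; apply: ord3P => //=.
  by rewrite comp_id //; apply: HomX.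
have w32 : w3 x2 = 0 by [].
have a_f : aug (etaz x2) (bc fM) = 0 by apply: aug_bc_Hom HfM M0.
have a_g : aug (etaz x2) (bc gM) = 0 by apply: aug_bc_Hom HgM M0.
pose PH (Z : FA R 3) := exists m, Hom (sel3 M M 0 : 'I_3 -> Q) m Z.
have PD Y l : PH Y -> PH (fox (etaz x2) l Y).
  move=> [m Hm]; exists (m - sel3 M M 0 l); apply: Hom_fox Hm => k.
  by rewrite /etaz; case: (k =P x2) => [->|]; rewrite ?eqxx.
have nbZ : bc Z != 0 by apply: contraNneq nZ => bZ; rewrite -(lam_bc x2 Z) bZ lam0.
have Z0' : sub3 x2 (bc fM) (bc gM) (bc Z) = 0 by rewrite -bc_sub3 Z0 bc0.
have PZ : PH (bc Z) by exists N; apply: supp_bc; apply: Hom_comp.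
have [Y [[m HY] nY EY]] := peel_vanish PD a_f a_g nbZ PZ Z0'.
set A0 := sub3 _ _ _ _ in nY EY; set A1 := sub3 _ _ _ (fox _ x1 _) in nY EY.
have HD l : Hom (sel3 M M 0 : 'I_3 -> Q) (m - sel3 M M 0 l) (fox (etaz x2) l Y).
  apply: Hom_fox HY => k.
  by rewrite /etaz; case: (k =P x2) => [->|]; rewrite ?eqxx.
have HU l : Hom w3 (sel3 M M 0 l) (sel3 (bc fM) (bc gM) (lett x2) l).
  by move: l; apply: ord3P => /=; [apply: supp_bc|apply: supp_bc|apply: HomX].
have HA0 : Hom w3 (m - M) A0 by apply: Hom_gev (HD x0).
have HA1 : Hom w3 (m - M) A1 by apply: Hom_gev (HD x1).
(* Reversal puts [A0] and [A1] on the right, where letters can be stripped. They have the same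
   weight, so [strip_rel] applies with [d = 0] and both become polynomials in [z]. *)
have ER : rv (rh x2 (bc fM)) * rv A0 + rv (rh x2 (bc gM)) * rv A1 = 0.
  by rewrite -!rvM -rvD EY rv0.
have wpos (l : 'I_3) : predT l -> l != x2 -> 0 < w3 l.
  by move: l; apply: ord3P.
have inT (u : FA R 3) : inL predT u by move=> s _; apply: all_predT.
have [c [d [cd0 Ecd]]] : exists c d, (c != 0) || (d != 0) /\
    rv (rh x2 (bc fM)) * zp x2 c + rv (rh x2 (bc gM)) * zp x2 d = 0.
  have H (u v a b : FA R 3) : a != 0 -> Hom w3 (m - M) a -> Hom w3 (m - M) b -> u * a + v * b = 0 ->
      exists c d, c != 0 /\ u * zp x2 c + v * zp x2 d = 0.
    move=> na Ha Hb Eab.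
    have [|c [b' [nc Ib Hb' Ec]]] := strip_rel w32 wpos (lexx 0) (inT a) (inT b) Ha _ na Eab.
      by rewrite addr0.
    by have [d dE] := Hom0_zp w32 wpos Ib Hb'; exists c, d; rewrite -dE.
  case: nY => nA.
    have [|c [d [c0 Ec]]] := H _ _ _ _ _ (Hom_rv HA0) (Hom_rv HA1) ER; first by rewrite rv_eq0.
    by exists c, d; rewrite c0.
  rewrite addrC in ER.
  have [|c [d [c0 Ec]]] := H _ _ _ _ _ (Hom_rv HA1) (Hom_rv HA0) ER; first by rewrite rv_eq0.
  by exists d, c; rewrite c0 orbT addrC.
have Eact : act x2 c fM + act x2 d gM = 0.
  have := congr1 (fun u => lam x2 (rv u)) Ecd; rewrite /= rv0 lam0 rvD !rvM !rv_zp !rvK lamD.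
  by rewrite -!rh_zpM !lam_rh ?augM ?a_f ?a_g ?mulr0 // -!actE.
have dc0 : (- d != 0) || (c != 0) by rewrite oppr_eq0 orbC.
have [p [q [cpq pq0 Epq]]] := cop_exists dc0.
(* Follows from [c.fM = - d.gM] and [c p = - d q] by cancelling [c], or [d] in case [c = 0]. *)
have EE : act x2 q fM = act x2 p gM.
  have aq : aug (etaz x2) (bc (act x2 q fM - act x2 p gM)) = 0.
    have Hq : Hom w3 M (act x2 q fM - act x2 p gM) by apply: HomB; apply: act_Hom.
    exact: aug_bc_Hom w32 Hq M0.
  apply/eqP; rewrite -subr_eq0; apply/eqP.
  have Ef : act x2 c fM = - act x2 d gM by apply/eqP; rewrite -addr_eq0 Eact.
  have [c0|c0] := eqVneq c 0.
    apply: (act_eq0 (z := x2) (p := d)) => //; first by move: cd0; rewrite c0 eqxx.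
    rewrite actB -!actM [d * p]mulrC [d * q]mulrC !actM.
    have -> : act x2 d gM = 0 by apply/eqP; rewrite -oppr_eq0 -Ef c0 act0l.
    have qd : q * d = 0.
      by apply/eqP; rewrite -oppr_eq0 mulrC -mulNr -Epq c0 mul0r.
    by rewrite act0 subr0 -actM qd act0l.
  apply: (act_eq0 (z := x2) c0) => //.
  have e1 : act x2 c (act x2 q fM) = act x2 q (act x2 c fM) by rewrite -!actM mulrC.
  by rewrite actB e1 Ef actN -!actM Epq mulNr actNl opprK mulrC addNr.
have [h0 [fE gE]] := cop_act cpq a_f a_g EE.
exists p, q, (comp w3 M h0); split=> //; first exact: Hom_comp.
  by rewrite -act_comp // -fE [RHS]comp_id.
by rewrite -act_comp // -gE [RHS]comp_id.
Qed.
End Top.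

Lemma aug_bc_supp (F : comNzRingType) n (z : 'I_n) (Q : realFieldType) (wt : 'I_n -> Q)
    (u : FA F n) :
  wt z = 0 -> supp (fun s => wtw wt s != 0) u -> aug (etaz z) (bc u) = 0.
Proof.
move=> wz Hu.
have Hb : supp (fun s => wtw wt s != 0) (bc u) by apply: supp_bc.
apply: aug_supp Hb => s; apply: contraR; rewrite -all_predC => es; apply/eqP.
apply: (wtw_eta (eta := etaz z : _ -> {poly F})) => [l|]; last exact: es.
by rewrite /etaz; case: (l =P z) => [->|]; rewrite ?eqxx.
Qed.

Section FoxMore.
Variables (F : comNzRingType) (n : nat) (z : 'I_n).
Local Notation D := (fox (etaz z : 'I_n -> {poly F})).
Implicit Types (x : FA {poly F} n) (u : FA F n).

Lemma fox_zX m x : m != z -> D m (x * (lett z - 'X%:A)) = 0.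
Proof.
move=> mz; rewrite foxM foxB foxX foxC augB augX augC /etaz eqxx subrr scale0r addr0.
by rewrite eq_sym (negPf mz) subr0 mulr0.
Qed.

Lemma fox_rh m x : m != z -> D m (rh z x) = D m x.
Proof.
move=> mz; rewrite {2}(rh_decomp z x) !foxD foxC fox_zX //.
by rewrite add0r addr0.
Qed.

Lemma aug_rh x : aug (etaz z) (rh z x) = 0.
Proof.
apply: (addrI (aug (etaz z) x)); rewrite addr0 {3}(rh_decomp z x) !augD augC.
by rewrite augM augB augX augC /etaz eqxx subrr mulr0 addr0.
Qed.

Lemma fox_act m p u : m != z -> D m (bc (act z p u)) = zp z p * D m (bc u).
Proof.
by move=> mz; rewrite -fox_rh // act_rh foxM fox_rh // aug_rh scale0r addr0.
Qed.

Lemma fox_gev n' (z' : 'I_n') (U : 'I_n' -> FA {poly F} n) (x : FA {poly F} n') m :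
    m != z -> U z' = lett z -> (forall l, l != z' -> aug (etaz z) (U l) = 0) ->
  D m (gev idfun U x) = \sum_(l | l != z') gev idfun U (fox (etaz z') l x) * D m (U l).
Proof.
move=> mz Uz U0; rewrite -fox_rh // (proj2 (rh_gev x Uz U0)).
elim/big_rec2: _ => [|l y1 y2 lz <-]; first exact: fox0.
by rewrite foxD foxM fox_rh // aug_rh scale0r addr0.
Qed.
End FoxMore.

Section LFree.
Variables (F : idomainType) (n : nat).
Implicit Types (u v : FA F n).

Lemma fox_lfree eta (t : 'I_n) u : lfree t u -> fox eta t u = 0.
Proof.
move=> Lu; apply: supp_contra; apply: supp_fox Lu => s s'.
by rewrite mem_cat mem_head orbT.
Qed.

Lemma lfree_fox eta (t l : 'I_n) u : lfree t u -> lfree t (fox eta l u).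
Proof. by apply: supp_fox => s s'; rewrite mem_cat negb_or => /andP[]. Qed.

Lemma lfreeM (t : 'I_n) u v : lfree t u -> lfree t v -> lfree t (u * v).
Proof. by apply: supp_mul => s s' ? ?; rewrite mem_cat negb_or; apply/andP. Qed.

Lemma lfree_lett (t l : 'I_n) : t != l -> lfree t (lett l : FA F n).
Proof. by move=> tl; apply: supp_mon; rewrite inE. Qed.

Lemma lfree_zp (t z : 'I_n) p : t != z -> lfree t (zp z p : FA F n).
Proof.
move=> tz; apply: supp_zp => // s; rewrite mem_cat inE negb_or tz andbT.
by [].
Qed.

Lemma lfree_gev n' (U : 'I_n -> FA F n') (U' : 'I_n -> FA F n') (t : 'I_n) u :
  (forall l, l != t -> U l = U' l) -> lfree t u -> gev idfun U u = gev idfun U' u.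
Proof.
move=> UU; move: u; apply: fa_suppind => [|u v Hu Hv|c s ts]; first by rewrite !gev0.
  by rewrite !gevD Hu Hv.
rewrite !gevU; congr (_ *: _); rewrite big_seq [RHS]big_seq; apply: eq_bigr => l ls.
by apply: UU; apply: contraNneq ts => <-.
Qed.

Lemma lfree_mulr (t : 'I_n) u v : v != 0 -> lfree t (u * v) -> lfree t u.
Proof.
move=> nv Luv; case: (eqVneq u 0) => [->|nu]; first exact: supp0.
by case: (lfree_mulf Luv nu nv).
Qed.

Lemma zp_neq0 (z : 'I_n) p : p != 0 -> (zp z p : FA F n) != 0.
Proof. by apply: contraNneq => /zp_eq0/eqP. Qed.

Lemma Fil_mul_zp (Q : realFieldType) (wt : 'I_n -> Q) (z : 'I_n) m u p :
  wt z = 0 -> p != 0 -> Fil wt m (u * zp z p) -> Fil wt m u.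
Proof.
move=> wz p0 Fup; case: (eqVneq u 0) => [->|nu]; first exact: Fil0.
have [a Fa na] := top_exists wt nu.
have H0 : Hom wt 0 (zp z p : FA F n) := @Hom_zp _ _ _ _ wt p wz.
have := Fil_mulf_le Fup Fa na (HomFil H0); rewrite comp_id // addr0 => am.
by apply: FilW Fa; apply: am; apply: zp_neq0.
Qed.

Lemma lfree_bc (t : 'I_n) u : lfree t u -> lfree t (bc u).
Proof. exact: supp_bc. Qed.
End LFree.

Section StripLin.
Variables (F : idomainType) (n : nat) (z : 'I_n) (Q : realFieldType) (wt : 'I_n -> Q).
Hypothesis wz : wt z = 0.
Variables (p q : {poly {poly F}}).
Hypothesis cpq : Cop p q.
Implicit Types (u v w : FA F n).

(** The parts of weight above [e] satisfy [q.u = p.v] exactly and, having positive weight, contain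
    no polynomial in [z], so [cop_act] divides them. The action preserves weights, hence [w] can be
    cut down to the weights between [e] and [M]. *)
Lemma strip_lin e M u v : 0 <= e -> Fil wt M u -> Fil wt M v ->
    Fil wt e (act z q u - act z p v) ->
  exists a b w, [/\ u = a + act z p w, v = b + act z q w, Fil wt e a, Fil wt e b &
    supp (fun s => (e < wtw wt s) && (wtw wt s <= M)) w].
Proof.
move=> e0 Fu Fv Fe.
pose X := (fun s : seq 'I_n => e < wtw wt s).
have zX : zinv z X := zinv_wt wz (fun x => e < x).
pose Y := (fun s : seq 'I_n => (e < wtw wt s) && (wtw wt s <= M)).
have zY : zinv z Y := zinv_wt wz (fun x => (e < x) && (x <= M)).
have FX (x : FA F n) : Fil wt e (x - proj X x).
  by move=> s /(supp_projC (Q := fun=> True)) H; case: H => // _; rewrite -leNgt.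
have aX (x : FA F n) : aug (etaz z) (bc (proj X x)) = 0.
  apply: aug_bc_supp wz _ => s /supp_proj; rewrite /X => es.
  by rewrite gt_eqF // (le_lt_trans e0 es).
have E : act z q (proj X u) = act z p (proj X v).
  apply/eqP; rewrite -subr_eq0 -!(act_proj _ _ zX) -projB; apply/eqP; apply: proj_0.
  by apply: suppW Fe => s; rewrite /X -leNgt.
have [w [uw vw]] := cop_act cpq (aX u) (aX v) E.
have XY (x : FA F n) : Fil wt M x -> proj X x = proj Y (proj X x).
  move=> Fx; rewrite (proj_id (P := Y)) // => s; rewrite cf_proj /X /Y.
  by case: ifP => [es /Fx ->|]; rewrite ?eqxx // es.
exists (u - proj X u), (v - proj X v), (proj Y w); split=> //.
- by rewrite -(act_proj _ _ zY) -uw -XY // subrK.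
- by rewrite -(act_proj _ _ zY) -vw -XY // subrK.
by move=> s /supp_proj.
Qed.
End StripLin.

Section Coefficients.
Variables (F : comNzRingType) (n : nat).
Implicit Types (x y : FA {poly F} n) (u : FA F n).

(** Brings the derivatives, which have coefficients in [{poly F}], back to elements over [F], so
    that an induction stated over [F] applies to them. *)
Definition cof i : FA {poly F} n -> FA F n := aext (fun s (c : {poly F}) => c`_i *: mon F s).

Let gB i (s : seq (ordinal n)) : zmod_morphism (fun c : {poly F} => c`_i *: mon F s).
Proof. by move=> c d; rewrite coefB scalerBl. Qed.

Lemma cof0 i : cof i 0 = 0. Proof. exact: aext0. Qed.
Lemma cofD i x y : cof i (x + y) = cof i x + cof i y. Proof. exact: aextD. Qed.
Lemma cofU i c s : cof i (c *: mon {poly F} s) = c`_i *: mon F s. Proof. exact: aextU. Qed.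

Lemma cofZ_bc i c u : cof i (c *: bc u) = c`_i *: u.
Proof.
move: u; apply: fa_ind => [|u v Hu Hv|d s]; first by rewrite bc0 !scaler0 cof0.
  by rewrite bcD !scalerDr cofD Hu Hv.
by rewrite bcU scalerA cofU scalerA mulrC coefCM mulrC.
Qed.

Lemma supp_cof (P : seq 'I_n -> Prop) i x : supp P x -> supp P (cof i x).
Proof.
move: x; apply: fa_suppind => [|x y Hx Hy|c s Ps]; first by rewrite cof0; apply: supp0.
  by rewrite cofD; apply: suppD.
by rewrite cofU; apply: suppU.
Qed.

Lemma cof_decomp x : exists N, x = \sum_(i < N) 'X^i *: bc (cof i x).
Proof.
suff [N H] : exists N, forall k, (N <= k)%N -> x = \sum_(i < k) 'X^i *: bc (cof i x).
  by exists N; apply: H.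
move: x; apply: fa_ind => [|x y [N Hx] [N' Hy]|c s].
- by exists 0%N => k _; rewrite big1 // => i _; rewrite cof0 bc0 scaler0.
- exists (maxn N N') => k; rewrite geq_max => /andP[/Hx {1}-> /Hy {1}->].
  by rewrite -big_split; apply: eq_bigr => i _; rewrite cofD bcD scalerDr.
exists (size c) => k ck.
have {1}-> : c = \sum_(i < k) 'X^i * (c`_i)%:P.
  apply/polyP => j; rewrite coef_sum; under eq_bigr => i _ do rewrite coefMC coefXn.
  have [jk|kj] := ltnP j k.
    rewrite (bigD1 (Ordinal jk)) //= eqxx mul1r big1 ?addr0 // => i ij.
    by rewrite (_ : (j == i) = false) ?mul0r //; apply/eqP => E; case/eqP: ij; apply: val_inj.
  rewrite nth_default ?(leq_trans ck) // big1 // => i _.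
  by rewrite gtn_eqF ?mul0r // (leq_trans _ kj).
rewrite scaler_suml; apply: eq_bigr => i _.
by rewrite cofU bcU scalerA.
Qed.
End Coefficients.

Lemma cof_gev (F : comNzRingType) n n' (U : 'I_n -> FA F n') i x :
  cof i (gev idfun (fun l => bc (U l)) x) = gev idfun U (cof i x).
Proof.
move: x; apply: fa_ind => [|x y Hx Hy|c s]; first by rewrite gev0 !cof0 gev0.
  by rewrite gevD !cofD gevD Hx Hy.
have -> : c *: mon {poly F} s = c *: bc (mon F s).
  by rewrite -[mon F s]scale1r bcU scale1r.
by rewrite gevZ -bc_gev !cofZ_bc gevZ.
Qed.

(** * Invariants of the translations by p, q *)

Lemma bc_letters (F : comNzRingType) n (x : FA {poly F} n) :
  gev idfun (fun l => bc (lett l : FA F n)) x = x.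
Proof. by rewrite -[RHS]gev_id; apply: eq_gev => l; rewrite bcX. Qed.

Lemma lt_mul_zp (R : idomainType) n (z : 'I_n) (Q : realFieldType) (wt : 'I_n -> Q) K r
    (u : FA R n) : wt z = 0 -> r != 0 ->
  supp (fun s => wtw wt s < K) (u * zp z r) -> supp (fun s => wtw wt s < K) u.
Proof.
move=> wz r0 Hu; case: (eqVneq u 0) => [->|nu]; first exact: supp0.
have [m Fm nm] := top_exists wt nu.
have H0 : Hom wt 0 (zp z r : FA R n) by apply: Hom_zp.
have : comp wt (m + 0) (u * zp z r) != 0.
  rewrite (comp_mul Fm (HomFil H0)) (comp_id H0).
  by apply: fa_mulf_neq0 => //; apply: zp_neq0.
case/neq0_supp => s; rewrite cf_proj addr0; case: (_ =P m) => [sm us|_]; last by rewrite eqxx.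
by move=> s' /Fm => le; apply: le_lt_trans le _; rewrite -sm; apply: Hu.
Qed.

Section VInv.
Variables (F : fieldType) (p q : {poly {poly F}}).
Hypotheses (cpq : Cop p q) (pq0 : (p != 0) || (q != 0)).
Local Notation R := {poly F}.
Local Notation D := (fox (etaz y2 : 'I_5 -> R)).
Implicit Types (Z : FA F 5) (x : FA R 5).

(* The letters of [FA F 5] are [a], [b], [z], [W] and [t]; the substitution adds
   [p . t] to [a] and [q . t] to [b]. *)
Definition vU : 'I_5 -> FA F 5 :=
  sel5 (lett y0 + act y2 p (lett y4)) (lett y1 + act y2 q (lett y4))
    (lett y2) (lett y3) (lett y4).
Definition vinv Z := gev idfun vU Z = Z.
Definition eps : FA F 5 := act y2 q (lett y0) - act y2 p (lett y1).
(** Polynomials in the evident invariants [eps], [W] and [z]; [vinv_iotaE] shows that there are no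
    other invariants without [y4]. *)
Definition iota : FA F 3 -> FA F 5 := sub3 y2 eps (lett y3).

Local Notation w5d := (sel5 1 1 0 1 1 : 'I_5 -> rat).
Local Notation vR := (gev idfun (fun l => bc (vU l))).

Lemma etaz_w5 (Q : realFieldType) (w : 'I_5 -> Q) l :
  w y2 = 0 -> etaz y2 l != 0 :> R -> w l = 0.
Proof. by move=> w2; rewrite /etaz; case: (l =P y2) => [->|]; rewrite ?eqxx. Qed.

Lemma vU_Hom l : Hom w5d (w5d l) (vU l).
Proof.
move: l; apply: ord5P => /=; try exact: HomX.
  by apply: HomD; [exact: HomX | apply: act_Hom => //; apply: HomX].
by apply: HomD; [exact: HomX | apply: act_Hom => //; apply: HomX].
Qed.

Lemma aug_vU l : l != y2 -> aug (etaz y2) (bc (vU l)) = 0.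
Proof.
move=> l2; have Hl := vU_Hom (l := l); apply: aug_bc_Hom Hl _ => //.
by move: l l2; apply: ord5P.
Qed.

Lemma vinv_eps : vinv eps.
Proof.
rewrite /vinv /eps gevB !(act_gev (z' := y2)) // !gevX /= !actD -!actM [q * p]mulrC.
by rewrite opprD addrACA subrr addr0.
Qed.

Lemma vinv_iota Y : vinv (iota Y).
Proof. by rewrite /vinv /iota (gev_sub3 (z' := y2)) // vinv_eps gevX. Qed.

Lemma fox_vR m x : m != y2 -> D m (vR x) =
  vR (D y0 x) * D m (bc (vU y0)) + vR (D y1 x) * D m (bc (vU y1)) +
  vR (D y3 x) * D m (lett y3) + vR (D y4 x) * D m (lett y4).
Proof.
move=> m2; rewrite (fox_gev (z' := y2)) ?sum5z //= ?bcX // => l.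
exact: aug_vU.
Qed.

Lemma fox_vU0 m : m != y2 -> D m (bc (vU y0)) = (y0 == m)%:R + zp y2 p * (y4 == m)%:R.
Proof. by move=> m2; rewrite /vU /= bcD foxD fox_act // !bcX !foxX. Qed.

Lemma fox_vU1 m : m != y2 -> D m (bc (vU y1)) = (y1 == m)%:R + zp y2 q * (y4 == m)%:R.
Proof. by move=> m2; rewrite /vU /= bcD foxD fox_act // !bcX !foxX. Qed.

Local Notation t0 := (sel5 (lett y0) (lett y1) (lett y2) (lett y3) 0 : 'I_5 -> FA F 5).

Lemma t0_id (R' : idomainType) (x : FA R' 5) : lfree y4 x ->
  gev idfun (sel5 (lett y0) (lett y1) (lett y2) (lett y3) 0) x = x.
Proof.
move=> Lx; rewrite -[RHS]gev_id; apply: lfree_gev Lx.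
by apply: ord5P.
Qed.

Lemma t0_vU l : l != y4 -> gev idfun t0 (vU l) = lett l.
Proof.
move: l; apply: ord5P => //= _; rewrite ?gevD ?gevX // (act_gev (z' := y2)) // gevX /=.
  by rewrite act0 addr0.
by rewrite act0 addr0.
Qed.

Lemma t0_vR x : lfree y4 x -> gev idfun (fun l => bc (t0 l)) (vR x) = x.
Proof.
move=> Lx; rewrite (gev_comp (phi'' := idfun)) // -[RHS]bc_letters.
apply: lfree_gev Lx => l l4; by rewrite -bc_gev t0_vU.
Qed.

Lemma cof_vinv x i : vR x = x -> vinv (cof i x).
Proof. by rewrite /vinv => E; rewrite -cof_gev E. Qed.

Lemma rh5 x : rh y2 x = D y0 x * lett y0 + D y1 x * lett y1 + D y3 x * lett y3 + D y4 x * lett y4.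
Proof. by rewrite rhE sum5z. Qed.

Lemma rh_eps : rh y2 (bc eps) = zp y2 q * lett y0 - zp y2 p * lett y1.
Proof. by rewrite /eps bcB rhB !act_rh !bcX !rhX. Qed.

Lemma aug_eps : aug (etaz y2) (bc eps) = 0.
Proof.
have H : Hom w5d 1 eps by apply: HomB; apply: act_Hom => //; apply: HomX.
exact: aug_bc_Hom H _.
Qed.

(** Differentiating the invariance along [y4] and then setting [y4] to 0 gives a syzygy of [p] and
    [q] between the derivatives along [y0] and [y1]. By coprimality these two come from one multiple
    of [rh eps]. *)
Lemma vinv_step x : lfree y4 x -> vR x = x -> exists c C,
  [/\ rh y2 x = c * rh y2 (bc eps) + C * lett y3,
      lfree y4 c /\ lfree y4 C, vR c = c /\ vR C = C, C = D y3 x &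
      D y0 x = c * zp y2 q /\ D y1 x = - c * zp y2 p].
Proof.
move=> Lx Vx.
have x4 : D y4 x = 0 by apply: fox_lfree.
have LD l : lfree y4 (D l x) by apply: lfree_fox.
have E4 : D y0 x * zp y2 p + D y1 x * zp y2 q = 0.
  have := @fox_vR y4 x isT; rewrite Vx x4 fox_vU0 // fox_vU1 // foxX /=.
  rewrite !add0r !mulr1 gev0 mul0r mulr0 !addr0 => /esym.
  move=> /(congr1 (gev idfun (fun l => bc (t0 l)))).
  by rewrite gev0 gevD !gevM !t0_vR // !(gevz_zp (z' := y2)) /= ?bcX.
have E0 : vR (D y0 x) = D y0 x.
  have := @fox_vR y0 x isT; rewrite Vx x4 fox_vU0 // fox_vU1 // !foxX /=.
  by rewrite gev0 !(mulr0, mul0r, addr0, add0r, mulr1) => <-.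
have E1 : vR (D y1 x) = D y1 x.
  have := @fox_vR y1 x isT; rewrite Vx x4 fox_vU0 // fox_vU1 // !foxX /=.
  by rewrite gev0 !(mulr0, mul0r, addr0, add0r, mulr1) => <-.
have E3 : vR (D y3 x) = D y3 x.
  have := @fox_vR y3 x isT; rewrite Vx x4 fox_vU0 // fox_vU1 // !foxX /=.
  by rewrite gev0 !(mulr0, mul0r, addr0, add0r, mulr1) => <-.
have [w [wp wq]] : exists w, D y1 x = w * zp y2 p /\ - D y0 x = w * zp y2 q.
  apply: cop_zp cpq _; apply/eqP; rewrite -subr_eq0 mulNr opprK addrC E4.
  by [].
have A0 : D y0 x = - w * zp y2 q by rewrite mulNr -wq opprK.
have A1 : D y1 x = - (- w) * zp y2 p by rewrite opprK wp.
have vzp r : vR (zp y2 r) = zp y2 r by rewrite (gevz_zp (z' := y2)) //= bcX.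
exists (- w), (D y3 x); split=> //.
- rewrite rh5 x4 mul0r addr0 rh_eps A0 A1 mulrBr !mulrA; congr (_ + _ + _).
  by rewrite !mulNr.
- split=> //; case/orP: pq0 => n0.
    apply: suppN; apply: (lfree_mulr (zp_neq0 y2 n0)). by rewrite -wp.
  by apply: (lfree_mulr (zp_neq0 y2 n0)); rewrite -A0.
split=> //; rewrite gevN; congr (- _); case/orP: pq0 => n0.
  by apply: (fa_mulIf (zp_neq0 y2 n0)); rewrite -wp -{1}(vzp p) -gevM -wp.
apply: (fa_mulIf (zp_neq0 y2 n0)); rewrite -wq -{1}(vzp q) -gevM -wq gevN E0.
by [].
Qed.

Lemma iota_lift c : (forall i, exists Y, cof i c = iota Y) ->
  exists Y, c = sub3 y2 (bc eps) (lett y3) Y.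
Proof.
move=> H; have [N cE] := cof_decomp c; rewrite cE.
elim/big_ind: _ => [|u v [Y ->] [Y' ->]|i _].
- by exists 0; rewrite sub3_0.
- by exists (Y + Y'); rewrite sub3D.
have [Y ->] := H i; exists ('X^i *: bc Y).
by rewrite /iota bc_sub3 bcX [RHS]gevZ.
Qed.

(** Induction on the degree: the coefficients given by [vinv_step] are again invariant and of
    smaller degree. They determine [Z] up to a polynomial in [z], its augmentation. *)
Lemma vinv_iotaE k Z : lfree y4 Z -> vinv Z ->
  supp (fun s => wtw w5d s < k%:R) Z -> exists Y, Z = iota Y.
Proof.
elim: k Z => [|k IH] Z LZ VZ kZ.
  exists 0; rewrite [RHS]sub3_0; apply: supp_contra => s /kZ; apply/negP; rewrite -leNgt.
  by apply: sumr_ge0 => l _; move: l; apply: ord5P.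
have Vx : vR (bc Z) = bc Z by rewrite -bc_gev VZ.
have [c [C [Erh [Lc LC] [Vc VC] CE [c0 c1]]]] := vinv_step (lfree_bc LZ) Vx.
have kx : supp (fun s => wtw w5d s < k.+1%:R) (bc Z) by apply: supp_bc.
have kD l : l != y2 -> supp (fun s => wtw w5d s < k%:R) (D l (bc Z)).
  move=> l2; apply: supp_fox kx => s s'; rewrite /wtw big_cat big_cons /= => + es.
  rewrite (wtw_eta _ es) => [|m]; last by apply: etaz_w5.
  have -> : w5d l = 1 by move: l l2; apply: ord5P.
  by rewrite addr0 -natr1 ltrD2r.
have kc : supp (fun s => wtw w5d s < k%:R) c.
  case/orP: pq0 => n0.
    rewrite -[c]opprK; apply: suppN; apply: (lt_mul_zp (z := y2) _ n0) => //.
    by rewrite -c1; apply: kD.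
  by apply: (lt_mul_zp (z := y2) _ n0) => //; rewrite -c0; apply: kD.
have kC : supp (fun s => wtw w5d s < k%:R) C by rewrite CE; apply: kD.
have [Yc cY] : exists Y, c = sub3 y2 (bc eps) (lett y3) Y.
  apply: iota_lift => i; apply: IH; [exact: supp_cof | exact: cof_vinv | exact: supp_cof].
have [YC CY] : exists Y, C = sub3 y2 (bc eps) (lett y3) Y.
  apply: iota_lift => i; apply: IH; [exact: supp_cof | exact: cof_vinv | exact: supp_cof].
exists (zp x2 (aug (etaz y2) (bc Z)) + lam x2 (Yc * lett x0 + YC * lett x1)).
rewrite /iota sub3D.
have -> : sub3 y2 eps (lett y3) (zp x2 (aug (etaz y2) (bc Z))) = zp y2 (aug (etaz y2) (bc Z)).
  by rewrite /sub3 (gevz_zp (z' := y2)).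
rewrite /sub3 -(lam_gev (z' := y2)) // -{1}(lam_bc y2 Z) {1}(rh_decomp y2 (bc Z)).
rewrite !lamD lam_zX addr0 lamC; congr (_ + _).
have -> : gev idfun (fun l => bc (sel3 eps (lett y3) (lett y2) l)) (Yc * lett x0 + YC * lett x1) =
    c * bc eps + C * bc (lett y3).
  rewrite gevD !gevM !gevX /= cY CY; congr (_ * _ + _ * _);
  by apply: eq_gev; apply: ord3P => //=; rewrite bcX.
by rewrite Erh !lamD bcX; congr (_ + _); apply: lam_mulr; rewrite lam_rh // aug_eps.
Qed.
End VInv.

(** * Words cut at the first occurrence of a letter *)

Section Cut.
Variables (R : comNzRingType) (n : nat) (t z : 'I_n) (Q : realFieldType) (wt : 'I_n -> Q).
Hypotheses (tz : t != z) (wz : wt z = 0).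
Implicit Types (u v x : FA R n) (r s : seq 'I_n).

Definition cutw r s : FA R n :=
  if (t \in s) && (drop (index t s).+1 s == r) then mon R (take (index t s) s) else 0.
(* [u t r |-> u] for the words [u] without [t] *)
Definition cut r : FA R n -> FA R n := lext (cutw r).

Lemma cut0 r : cut r 0 = 0. Proof. exact: lext0. Qed.
Lemma cutD r u v : cut r (u + v) = cut r u + cut r v. Proof. exact: lextD. Qed.
Lemma cutU r c s : cut r (c *: mon R s) = c *: cutw r s. Proof. exact: lextU. Qed.

Definition pfx s : Q := wtw wt (take (index t s) s).

Lemma cut_lfree r u : lfree t u -> cut r u = 0.
Proof.
move: u; apply: fa_suppind => [|u v Hu Hv|c s ts]; first exact: cut0.
  by rewrite cutD Hu Hv addr0.
by rewrite cutU /cutw (negPf ts) scaler0.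
Qed.

Lemma cutM r u v : lfree t u -> cut r (u * v) = u * cut r v.
Proof.
move=> Lu; move: u Lu; apply: fa_suppind => [|u u' Hu Hu'|c s ts].
- by rewrite !mul0r cut0.
- by rewrite !mulrDl cutD Hu Hu'.
move: v; apply: fa_ind => [|v v' Hv Hv'|d s'].
- by rewrite !mulr0 cut0 mulr0.
- by rewrite mulrDr !cutD Hv Hv' mulrDr.
rewrite monU_mul !cutU /cutw mem_cat (negPf ts) /=.
rewrite index_cat (negPf ts) take_cat drop_cat.
set i := index t s'.
have -> : (size s + i < size s)%N = false by rewrite ltnNge leq_addr.
have -> : ((size s + i).+1 < size s)%N = false.
  by rewrite ltnNge (leq_trans (leq_addr i _)).
rewrite addKn -addnS addKn; case: ifP => _; last by rewrite !scaler0 mulr0.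
by rewrite monU_mul.
Qed.

Lemma cf_cut r x s : t \notin s -> cf s (cut r x) = cf (s ++ t :: r) x.
Proof.
move=> ts; move: x; apply: fa_ind => [|x y Hx Hy|c w].
- by rewrite cut0 !cf0.
- by rewrite cutD !cfD Hx Hy.
rewrite cutU !cfZ cf_mon /cutw; congr (_ * _).
have [->|ne] := eqVneq w (s ++ t :: r).
  rewrite mem_cat mem_head orbT /= index_cat (negPf ts) /= eqxx addn0.
  rewrite take_size_cat // drop_cat ltnNge leqnSn /= subSnn /= drop0 eqxx.
  by rewrite cf_mon eqxx.
case: ifP => [/andP[tw /eqP rE]|_]; last by rewrite cf0.
rewrite cf_mon; case: eqP => // sE; case/eqP: ne.
rewrite -sE -rE -{1}(cat_take_drop (index t w) w); congr (_ ++ _).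
by rewrite (drop_nth t) ?index_mem // nth_index.
Qed.

Lemma lfree_cut r x : lfree t (cut r x).
Proof.
move: x; apply: fa_ind => [|x y Hx Hy|c w].
- by rewrite cut0; apply: supp0.
- by rewrite cutD; apply: suppD.
rewrite cutU; apply: suppZ; rewrite /cutw; case: ifP => _; last exact: supp0.
apply: supp_mon; apply/negP => tt; have := tt; rewrite -index_mem => lt.
have := index_cat t (take (index t w) w) (drop (index t w) w).
rewrite cat_take_drop tt => E; rewrite -E in lt.
have : (size (take (index t w) w) <= index t w)%N by rewrite size_take; case: ltnP.
by rewrite leqNgt lt.
Qed.

(* The bound of the prefix before the first [t]; words without [t] are bounded
   as a whole. *)
Definition Bd (lam c : Q) u := supp
  (fun s => if t \in s then pfx s <= c + lam else wtw wt s <= c) u.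

Lemma BdM lm c d u v : 0 <= d -> Bd lm c u -> Bd lm d v -> Bd lm (c + d) (u * v).
Proof.
move=> d0; apply: supp_mul => s s'; rewrite mem_cat /pfx index_cat take_cat wtwM.
case ts: (t \in s) => /=.
  by rewrite index_mem ts => h _; lra.
rewrite ltnNge leq_addr /= addKn wtwM => h; case: ifP => _ h'; lra.
Qed.

(** As all words of [u] contain [t], the first [t] of a product lies in the left factor, and the cut
    leaves a prefix of a word of [u]. *)
Lemma Bd_cut lm c r u : supp (fun s => t \in s) u -> Bd lm c u ->
  forall v, Fil wt (c + lm) (cut r (u * v)).
Proof.
move=> Tu Bu; move: u {Tu Bu}(supp_and Tu Bu).
apply: fa_suppind => [|u u' Hu Hu'|d s [ts ps]] v.
- by rewrite mul0r cut0; apply: Fil0.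
- by rewrite mulrDl cutD; apply: FilD.
rewrite ts in ps; move: v; apply: fa_ind => [|v v' Hv Hv'|c' s'].
- by rewrite mulr0 cut0; apply: Fil0.
- by rewrite mulrDr cutD; apply: FilD.
rewrite monU_mul cutU; apply: FilZ; rewrite /cutw; case: ifP => _; last exact: Fil0.
apply: supp_mon; rewrite index_cat ts take_cat index_mem ts; exact: ps.
Qed.

Lemma Bd_lam lm c (x : FA {poly R} n) :
  supp (fun s => if t \in s then pfx s <= c + lm else wtw wt s <= c) x ->
  Bd lm c (lam z x).
Proof.
apply: supp_lam => s; rewrite mem_cat inE (negPf tz) orbF /pfx wtwM wtwU wz addr0.
by case ts: (t \in s) => //; rewrite index_cat ts take_cat index_mem ts.
Qed.

End Cut.

Lemma notin_take_index (T : eqType) (t : T) s : t \notin take (index t s) s.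
Proof.
apply/negP => tt; have := tt; rewrite -index_mem => lt.
have := index_cat t (take (index t s) s) (drop (index t s) s).
rewrite cat_take_drop tt => E; rewrite -E in lt.
have : (size (take (index t s) s) <= index t s)%N by rewrite size_take; case: ltnP.
by rewrite leqNgt lt.
Qed.

Lemma t0_proj (R : comNzRingType) (u : FA R 5) :
  gev idfun (sel5 (lett y0) (lett y1) (lett y2) (lett y3) 0) u =
    proj (fun s => y4 \notin s) u.
Proof.
move: u; apply: fa_ind => [|u v Hu Hv|c s]; first by rewrite gev0 proj0.
  by rewrite gevD projD Hu Hv.
rewrite gevU projU; case: ifP => [|/negbFE] ys.
  congr (_ *: _); elim: s ys => [|l s IH]; first by rewrite big_nil mon0.
  rewrite inE negb_or big_cons mon_cons => /andP[ly /IH ->]; congr (_ * _).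
  by move: l ly; apply: ord5P.
suff -> : \prod_(i <- s) sel5 (lett y0) (lett y1) (lett y2) (lett y3) 0 i = 0 :> FA R 5.
  by rewrite scaler0.
elim: s ys => // l s IH; rewrite inE big_cons => /orP[/eqP<-|/IH->]; last by rewrite mulr0.
by rewrite /= mul0r.
Qed.

Lemma Len_w5d (R : comNzRingType) k (u : FA R 5) : Len k u ->
  supp (fun s => wtw (sel5 1 1 0 1 1 : 'I_5 -> rat) s < k.+1%:R) u.
Proof.
apply: suppW => s sk; apply: (@le_lt_trans _ _ (size s)%:R); last by rewrite ltr_nat ltnS.
rewrite /wtw; elim: s {sk} => [|l s IH]; first by rewrite big_nil.
rewrite big_cons /= -[(size s).+1]addn1 natrD addrC lerD //.
by move: l; apply: ord5P.
Qed.

(** * The extremal occurrences of [y4] *)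

Section Ends.
Variables (F : fieldType) (p q : {poly {poly F}}).
Hypotheses (cpq : Cop p q) (pq0 : (p != 0) || (q != 0)).
Variables (Q : realFieldType) (e M s : Q).
Hypotheses (e0 : 0 < e) (eM : e < M).
Local Notation R := {poly F}.
Local Notation D := (fox (etaz x2 : 'I_3 -> R)).
Local Notation w5 := (sel5 e e 0 M s : 'I_5 -> Q).
Local Notation wS := (sel3 e M 0 : 'I_3 -> Q).
Local Notation eps := (eps p q).
Local Notation iotaR := (sub3 y2 (bc eps) (lett y3)).
Variables (hE hW : FA F 5).
Hypotheses (HhE : Hom w5 e hE) (HhW : Hom w5 M hW).
Local Notation t0 := (sel5 (lett y0) (lett y1) (lett y2) (lett y3) 0 : 'I_5 -> FA F 5).
Hypotheses (hE0 : gev idfun t0 hE = eps) (hW0 : gev idfun t0 hW = lett y3).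
Hypothesis nfree : ~ (lfree y4 hE /\ lfree y4 hW).
Local Notation PsiR := (sub3 y2 (bc hE) (bc hW)).
Local Notation rE := (rh y2 (bc hE)).
Local Notation rW := (rh y2 (bc hW)).

Let M0 : 0 < M. Proof. exact: lt_trans e0 eM. Qed.

Lemma aug_hE : aug (etaz y2) (bc hE) = 0.
Proof. by apply: aug_bc_Hom HhE _ => //; rewrite gt_eqF. Qed.

Lemma aug_hW : aug (etaz y2) (bc hW) = 0.
Proof. by apply: aug_bc_Hom HhW _ => //; rewrite gt_eqF. Qed.

Lemma Hom_rE : Hom w5 e rE.
Proof. by apply: Hom_rh => //; apply: supp_bc. Qed.

Lemma Hom_rW : Hom w5 M rW.
Proof. by apply: Hom_rh => //; apply: supp_bc. Qed.

Lemma lfree_lam (x : FA R 5) : lfree y4 x -> lfree y4 (lam y2 x).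
Proof. by apply: supp_lam => w; rewrite mem_cat inE orbF. Qed.

(** [lm] is the largest difference between the weight in front of the first [y4] of a word of [rE]
    or [rW] and the weight [e] or [M] of that element; [r] is what follows this [y4] in a word
    reaching the maximum. The boolean tags record which element a word comes from. *)
Lemma ends_exists : exists lm r, [/\ Bd y4 w5 lm e rE, Bd y4 w5 lm M rW &
  comp w5 (e + lm) (cut y4 r rE) != 0 \/ comp w5 (M + lm) (cut y4 r rW) != 0].
Proof.
pose l1 := [seq (true, w) | w <- fa_supp rE & y4 \in w].
pose l2 := [seq (false, w) | w <- fa_supp rW & y4 \in w].
have m1 w : ((true, w) \in l1 ++ l2) = (cf w rE != 0) && (y4 \in w).
  rewrite mem_cat; have -> : ((true, w) \in l2) = false by apply/negP => /mapP[].
  by rewrite orbF mem_map ?mem_filter ?mem_supp 1?andbC // => ? ? [].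
have m2 w : ((false, w) \in l1 ++ l2) = (cf w rW != 0) && (y4 \in w).
  rewrite mem_cat; have -> : ((false, w) \in l1) = false by apply/negP => /mapP[].
  by rewrite mem_map ?mem_filter ?mem_supp 1?andbC // => ? ? [].
have [bw bwl] : exists bw, bw \in l1 ++ l2.
  apply: NNPP => H; apply: nfree; split.
    rewrite -(lam_bc y2 hE) -(lam_rh aug_hE); apply: lfree_lam => w nw.
    by apply/negP => tw; apply: H; exists (true, w); rewrite m1 nw.
  rewrite -(lam_bc y2 hW) -(lam_rh aug_hW); apply: lfree_lam => w nw.
  by apply/negP => tw; apply: H; exists (false, w); rewrite m2 nw.
pose f (bw : bool * seq 'I_5) : Q := pfx y4 w5 bw.2 - if bw.1 then e else M.
have [[b w] wl wmax] := seq_max f bwl; exists (f (b, w)), (drop (index y4 w).+1 w).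
have cut_nz x (c : Q) : cf w x != 0 -> y4 \in w -> pfx y4 w5 w = c ->
    comp w5 c (cut y4 (drop (index y4 w).+1 w) x) != 0.
  move=> nx yw wc; apply: contraNneq nx => /(congr1 (cf (take (index y4 w) w))).
  rewrite cf0 cf_proj -[wtw _ _]/(pfx y4 w5 w) wc eqxx cf_cut ?notin_take_index //.
  rewrite -{2}(nth_index y4 yw) -drop_nth ?index_mem // cat_take_drop => ->.
  by [].
split.
- move=> v nv; case: ifP => yv; last by rewrite (Hom_rE nv).
  have /wmax : (true, v) \in l1 ++ l2 by rewrite m1 nv.
  by rewrite {1}/f /=; lra.
- move=> v nv; case: ifP => yv; last by rewrite (Hom_rW nv).
  have /wmax : (false, v) \in l1 ++ l2 by rewrite m2 nv.
  by rewrite {1}/f /=; lra.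
case: b wl {wmax} => wl; [left; move: wl; rewrite m1 | right; move: wl; rewrite m2];
  by case/andP=> nw yw; apply: cut_nz => //; rewrite /f /= addrC subrK.
Qed.

Lemma PsiR0 Y : gev idfun (fun l => bc (t0 l)) (PsiR Y) = iotaR Y.
Proof. by rewrite (gev_sub3 (z' := y2)) -?bc_gev ?hE0 ?hW0 ?bcX. Qed.

Lemma PsiR_proj Y : proj (fun w => y4 \notin w) (PsiR Y) = iotaR Y.
Proof.
rewrite -t0_proj -PsiR0; apply: eq_gev.
by apply: ord5P => /=; rewrite ?bcX ?bc0.
Qed.

Lemma lfree_iotaR Y : lfree y4 (iotaR Y).
Proof. by rewrite -PsiR_proj; apply: supp_proj. Qed.

Lemma PsiR_free Y : lfree y4 (PsiR Y) -> PsiR Y = iotaR Y.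
Proof. by move=> L; rewrite -PsiR_proj proj_id. Qed.

Lemma Hom_iotaR m Y : Hom wS m Y -> Hom w5 m (iotaR Y).
Proof.
apply: Hom_gev; apply: ord3P => /=; [|exact: HomX|exact: HomX].
apply: supp_bc; apply: HomB; apply: act_Hom => //; exact: HomX.
Qed.

Lemma Bd_PsiR lm m Y : Bd y4 w5 lm e rE -> Bd y4 w5 lm M rW -> Hom wS m Y ->
  Bd y4 w5 lm m (PsiR Y).
Proof.
move=> BE BW HY.
have B1 : Bd y4 w5 lm e (bc hE).
  apply: supp_bc; rewrite -(lam_bc y2 hE) -(lam_rh aug_hE).
  exact: Bd_lam.
have B2 : Bd y4 w5 lm M (bc hW).
  apply: supp_bc; rewrite -(lam_bc y2 hW) -(lam_rh aug_hW).
  exact: Bd_lam.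
apply: (@gev_graded R R idfun 3 5 _ Q wS predT (fun a u => Bd y4 w5 lm a u) _ _ _ _ _ m Y HY).
- by move=> a; apply: supp0.
- by move=> a u v; apply: suppD.
- by move=> a c u; apply: suppZ.
- by apply: supp1; rewrite /= /wtw big_nil.
- move=> a u l _ Bu; apply: BdM => //.
    by move: l; apply: ord3P => //=; apply: ltW.
  move: l; apply: ord3P => //=.
  by apply: supp_mon; rewrite /= /wtw big_seq1.
by move=> w _; apply: all_predT.
Qed.

(** If the first [y4] of a word lies in the factor [PsiR G], the weight before it is below [m + lm],
    because the other factor has positive weight. At weight [m + lm] only the part of [PsiR G]
    without [y4], which is [iotaR G], contributes, and the right side has no [y4] at all. *)
Lemma ends_rel lm r m G0 G1 : Bd y4 w5 lm e rE -> Bd y4 w5 lm M rW ->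
    Hom wS (m - e) G0 -> Hom wS (m - M) G1 ->
    PsiR G0 * rE + PsiR G1 * rW = iotaR G0 * rh y2 (bc eps) + iotaR G1 * lett y3 ->
  iotaR G0 * comp w5 (e + lm) (cut y4 r rE) + iotaR G1 * comp w5 (M + lm) (cut y4 r rW) = 0.
Proof.
move=> BE BW H0 H1 E.
have split G d x : Hom wS (m - d) G -> 0 < d ->
    comp w5 (m + lm) (cut y4 r (PsiR G * x)) = iotaR G * comp w5 (d + lm) (cut y4 r x).
  move=> HG d0; have BG := Bd_PsiR BE BW HG.
  rewrite -[PsiR G](subrK (iotaR G)) mulrDl cutD compD.
  rewrite (cutM _ _ (@lfree_iotaR G)).
  have -> : m + lm = (m - d) + (d + lm) by rewrite addrA subrK.
  rewrite (comp_mull _ _ (Hom_iotaR HG)) -[RHS]add0r; congr (_ + _).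
  apply: (@comp_lt _ _ _ _ _ (m - d + lm)); last by move: d0; lra.
  apply: Bd_cut; rewrite -PsiR_proj.
    by move=> w /(supp_projC BG)[_]; rewrite negbK.
  by move=> w /(supp_projC BG)[].
have := congr1 (fun x => comp w5 (m + lm) (cut y4 r x)) E; rewrite /= cutD compD.
rewrite (split _ _ _ H0 e0) (split _ _ _ H1 M0) => ->; rewrite cut_lfree ?comp0 //.
apply: suppD; apply: lfreeM; try exact: lfree_iotaR; last exact: lfree_lett.
rewrite rh_eps; apply: suppB; apply: lfreeM; try exact: lfree_lett; exact: lfree_zp.
Qed.

Lemma rh_eps_neq0 : rh y2 (bc eps) != 0.
Proof.
apply/eqP => E; have E0 := congr1 (fox (etaz y2) y0) E.
have E1 := congr1 (fox (etaz y2) y1) E; move: E0 E1.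
have az l : l != y2 -> aug (etaz y2) (lett l) = 0 :> R by move=> l2; rewrite augX /etaz (negPf l2).
rewrite rh_eps !foxB !foxM !foxX !az // !scale0r !addr0 !fox0 /= !mulr0 !subr0 !sub0r.
rewrite !mulr1 => /eqP E0 /eqP; rewrite oppr_eq0 => E1; move: E0 E1.
by case/orP: pq0 => n0; rewrite (negPf (zp_neq0 y2 n0)).
Qed.

(** [rh eps] has derivative 0 along [y3], so differentiating along [y3] separates the two terms of
    the linear relation given by [peel_vanish]. *)
Lemma iotaR_inj Y : iotaR Y = 0 -> Y = 0.
Proof.
move=> Y0; apply/eqP; apply: contraT => nY.
have a3 : aug (etaz y2) (lett y3) = 0 :> R by rewrite augX.
have [//|Y' [_ nn E]] := peel_vanish (P := fun=> True) _ (aug_eps p q) a3 nY I Y0.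
have r3 : rh y2 (lett y3) = lett y3 :> FA R 5 by rewrite rhX.
have D3 : iotaR (D x1 Y') = 0.
  have f3 : fox (etaz y2) y3 (rh y2 (bc eps)) = 0 :> FA R 5.
    by rewrite fox_rh // bcB foxB !fox_act // !bcX !foxX /= !mulr0 subr0.
  have := congr1 (fox (etaz y2) y3) E; rewrite r3 foxD !foxM aug_rh f3 a3 foxX fox0 /=.
  by rewrite mulr0 !scale0r !addr0 add0r mulr1.
move: nn E; rewrite D3 mul0r addr0 eqxx => -[n0|//] /fa_mulf_eq0[] /eqP.
  by rewrite (negPf n0).
by rewrite (negPf rh_eps_neq0).
Qed.

End Ends.

Lemma rh_bc_neq0 (F : comNzRingType) n (z : 'I_n) (u : FA F n) :
  aug (etaz z) (bc u) = 0 -> u != 0 -> rh z (bc u) != 0.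
Proof.
by move=> a0; apply: contraNneq => r0; rewrite -(lam_bc z u) -lam_rh // r0 lam0.
Qed.

Section PeelMain.
Variables (F : fieldType) (p q : {poly {poly F}}).
Hypotheses (cpq : Cop p q) (pq0 : (p != 0) || (q != 0)).
Variables (Q : realFieldType) (e M s : Q).
Hypotheses (e0 : 0 < e) (eM : e < M).
Local Notation R := {poly F}.
Local Notation D := (fox (etaz x2 : 'I_3 -> R)).
Local Notation w5 := (sel5 e e 0 M s : 'I_5 -> Q).
Local Notation wS := (sel3 e M 0 : 'I_3 -> Q).
Local Notation eps := (eps p q).
Local Notation iotaR := (sub3 y2 (bc eps) (lett y3)).
Variables (hE hW : FA F 5).
Hypotheses (HhE : Hom w5 e hE) (HhW : Hom w5 M hW).
Local Notation t0 := (sel5 (lett y0) (lett y1) (lett y2) (lett y3) 0 : 'I_5 -> FA F 5).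
Hypotheses (hE0 : gev idfun t0 hE = eps) (hW0 : gev idfun t0 hW = lett y3).
Hypothesis nfree : ~ (lfree y4 hE /\ lfree y4 hW).
Local Notation PsiR := (sub3 y2 (bc hE) (bc hW)).
Local Notation rE := (rh y2 (bc hE)).
Local Notation rW := (rh y2 (bc hW)).
Variables (Eb h : FA F 3).
Hypotheses (aEb : aug (etaz x2) (bc Eb) = 0) (ah : aug (etaz x2) (bc h) = 0).
Hypotheses (nEb : Eb != 0) (nh : h != 0).
Local Notation evR := (sub3 x2 (bc Eb) (bc h)).

Let M0 : 0 < M. Proof. exact: lt_trans e0 eM. Qed.
Let dM0 : 0 < M - e. Proof. by rewrite subr_gt0. Qed.

Lemma lfree_inL (u : FA R 5) : lfree y4 u -> inL (fun l => l != y4) u.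
Proof.
apply: suppW => w yw; apply/allP => l lw; by apply: contraNneq yw => <-.
Qed.

Lemma a_y3 : aug (etaz y2) (lett y3) = 0 :> R.
Proof. by rewrite augX. Qed.

Lemma etaz_wS l : etaz x2 l != 0 :> R -> wS l = 0.
Proof. by rewrite /etaz; case: (l =P x2) => [->|]; rewrite ?eqxx. Qed.

(* [D0], [D1] are the right coefficients of [E], [W] in a vanishing element. *)
Lemma peel_pair m (D0 D1 : FA R 3) : D0 != 0 -> D1 != 0 ->
    Hom wS (m - e) D0 -> Hom wS (m - M) D1 ->
    PsiR D0 * rE + PsiR D1 * rW = iotaR D0 * rh y2 (bc eps) + iotaR D1 * lett y3 ->
  exists c0 K, [/\ c0 != 0, c0 *: D0 = D1 * K, Hom w5 (M - e) (iotaR K) &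
    PsiR D1 = iotaR D1].
Proof.
move=> n0 n1 H0 H1 E.
have injR Y : iotaR Y = 0 -> Y = 0 by apply: (@iotaR_inj F p q pq0).
have i0 : iotaR D0 != 0 by apply: contraNneq n0 => /injR->.
have i1 : iotaR D1 != 0 by apply: contraNneq n1 => /injR->.
have HI mm Y : Hom wS mm Y -> Hom w5 mm (iotaR Y) by apply: Hom_iotaR.
have [lm [r [BE BW nPQ]]] := ends_exists e0 eM HhE HhW nfree.
have := ends_rel e0 eM HhE HhW hE0 hW0 r BE BW H0 H1 E.
set P' := comp _ _ _ in nPQ *; set Q' := comp _ (M + lm) _ in nPQ * => EPQ.
have nP' : P' != 0.
  apply/eqP => P0; move: nPQ EPQ; rewrite P0 mulr0 add0r eqxx => -[//|nQ] /fa_mulf_eq0[] /eqP.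
    by rewrite (negPf i1).
  by rewrite (negPf nQ).
have wpos l : l != y4 -> l != y2 -> 0 < w5 l by move: l; apply: ord5P.
have LP : inL (fun l => l != y4) P'.
  by apply: lfree_inL; apply: supp_projW; apply: lfree_cut.
have LQ : inL (fun l => l != y4) Q'.
  by apply: lfree_inL; apply: supp_projW; apply: lfree_cut.
have HP : Hom w5 (e + lm) P' by apply: Hom_comp.
have HQ : Hom w5 (e + lm + (M - e)) Q'.
  have HQ' : Hom w5 (M + lm) Q' by apply: Hom_comp.
  by apply: (Hom_eq HQ'); lra.
have w52 : w5 y2 = 0 by [].
(* The weights of [P'] and [Q'] differ by [M - e > 0]. Stripping turns [P'] into a polynomial in
   [z], which [strip_zp] removes: up to a scalar, [iotaR D0] is a right multiple of [iotaR D1]. *)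
have [c [b' [nc Lb Hb Ecb]]] := strip_rel w52 wpos (ltW dM0) LP LQ HP HQ nP' EPQ.
have dMn : M - e != 0 by rewrite gt_eqF.
have [c0 [k0 [nc0 Ek0]]] := strip_zp w52 nc Hb dMn Ecb.
pose k := comp w5 (M - e) k0.
have Ek : c0 *: iotaR D0 = iotaR D1 * k.
  have HD0 : Hom w5 (m - e) (c0 *: iotaR D0) by apply: HomZ; apply: HI.
  rewrite -(comp_id HD0) Ek0 /k -(comp_mull _ _ (HI _ _ H1)); congr (comp _ _ _).
  by lra.
have nk : k != 0.
  by apply/eqP => kE; move: Ek; rewrite kE mulr0 => /(faZ_eq0 nc0)/eqP; rewrite (negPf i0).
have Lfree Y : lfree y4 (iotaR Y) by apply: (lfree_iotaR hE0 hW0).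
have Lk : lfree y4 k.
  by case: (@lfree_mulf _ _ y4 (iotaR D1) k) => //; rewrite -Ek; apply: suppZ; apply: Lfree.
have Vi Y : gev idfun (fun l => bc (vU p q l)) (iotaR Y) = iotaR Y.
  rewrite (gev_sub3 (z' := y2)) /= ?bcX // -bc_gev (vinv_eps p q) gevX /=.
  by rewrite bcX.
have Vk : gev idfun (fun l => bc (vU p q l)) k = k.
  by apply: (fa_mulfI i1); rewrite -Ek -{1}(Vi D1) -gevM -Ek gevZ Vi.
have [K kE] : exists K, k = iotaR K.
  apply: (iota_lift (p := p) (q := q)) => i; have [N LN] := Len_exists k.
  apply: (vinv_iotaE cpq pq0 (k := N.+1)); first exact: supp_cof.
    exact: cof_vinv.
  by apply: supp_cof; apply: Len_w5d.
have EK : c0 *: D0 = D1 * K.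
  apply/eqP; rewrite -subr_eq0; apply/eqP/injR.
  by rewrite sub3B sub3M [sub3 _ _ _ (c0 *: _)]gevZ -kE -Ek subrr.
exists c0, K; split=> //; first by rewrite -kE; apply: Hom_comp.
apply: (PsiR_free hE0 hW0).
have EP : c0 *: PsiR D0 = PsiR D1 * PsiR K.
  by rewrite -sub3M -EK [RHS]gevZ.
(* Now [PsiR D1] is a left factor of a nonzero element without [y4], so it is itself free of
   [y4]. *)
have : PsiR D1 * (PsiR K * rE + c0 *: rW) = iotaR D1 * (iotaR K * rh y2 (bc eps) + c0 *: lett y3).
  rewrite !mulrDr !mulrA -EP -!fa_scaler -!scalerAl -kE -Ek -scalerAl.
  by rewrite -!scalerDr E.
set X := _ + c0 *: rW; set Y := _ + c0 *: lett y3 => EXY.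
have nY : Y != 0.
  apply: contraNneq nc0 => /(congr1 (fun u => aug (fun=> 1) (fox (etaz y2) y3 u))).
  rewrite fox0 aug0 /Y foxD foxZ foxX /= foxM aug_rh scale0r addr0.
  rewrite fox_rh // bcB foxB !fox_act // !bcX !foxX /= !mulr0 subr0 mulr0 add0r.
  by rewrite augZ aug1 mulr1 => ->.
have nXY : iotaR D1 * Y != 0 by apply: fa_mulf_neq0.
have LXY : lfree y4 (PsiR D1 * X).
  rewrite EXY; apply: lfreeM; first exact: Lfree.
  apply: suppD; last by apply: suppZ; apply: lfree_lett.
  apply: lfreeM; first exact: Lfree.
  rewrite rh_eps; apply: suppB; apply: lfreeM; try exact: lfree_lett; exact: lfree_zp.
rewrite -EXY in nXY.
case: (lfree_mulf LXY) => //; apply: contraNneq nXY => ->; by rewrite ?mul0r ?mulr0.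
Qed.

(** If at most one of the derivatives along [x0] and [x1] is nonzero, a derivative of [Y] is a
    shorter element with the same properties. If both are nonzero, [peel_pair] applies: either the
    derivative along [x1] still vanishes at [(Eb, h)] and the induction goes on with it, or it can
    be cancelled, which leaves the relation between [h] and [Eb]. *)
Lemma peel_main k Y m : Len k Y -> Y != 0 -> Hom wS m Y -> PsiR Y = iotaR Y -> evR Y = 0 ->
  exists c0 K, [/\ c0 != 0, Hom w5 (M - e) (iotaR K) &
    c0 *: rh x2 (bc h) + evR K * rh x2 (bc Eb) = 0].
Proof.
elim: k Y m => [|k IH] Y m LY nY HY EY Y0.
  case/eqP: nY; move: Y0; rewrite (Len0E (etaz x2) LY) sub3C => /(congr1 (aug (etaz x2))).
  by rewrite augC aug0 => ->; rewrite scale0r.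
have [aY rY] := peel3 Y aEb ah; rewrite Y0 rh0 aug0 in aY rY.
have aE := aug_hE e0 HhE; have aW := aug_hW e0 eM HhW.
have [_ rP] := peel3 Y aE aW.
have [_ rI] := peel3 Y (aug_eps p q) a_y3.
have r3 : rh y2 (lett y3) = lett y3 :> FA R 5 by rewrite rhX.
have E : PsiR (D x0 Y) * rE + PsiR (D x1 Y) * rW =
    iotaR (D x0 Y) * rh y2 (bc eps) + iotaR (D x1 Y) * lett y3.
  by rewrite -rP EY rI r3.
have LD l : Len k (D l Y) by apply: Len_fox.
have HD l : Hom wS (m - wS l) (D l Y) by apply: Hom_fox HY => //; apply: etaz_wS.
have rEb := rh_bc_neq0 aEb nEb; have rhh := rh_bc_neq0 ah nh.
have injR Z : iotaR Z = 0 -> Z = 0 by apply: (@iotaR_inj F p q pq0).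
have Lfree Z : lfree y4 (iotaR Z) by apply: (lfree_iotaR hE0 hW0).
have Lre : lfree y4 (rh y2 (bc eps)).
  rewrite rh_eps; apply: suppB; apply: lfreeM; try exact: lfree_lett; exact: lfree_zp.
case: (eqVneq (D x0 Y) 0) => [d0|n0]; case: (eqVneq (D x1 Y) 0) => [d1|n1].
- have YE := peel3_z (esym aY) d0 d1.
  have n2 : D x2 Y != 0 by apply: contraNneq nY => E0; rewrite YE E0 mul0r.
  have H2 : Hom wS m (D x2 Y) by apply: (Hom_eq (HD x2)); rewrite subr0.
  apply: (IH _ m (LD x2) n2 H2).
    apply: (fa_mulIf (zX_neq0 F y2)).
    have := EY; rewrite {1 2}YE !sub3M !sub3B !sub3C !sub3z.
    by [].
  move: Y0; rewrite {1}YE sub3M sub3B sub3C sub3z.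
  by case/fa_mulf_eq0 => // /eqP; rewrite (negPf (zX_neq0 F x2)).
- move: E rY; rewrite d0 !sub3_0 !mul0r !add0r => E /esym/fa_mulf_eq0[e1|/eqP]; last first.
    by rewrite (negPf rhh).
  apply: (IH _ _ (LD x1) n1 (HD x1)) => //.
  apply: (PsiR_free hE0 hW0).
  have nn : PsiR (D x1 Y) * rW != 0.
    rewrite E; apply: fa_mulf_neq0; first by apply: contraNneq n1 => /injR->.
    by apply/eqP => /(congr1 (aug (fun=> 1))); rewrite augX aug0 => /eqP; rewrite oner_eq0.
  case: (@lfree_mulf _ _ y4 (PsiR (D x1 Y)) rW) => //.
  + by rewrite E; apply: lfreeM => //; apply: lfree_lett.
  + by apply: contraNneq nn => ->; rewrite mul0r.
  by apply: contraNneq nn => ->; rewrite mulr0.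
- move: E rY; rewrite d1 !sub3_0 !mul0r !addr0 => E /esym/fa_mulf_eq0[e1|/eqP]; last first.
    by rewrite (negPf rEb).
  apply: (IH _ _ (LD x0) n0 (HD x0)) => //.
  apply: (PsiR_free hE0 hW0).
  have nn : PsiR (D x0 Y) * rE != 0.
    rewrite E; apply: fa_mulf_neq0; first by apply: contraNneq n0 => /injR->.
    exact: rh_eps_neq0.
  case: (@lfree_mulf _ _ y4 (PsiR (D x0 Y)) rE) => //.
  + by rewrite E; apply: lfreeM.
  + by apply: contraNneq nn => ->; rewrite mul0r.
  by apply: contraNneq nn => ->; rewrite mulr0.
have [c0 [K [nc0 EK HK P1]]] := peel_pair n0 n1 (HD x0) (HD x1) E.
case: (eqVneq (evR (D x1 Y)) 0) => [e1|ne1]; first exact: (IH _ _ (LD x1) n1 (HD x1)).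
exists c0, K; split=> //.
have Eev : c0 *: evR (D x0 Y) = evR (D x1 Y) * evR K by rewrite -sub3M -EK [RHS]gevZ.
have := congr1 (fun u => c0 *: u) rY; rewrite /= scaler0 scalerDr scalerAl Eev.
rewrite -mulrA fa_scaler -mulrDr addrC => /esym/fa_mulf_eq0[/eqP|//].
by rewrite (negPf ne1).
Qed.
End PeelMain.

(** * The leading form as a value of an invariant *)

Lemma proj_comm (R : comNzRingType) n (X Y : pred (seq 'I_n)) (u : FA R n) :
  proj X (proj Y u) = proj Y (proj X u).
Proof. by apply: fa_eq => s; rewrite !cf_proj; case: (X s); case: (Y s). Qed.

Lemma comp_gev_Hom (R : comNzRingType) n n' (Q : realFieldType) (wt : 'I_n -> Q)
    (wt' : 'I_n' -> Q) (U : 'I_n -> FA R n') m u :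
  (forall l, Hom wt' (wt l) (U l)) ->
  comp wt' m (gev idfun U u) = gev idfun U (comp wt m u).
Proof.
move=> HU; move: u; apply: fa_ind => [|u v Hu Hv|c s].
- by rewrite gev0 !comp0 gev0.
- by rewrite gevD !compD gevD Hu Hv.
have Hs : Hom wt' (wtw wt s) (gev idfun U (c *: mon R s)).
  by apply: Hom_gev HU _; apply: suppU.
rewrite compU; case: (eqVneq (wtw wt s) m) => [E|/eqP ne].
  by rewrite comp_id // -E.
by rewrite gev0 (comp_ne Hs ne).
Qed.

Lemma lfree_sub (R : idomainType) n n' (t : 'I_n') (U : 'I_n -> FA R n') u :
  (forall l, lfree t (U l)) -> lfree t (gev idfun U u).
Proof.
move=> HU; move: u; apply: fa_rind => [u v|c u||u l].
- by rewrite gevD; apply: suppD.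
- by rewrite gevZ; apply: suppZ.
- by rewrite gev1; apply: supp1.
by rewrite gevM gevX => Hu; apply: lfreeM.
Qed.

Section W5.
Variables (R : comNzRingType) (Q : realFieldType) (e M : Q).
Local Notation w5 := (fun s => sel5 e e 0 M s : 'I_5 -> Q).
Implicit Types u : FA R 5.

Lemma wtw_w5 s (w : seq 'I_5) : wtw (w5 s) w = wtw (w5 0) w + (count_mem y4 w)%:R * s.
Proof.
rewrite /wtw; elim: w => [|l w IH]; first by rewrite !big_nil mul0r addr0.
rewrite !big_cons IH /= natrD mulrDl addrACA; congr (_ + _).
by move: l; apply: ord5P => /=; rewrite ?mul0r ?addr0 ?mul1r ?add0r.
Qed.

Lemma wtw_w5_lfree s s' (w : seq 'I_5) : y4 \notin w -> wtw (w5 s) w = wtw (w5 s') w.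
Proof.
by move=> yw; rewrite wtw_w5 [RHS]wtw_w5 (count_memPn yw) !mul0r.
Qed.

Lemma comp_w5_lfree s s' m u : lfree y4 u -> comp (w5 s) m u = comp (w5 s') m u.
Proof.
move=> Lu; apply: fa_eq => w; rewrite !cf_proj.
case: (eqVneq (cf w u) 0) => [->|/Lu yw]; first by rewrite !if_same.
by rewrite (wtw_w5_lfree s s').
Qed.

Lemma Hom_w5_lfree s s' m u : lfree y4 u -> Hom (w5 s) m u -> Hom (w5 s') m u.
Proof. by move=> Lu Hu w nw; rewrite (wtw_w5_lfree s' s (Lu _ nw)); apply: Hu. Qed.

Lemma Fil_w5_lfree s s' m u : lfree y4 u -> Fil (w5 s) m u -> Fil (w5 s') m u.
Proof. by move=> Lu Hu w nw; rewrite (wtw_w5_lfree s' s (Lu _ nw)); apply: Hu. Qed.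

Lemma wtw_w5_W s (w : seq 'I_5) : 0 <= e -> 0 <= M -> y4 \notin w -> y3 \in w ->
  M <= wtw (w5 s) w.
Proof.
move=> e0 M0 yw y3w; rewrite /wtw (big_rem y3) //= lerDl.
rewrite big_seq; apply: sumr_ge0 => l lw.
have : l != y4 by apply: contraNneq yw => <-; apply: (mem_subseq (rem_subseq _ _)) lw.
by move: l {lw}; apply: ord5P.
Qed.
End W5.

(** * A right multiple of the leading form as a value of an invariant *)

Section Core.
Variables (F : fieldType) (p q : {poly {poly F}}).
Hypotheses (cpq : Cop p q) (pq0 : (p != 0) || (q != 0)).
Variables (Q : realFieldType) (e M : Q).
Hypotheses (e0 : 0 < e) (eM : e < M) (M1 : 1 < M).
Local Notation w5 := (fun s => sel5 e e 0 M s : 'I_5 -> Q).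
Local Notation wS := (sel3 e M 0 : 'I_3 -> Q).
Local Notation w3 := (w3 Q).
Local Notation eps := (eps p q).
Local Notation iota := (iota p q).
Variables (a0 b0 W0 Pi : FA F 3) (i : 'I_3).
Hypotheses (Fa : Fil w3 e a0) (Fb : Fil w3 e b0) (FW0 : Fil w3 M W0).
Local Notation al := (comp w3 e a0).
Local Notation be := (comp w3 e b0).
Local Notation h := (comp w3 M W0).
Local Notation Eb := (act x2 q al - act x2 p be).
Hypotheses (nEb : Eb != 0) (nh : h != 0) (ni : i != x2).
Hypothesis Pi_fg : sub3 x2 (a0 + act x2 p W0) (b0 + act x2 q W0) Pi = lett i.
Local Notation mu := (sub3 y2 (lett y0 + act y2 p (lett y3)) (lett y1 + act y2 q (lett y3))).
Hypothesis mu_W : ~ lfree y3 (mu Pi).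
Variables (X Y : FA F 5).
Hypothesis XY_Pi : sub3 y2 X Y Pi = mu Pi.
Hypothesis XY_t : ~ (lfree y4 X /\ lfree y4 Y).
Local Notation t0 := (sel5 (lett y0) (lett y1) (lett y2) (lett y3) 0 : 'I_5 -> FA F 5).
Hypotheses (X0 : gev idfun t0 X = lett y0 + act y2 p (lett y3))
  (Y0 : gev idfun t0 Y = lett y1 + act y2 q (lett y3)).
Local Notation evab := (gev idfun (sel5 al be (lett x2) h 0)).

Let M0 : 0 < M. Proof. exact: lt_trans e0 eM. Qed.

Lemma lfree_mu t : t = y4 -> lfree t (mu Pi).
Proof.
move=> ->; apply: lfree_sub; apply: ord3P => /=; try exact: lfree_lett.
  by apply: suppD; [apply: lfree_lett | apply: act_lfree => //; apply: lfree_lett].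
by apply: suppD; [apply: lfree_lett | apply: act_lfree => //; apply: lfree_lett].
Qed.

Lemma lfree_eps t : t = y4 \/ t = y3 -> lfree t eps.
Proof.
by case=> ->; apply: suppB; apply: act_lfree => //; apply: lfree_lett.
Qed.

Lemma Hom_eps s : Hom (w5 s) e eps.
Proof. by apply: HomB; apply: act_Hom => //; exact: HomX. Qed.

Lemma mu_top : exists N, [/\ M <= N, Fil (w5 e) N (mu Pi) & comp (w5 e) N (mu Pi) != 0].
Proof.
have nmu : mu Pi != 0 by apply/eqP => mu0; apply: mu_W; rewrite mu0; apply: supp0.
have [N FN nN] := top_exists (w5 e) nmu; exists N; split=> //.
have [w nw w3] : exists2 w, cf w (mu Pi) != 0 & y3 \in w.
  apply: NNPP => H; apply: mu_W => w nw; apply/negP => w3; apply: H; by exists w.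
apply: le_trans (FN _ nw).
exact: wtw_w5_W (ltW e0) (ltW M0) (lfree_mu erefl nw) w3.
Qed.

(** [mu Pi] depends only on [a + p.W] and [b + q.W], which are unchanged when [a], [b] are
    translated by [y4] and [W] is replaced by [W - y4]. As [y4] has weight [e < M], the leading form
    of [W - y4] is [W]. *)
Lemma mu_top_vinv N : Fil (w5 e) N (mu Pi) -> vinv p q (comp (w5 e) N (mu Pi)).
Proof.
move=> FN; pose v' : 'I_5 -> FA F 5 :=
  sel5 (lett y0 + act y2 p (lett y4)) (lett y1 + act y2 q (lett y4)) (lett y2)
    (lett y3 - lett y4) (lett y4).
have v'mu : gev idfun v' (mu Pi) = mu Pi.
  rewrite (gev_sub3 (z' := y2)) // !gevD !(act_gev (z' := y2)) // !gevX /= !actB.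
  by rewrite -!addrA !(addrC (act _ _ (lett y4))) !subrK.
have Ha l r : Hom (w5 e) e (lett l : FA F 5) -> Hom (w5 e) e (lett l + act y2 r (lett y4) : FA F 5).
  by move=> Hl; apply: HomD => //; apply: act_Hom => //; apply: (HomX _ (l := y4)).
have Hy0 : Hom (w5 e) e (lett y0 : FA F 5) by apply: (HomX _ (l := y0)).
have Hy1 : Hom (w5 e) e (lett y1 : FA F 5) by apply: (HomX _ (l := y1)).
have Hy2 : Hom (w5 e) 0 (lett y2 : FA F 5) by apply: (HomX _ (l := y2)).
have Hy3 : Hom (w5 e) M (lett y3 : FA F 5) by apply: (HomX _ (l := y3)).
have Hy4 : Hom (w5 e) e (lett y4 : FA F 5) by apply: (HomX _ (l := y4)).
have U l : Fil (w5 e) (w5 e l) (v' l).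
  move: l; apply: ord5P => /=; try exact: HomFil.
  - by apply/HomFil/Ha.
  - by apply/HomFil/Ha.
  by apply: FilB; [exact: HomFil | apply: FilW (ltW eM) (HomFil Hy4)].
have := comp_gev idfun U FN; rewrite v'mu => E; rewrite /vinv [RHS]E.
apply: eq_gev; apply: ord5P; rewrite /v' /=.
- by rewrite comp_id //; apply: Ha.
- by rewrite comp_id //; apply: Ha.
- by rewrite comp_id.
- by rewrite compB (comp_id Hy3) (comp_ne Hy4) ?subr0 //; apply/eqP; rewrite lt_eqF.
by rewrite comp_id.
Qed.

Lemma top_iota N : Fil (w5 e) N (mu Pi) ->
  exists2 Z0, Hom wS N Z0 & comp (w5 e) N (mu Pi) = iota Z0.
Proof.
move=> FN; have Lz : lfree y4 (comp (w5 e) N (mu Pi)) by apply: supp_projW; apply: lfree_mu.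
have [k Lk] := Len_exists (comp (w5 e) N (mu Pi)).
have [Z ZE] := vinv_iotaE cpq pq0 Lz (mu_top_vinv FN) (Len_w5d Lk).
exists (comp wS N Z); first exact: Hom_comp.
have HN : Hom (w5 e) N (comp (w5 e) N (mu Pi)) by apply: Hom_comp.
rewrite -(comp_id HN) ZE; apply: comp_gev_Hom; apply: ord3P => /=.
- exact: Hom_eps.
- exact: (HomX _ (l := y3)).
exact: (HomX _ (l := y2)).
Qed.

(** At [(a0, b0, W0)] the element [mu Pi] takes the value [lett i], of weight 1. Since [1 < M <= N],
    the part of weight [N] of this value is zero. *)
Lemma top_ev N : M <= N -> Fil (w5 e) N (mu Pi) -> evab (comp (w5 e) N (mu Pi)) = 0.
Proof.
move=> MN FN.
pose r : 'I_5 -> FA F 3 := sel5 a0 b0 (lett x2) W0 0.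
have rmu : gev idfun r (mu Pi) = lett i.
  rewrite (gev_sub3 (z' := x2)) // !gevD !(act_gev (z' := x2)) // !gevX /=.
  exact: Pi_fg.
have U l : Fil w3 (w5 e l) (r l).
  move: l; apply: ord5P => //=; first exact: HomFil (HomX _ (l := x2)).
  exact: Fil0.
have := comp_gev idfun U FN; rewrite rmu.
have Hi : Hom w3 1 (lett i : FA F 3).
  by move: i ni; apply: ord3P => // _; [apply: (HomX _ (l := x0)) | apply: (HomX _ (l := x1))].
rewrite (comp_ne Hi) => [E|]; last by move=> N1; move: MN M1; rewrite -N1; lra.
rewrite [RHS]E; apply: eq_gev; apply: ord5P => //; rewrite /r /=; first by rewrite [RHS]comp_id //; apply: (HomX _ (l := x2)).
by rewrite comp0.
Qed.

Local Notation E2 := (act y2 q X - act y2 p Y).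

Lemma t0_E2 : gev idfun t0 E2 = eps.
Proof.
rewrite gevB !(act_gev (z' := y2)) // X0 Y0 !actD -!actM [q * p]mulrC opprD addrACA.
by rewrite subrr addr0.
Qed.

(* The weight of [t] is the largest one for which [X], [Y] and [E2] keep the
   weights of their parts without [t]. *)
Lemma choose_s : exists s, [/\ Fil (w5 s) M X, Fil (w5 s) M Y, Fil (w5 s) e E2 &
  [\/ ~ lfree y4 (comp (w5 s) M X), ~ lfree y4 (comp (w5 s) M Y)
    | ~ lfree y4 (comp (w5 s) e E2)]].
Proof.
pose l1 := [seq (true, w) | w <- fa_supp E2 & y4 \in w].
pose l2 := [seq (false, w) | w <- fa_supp X ++ fa_supp Y & y4 \in w].
have m1 w : ((true, w) \in l1 ++ l2) = (cf w E2 != 0) && (y4 \in w).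
  rewrite mem_cat; have -> : ((true, w) \in l2) = false by apply/negP => /mapP[].
  by rewrite orbF mem_map ?mem_filter ?mem_supp 1?andbC // => ? ? [].
have m2 w : ((false, w) \in l1 ++ l2) = ((cf w X != 0) || (cf w Y != 0)) && (y4 \in w).
  rewrite mem_cat; have -> : ((false, w) \in l1) = false by apply/negP => /mapP[].
  by rewrite mem_map ?mem_filter ?mem_cat ?mem_supp 1?andbC // => ? ? [].
have [bw bwl] : exists bw, bw \in l1 ++ l2.
  apply: NNPP => H; apply: XY_t; split=> w nw; apply/negP => tw; apply: H;
    by exists (false, w); rewrite m2 nw ?orbT.
pose bound (b : bool) := if b then e else M.
pose c (w : seq 'I_5) : Q := (count_mem y4 w)%:R.
have cpos w : y4 \in w -> 0 < c w by move=> yw; rewrite /c ltr0n -has_count has_pred1.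
(* Minus the upper bound that a word puts on [s]. A word where [f] is maximal determines the largest
   admissible [s], and it then survives in a leading form. *)
pose f (bw : bool * seq 'I_5) : Q := - ((bound bw.1 - wtw (w5 0) bw.2) / c bw.2).
have [[b w] wl wmax] := seq_max f bwl.
pose s := - f (b, w); exists s.
have le_s b' v : (b', v) \in l1 ++ l2 -> y4 \in v -> wtw (w5 s) v <= bound b'.
  move=> vl yv; have := wmax _ vl; rewrite {1}/f /= -[f (b, w)]opprK -/s lerN2.
  by rewrite ler_pdivlMr ?cpos // lerBrDr [_ + wtw _ _]addrC [s * _]mulrC (wtw_w5 e M s).
have eq_s : y4 \in w -> wtw (w5 s) w = bound b.
  move=> yw; rewrite (wtw_w5 e M s) -/(c w) /s /f opprK /= mulrC mulfVK ?gt_eqF ?cpos //.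
  by rewrite addrC subrK.
have free_part u v m : gev idfun t0 u = v -> Fil (w5 s) m v ->
    forall w, y4 \notin w -> cf w u != 0 -> wtw (w5 s) w <= m.
  move=> uv Fv w' yw nw; apply: Fv; rewrite -uv t0_proj cf_proj yw.
  by [].
have Hl l : Hom (w5 s) (w5 s l) (lett l : FA F 5) by apply: HomX.
have Fap l r : w5 s l = e -> Fil (w5 s) M (lett l + act y2 r (lett y3) : FA F 5).
  move=> le; apply: FilD; first by apply: FilW (ltW eM) _; apply: HomFil; move: (Hl l); rewrite le.
  by apply: HomFil; apply: act_Hom => //; apply: (Hl y3).
split.
- move=> v nv; case: (boolP (y4 \in v)) => yv.
    by apply: (le_s false) => //; rewrite m2 nv.
  exact: (free_part _ _ _ X0 (Fap y0 p erefl)).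
- move=> v nv; case: (boolP (y4 \in v)) => yv.
    by apply: (le_s false) => //; rewrite m2 nv orbT.
  exact: (free_part _ _ _ Y0 (Fap y1 q erefl)).
- move=> v nv; case: (boolP (y4 \in v)) => yv.
    by apply: (le_s true) => //; rewrite m1 nv.
  exact: (free_part _ _ _ t0_E2 (HomFil (@Hom_eps s))).
have nf u m : cf w u != 0 -> y4 \in w -> wtw (w5 s) w = m -> ~ lfree y4 (comp (w5 s) m u).
  move=> nu yw wm /(_ w); rewrite cf_proj wm eqxx => /(_ nu).
  by rewrite yw.
case: b wl {wmax le_s} @s eq_s free_part Hl Fap nf => wl s eq_s _ _ _ nf.
  by move: wl; rewrite m1 => /andP[nw yw]; apply: Or33; apply: nf => //; apply: eq_s.
move: wl; rewrite m2 => /andP[/orP[nw|nw] yw]; [apply: Or31 | apply: Or32];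
  by apply: nf => //; apply: eq_s.
Qed.

(** The [K] of [peel_main] has weight [M - e < M], so it cannot contain [y3]. Hence the value of [K]
    times [eps], with coefficients moved into [z] by [lam], is an invariant in [y0], [y1], [z]
    alone, and up to sign it takes the value [h c0(z)] at [(al, be)]. *)
Lemma right_multiple_core : exists c V, [/\ c != 0, vinv p q V, lfree y4 V /\ lfree y3 V,
  Hom (w5 0) M V & evab V = h * zp x2 c].
Proof.
have [N [MN FN nN]] := mu_top.
have [Z0 HZ0 ZE] := top_iota FN; have ev0 := top_ev MN FN.
have [s [FX FY FE nfr]] := choose_s.
have w2 : w5 s y2 = 0 by [].
have [a' [b' [w' [XE YE Fa' Fb' Fw']]]] := strip_lin w2 cpq (ltW e0) FX FY FE.
have FwM : Fil (w5 s) M w' by apply: suppW Fw' => w /andP[].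
pose hE := act y2 q (comp (w5 s) e a') - act y2 p (comp (w5 s) e b').
pose hW := comp (w5 s) M w'.
have HhW : Hom (w5 s) M hW by apply: Hom_comp.
have HhE : Hom (w5 s) e hE by apply: HomB; apply: act_Hom => //; apply: Hom_comp.
have hEE : comp (w5 s) e E2 = hE.
  rewrite XE YE !actD -!actM [q * p]mulrC opprD addrACA subrr addr0 compB !act_comp //.
have compX : comp (w5 s) M X = act y2 p hW.
  by rewrite XE compD (comp_lt Fa' eM) add0r act_comp.
have compY : comp (w5 s) M Y = act y2 q hW.
  by rewrite YE compD (comp_lt Fb' eM) add0r act_comp.
have t0c m u : gev idfun t0 (comp (w5 s) m u) = comp (w5 s) m (gev idfun t0 u).
  by rewrite !t0_proj; apply: proj_comm.
have hE0 : gev idfun t0 hE = eps.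
  by rewrite -hEE t0c t0_E2 comp_id //; apply: Hom_eps.
have Hy0 : Hom (w5 s) e (lett y0 : FA F 5) by apply: (HomX _ (l := y0)).
have Hy1 : Hom (w5 s) e (lett y1 : FA F 5) by apply: (HomX _ (l := y1)).
have Hy3 : Hom (w5 s) M (lett y3 : FA F 5) by apply: (HomX _ (l := y3)).
have eMn : e <> M by move=> E; move: eM; rewrite E ltxx.
have hW0 : gev idfun t0 hW = lett y3.
  have Hd : Hom (w5 s) M (gev idfun t0 hW - lett y3).
    by apply: HomB => //; rewrite /hW t0c; apply: Hom_comp.
  have ad : aug (etaz y2) (bc (gev idfun t0 hW - lett y3)) = 0.
    by apply: aug_bc_Hom Hd _ => //; rewrite gt_eqF.
  apply/eqP; rewrite -subr_eq0; apply/eqP; case/orP: pq0 => n0.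
    apply: (act_eq0 (z := y2) n0 ad); rewrite actB -(act_gev (z := y2) (z' := y2)) // -compX t0c X0 compD.
    by rewrite (comp_ne Hy0 eMn) add0r act_comp // (comp_id Hy3) subrr.
  apply: (act_eq0 (z := y2) n0 ad); rewrite actB -(act_gev (z := y2) (z' := y2)) // -compY t0c Y0 compD.
  by rewrite (comp_ne Hy1 eMn) add0r act_comp // (comp_id Hy3) subrr.
have nfree : ~ (lfree y4 hE /\ lfree y4 hW).
  case=> LE LW; case: nfr; rewrite ?compX ?compY ?hEE //.
    by apply; apply: act_lfree.
  by apply; apply: act_lfree.
(* Because [X = a' + p.w'] and [Y = b' + q.w'], the substitution [U] below sends [mu Pi] to
   [Pi(X, Y)], that is, to itself. The claim compares the leading forms of the two sides. *)
have PsiZ : sub3 y2 hE hW Z0 = iota Z0.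
  pose U : 'I_5 -> FA F 5 := sel5 a' b' (lett y2) w' 0.
  have Umu : gev idfun U (mu Pi) = mu Pi.
    rewrite (gev_sub3 (z' := y2)) // !gevD !(act_gev (z' := y2)) // !gevX /=.
    by rewrite -XE -YE.
  have FU l : Fil (w5 s) (w5 s l) (U l).
    move: l; apply: ord5P => //=; last exact: Fil0.
    exact: HomFil (HomX _ (l := y2)).
  have FNs : Fil (w5 s) N (mu Pi) by apply: Fil_w5_lfree FN; apply: lfree_mu.
  have := comp_gev idfun FU FNs; rewrite Umu (comp_w5_lfree _ _ _ e) ?ZE; last exact: lfree_mu.
  move=> E; rewrite [RHS]E /iota (gev_sub3 (z' := y2)) /=; last first.
    by rewrite comp_id //; apply: (HomX _ (l := y2)).
  rewrite gevX /= gevB !(act_gev (z' := y2)) ?gevX //=;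
  by rewrite comp_id //; apply: (HomX _ (l := y2)).
have HEb : Hom w3 e Eb by apply: HomB; apply: act_Hom => //; apply: Hom_comp.
have Hh : Hom w3 M h by apply: Hom_comp.
have aEb : aug (etaz x2) (bc Eb) = 0 by apply: aug_bc_Hom HEb _ => //; rewrite gt_eqF.
have ah : aug (etaz x2) (bc h) = 0 by apply: aug_bc_Hom Hh _ => //; rewrite gt_eqF.
have evab_iota Y' : evab (iota Y') = sub3 x2 Eb h Y'.
  by rewrite /iota (gev_sub3 (z' := x2)) // gevB !(act_gev (z' := x2)) // !gevX.
have nZ : bc Z0 != 0.
  apply: contraNneq nN => bZ; rewrite ZE -(lam_bc x2 Z0) bZ lam0.
  by rewrite /iota sub3_0.
have HbZ : Hom wS N (bc Z0) by apply: supp_bc.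
have PbZ : sub3 y2 (bc hE) (bc hW) (bc Z0) = sub3 y2 (bc eps) (lett y3) (bc Z0).
  by rewrite -bc_sub3 PsiZ /iota bc_sub3 bcX.
have EbZ : sub3 x2 (bc Eb) (bc h) (bc Z0) = 0.
  by rewrite -bc_sub3 -evab_iota -ZE ev0 bc0.
have [k Lk] := Len_exists (bc Z0).
have [c0 [K [nc0 HK EK]]] :=
  peel_main cpq pq0 e0 eM HhE HhW hE0 hW0 nfree aEb ah nEb nh Lk nZ HbZ PbZ EbZ.
pose V0 := lam x2 (K * lett x0).
have iV0 : iota V0 = lam y2 (sub3 y2 (bc eps) (lett y3) K * bc eps).
  rewrite /V0 /iota /sub3 -(lam_gev (z' := y2)) // gevM gevX /=; congr (lam _ (_ * _)).
  by apply: eq_gev; apply: ord3P => //=; rewrite bcX.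
have LK4 : lfree y4 (sub3 y2 (bc eps) (lett y3) K).
  by apply: (lfree_iotaR hE0 hW0).
have LK3 : lfree y3 (sub3 y2 (bc eps) (lett y3) K).
  move=> w nw; apply/negP => w3; have := wtw_w5_W s (ltW e0) (ltW M0) (LK4 _ nw) w3.
  by rewrite (HK _ nw) => le; move: le e0; lra.
have LV4 : lfree y4 (iota V0).
  rewrite iV0; apply: lfree_lam; apply: lfreeM => //; apply: lfree_bc.
  by apply: lfree_eps; left.
exists c0, (- iota V0); split=> //.
- by rewrite /vinv gevN vinv_iota.
- split; first by apply: suppN.
  apply: suppN; rewrite iV0; apply: (@supp_lam F 5 y2 (fun w => y3 \notin w)) => [w|].
    by rewrite mem_cat inE orbF.
  by apply: lfreeM => //; apply: lfree_bc; apply: lfree_eps; right.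
- apply: HomN; suff HV : Hom (w5 s) M (iota V0) by exact: Hom_w5_lfree LV4 HV.
  rewrite iV0; apply: Hom_lam => //.
  have He : Hom (w5 s) e (bc eps) by apply: supp_bc; exact: Hom_eps.
  by apply: (Hom_eq (HomM HK He)); rewrite subrK.
rewrite gevN evab_iota /V0 /sub3 -(lam_gev (z' := x2)) // gevM gevX /=.
have -> : gev idfun (fun l => bc (sel3 Eb h (lett x2) l)) K = sub3 x2 (bc Eb) (bc h) K.
  by apply: eq_gev; apply: ord3P => //=; rewrite bcX.
have -> : lam x2 (sub3 x2 (bc Eb) (bc h) K * bc Eb) =
    lam x2 (sub3 x2 (bc Eb) (bc h) K * rh x2 (bc Eb)) by apply: lam_mulr; rewrite lam_rh.
have -> : sub3 x2 (bc Eb) (bc h) K * rh x2 (bc Eb) = - (c0 *: rh x2 (bc h)).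
  by apply/eqP; rewrite -addr_eq0 addrC EK.
by rewrite lamN opprK lamZ lam_rh // lam_bc.
Qed.
End Core.

Lemma act_map_polyC (F : comNzRingType) n (z : 'I_n) (c : {poly F}) (u : FA F n) :
  act z (map_poly polyC c) u = zp z c * u.
Proof.
elim/poly_ind: c u => [|c d IH] u; first by rewrite map_poly0 act0l zp0 mul0r.
rewrite rmorphD rmorphM /= map_polyX map_polyC /= actDl actM actX IH actCCl.
by rewrite zpD zpM zpX zpC mulrDl mulr_algl mulrA.
Qed.

Lemma rv_sub3 (R : comNzRingType) n (z : 'I_n) (u v : FA R n) Z :
  rv (sub3 z u v Z) = sub3 z (rv u) (rv v) (rv Z).
Proof. by rewrite /sub3 gev_rv; apply: eq_gev; apply: ord3P => //=; rewrite rvX. Qed.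

Section SRight.
Variables (F : fieldType) (Q : realFieldType).
Implicit Types (p q : {poly {poly F}}) (e M : Q) (f g : FA F 3).
Local Notation w3 := (w3 Q).
Local Notation w5 e M := (sel5 e e 0 M 0 : 'I_5 -> Q).

Definition inverse_pair f g P1 P2 := [/\ sub3 x2 f g P1 = lett x0, sub3 x2 f g P2 = lett x1,
  sub3 x2 P1 P2 f = lett x0 & sub3 x2 P1 P2 g = lett x1].

Lemma inverse_pair_rv f g P1 P2 :
  inverse_pair f g P1 P2 -> inverse_pair (rv f) (rv g) (rv P1) (rv P2).
Proof. by case=> e1 e2 e3 e4; split; rewrite -rv_sub3 ?e1 ?e2 ?e3 ?e4 rvX. Qed.

(** The deformed point is [(f, g)] evaluated at [(mu P1, mu P2)] with [y4] added to one entry; the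
    component of the inverse that belongs to the other entry keeps its value. That component must
    contain [y3] after [mu]. If neither did, [a + p.W] and [b + q.W] would be free of [W], against
    [(p, q)] being nonzero. *)
Lemma top_right_multiple p q e M f g P1 P2 (a0 b0 W0 : FA F 3) :
    Cop p q -> (p != 0) || (q != 0) -> 0 < e -> e < M -> 1 < M ->
    inverse_pair f g P1 P2 -> f = a0 + act x2 p W0 -> g = b0 + act x2 q W0 ->
    Fil w3 e a0 -> Fil w3 e b0 -> Fil w3 M W0 ->
    act x2 q (comp w3 e a0) - act x2 p (comp w3 e b0) != 0 -> comp w3 M W0 != 0 ->
  exists c V, [/\ c != 0, vinv p q V, lfree y4 V /\ lfree y3 V, Hom (w5 e M) M V &
    gev idfun (sel5 (comp w3 e a0) (comp w3 e b0) (lett x2) (comp w3 M W0) 0) V =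
      comp w3 M W0 * zp x2 c].
Proof.
move=> cpq pq0 e0 eM M1 [fgP1 fgP2 Pf Pg] fE gE Fa Fb FW nEb nh.
pose mu := sub3 y2 (lett y0 + act y2 p (lett y3)) (lett y1 + act y2 q (lett y3) : FA F 5).
have Lmu Y : lfree y4 (mu Y).
  apply: lfree_sub; apply: ord3P => /=; try exact: lfree_lett.
    by apply: suppD; [apply: lfree_lett | apply: act_lfree => //; apply: lfree_lett].
  by apply: suppD; [apply: lfree_lett | apply: act_lfree => //; apply: lfree_lett].
have muf : sub3 y2 (mu P1) (mu P2) f = lett y0 + act y2 p (lett y3).
  by rewrite /mu -(gev_sub3 (z := x2) (z' := y2)) // Pf gevX.
have mug : sub3 y2 (mu P1) (mu P2) g = lett y1 + act y2 q (lett y3).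
  by rewrite /mu -(gev_sub3 (z := x2) (z' := y2)) // Pg gevX.
have Lt : ~ lfree y4 (lett y4 : FA F 5).
  move/(_ [:: y4]); rewrite cf_mon eqxx oner_neq0 inE eqxx => /(_ isT).
  by [].
have gen t1 t2 i Pi : i != x2 -> sub3 x2 f g Pi = lett i -> ~ lfree y3 (mu Pi) ->
    let U := sel3 (mu P1 + t1) (mu P2 + t2) (lett y2) in
    gev idfun U (lett i) = mu Pi ->
    gev idfun (sel5 (lett y0) (lett y1) (lett y2) (lett y3) 0) t1 = 0 ->
    gev idfun (sel5 (lett y0) (lett y1) (lett y2) (lett y3) 0) t2 = 0 ->
    ~ (lfree y4 (mu P1 + t1) /\ lfree y4 (mu P2 + t2)) ->
  exists c V, [/\ c != 0, vinv p q V, lfree y4 V /\ lfree y3 V, Hom (w5 e M) M V &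
    gev idfun (sel5 (comp w3 e a0) (comp w3 e b0) (lett x2) (comp w3 M W0) 0) V =
      comp w3 M W0 * zp x2 c].
  move=> ni fgPi nmu U Ui t10 t20 nt.
  apply: (@right_multiple_core _ _ _ cpq pq0 _ _ _ e0 eM M1 _ _ _ Pi _ Fa Fb FW nEb nh ni _ nmu
    (gev idfun U f) (gev idfun U g)) => //.
  - by rewrite -fE -gE.
  - by rewrite -(gev_sub3 (z := x2) (z' := y2)) // fgPi Ui.
  - move=> [L1 L2]; apply: nt; split.
      rewrite -[mu P1 + t1]/(U x0) -(gevX idfun U x0) -fgP1 (gev_sub3 (z' := y2)) //.
      by apply: lfree_sub; apply: ord3P => //=; apply: lfree_lett.
    rewrite -[mu P2 + t2]/(U x1) -(gevX idfun U x1) -fgP2 (gev_sub3 (z' := y2)) //.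
    by apply: lfree_sub; apply: ord3P => //=; apply: lfree_lett.
  - rewrite -[gev idfun U f]/(sub3 y2 (mu P1 + t1) (mu P2 + t2) f) (gev_sub3 (z' := y2)) //.
    by rewrite !gevD t10 t20 !addr0 !t0_id.
  rewrite -[gev idfun U g]/(sub3 y2 (mu P1 + t1) (mu P2 + t2) g) (gev_sub3 (z' := y2)) //.
  by rewrite !gevD t10 t20 !addr0 !t0_id.
have nLt u : lfree y4 u -> ~ lfree y4 (u + lett y4 : FA F 5).
  by move=> Lu Lut; apply: Lt; rewrite -[lett y4](addKr u) addrC; apply: suppB.
case: (classic (lfree y3 (mu P1))) => [L1|nL1]; last first.
  apply: (gen 0 (lett y4) x0 P1 isT fgP1 nL1); rewrite ?gevX ?gev0 /= ?addr0 //.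
  by case=> _; apply: nLt.
case: (classic (lfree y3 (mu P2))) => [L2|nL2]; last first.
  apply: (gen (lett y4) 0 x1 P2 isT fgP2 nL2); rewrite ?gevX ?gev0 /= ?addr0 //.
  by case=> L _; apply: nLt L.
have Lf Y : lfree y3 (sub3 y2 (mu P1) (mu P2) Y).
  by apply: lfree_sub; apply: ord3P => //=; apply: lfree_lett.
have nL l r : lfree y3 (lett l + act y2 r (lett y3) : FA F 5) -> l != y3 -> r = 0.
  move=> L l3; have : lfree y3 (act y2 r (lett y3) : FA F 5).
    by rewrite -[act _ _ _](addKr (lett l)) addrC; apply: suppB => //; apply: lfree_lett; rewrite eq_sym.
  move/(@lfree_bc _ _ y3)/(fox_lfree (etaz y2)); rewrite fox_act // bcX foxX eqxx mulr1.
  exact: zp_eq0.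
case/orP: pq0 => /eqP n0; case: n0.
  by apply: (nL y0) => //; rewrite -muf.
by apply: (nL y1) => //; rewrite -mug.
Qed.

(** An invariant without [y3] and [y4] is a polynomial in [eps] and [z]. At [(al, be)] the letter
    [eps] becomes [Eb], which is nonzero of positive weight and hence satisfies no relation with
    [z]: a derivative of one would give zero divisors. *)
Lemma vinv_vanish p q e al be h U :
    Cop p q -> (p != 0) || (q != 0) -> 0 < e -> Hom w3 e al -> Hom w3 e be ->
    act x2 q al - act x2 p be != 0 -> vinv p q U -> lfree y4 U -> lfree y3 U ->
    gev idfun (sel5 al be (lett x2) h 0) U = 0 -> U = 0.
Proof.
move=> cpq pq0 e0 Hal Hbe nEb VU L4 L3 U0.
set Eb := _ - _ in nEb.
have HEb : Hom w3 e Eb by apply: HomB; apply: act_Hom.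
have aEb : aug (etaz x2) (bc Eb) = 0 by apply: aug_bc_Hom HEb _ => //; rewrite gt_eqF.
have [k Lk] := Len_exists U.
have [Z0 UE] := vinv_iotaE cpq pq0 L4 VU (Len_w5d Lk).
(* Erasing the letter of [W] in [Z0] leaves a relation with a single derivative to consider. *)
pose Z1 := sub3 x2 (lett x0) 0 Z0.
have UZ1 : U = iota p q Z1.
  rewrite -[LHS]gev_id.
  rewrite (lfree_gev (U' := sel5 (lett y0) (lett y1) (lett y2) 0 (lett y4)) _ L3); last by apply: ord5P.
  rewrite UE /iota (gev_sub3 (z' := y2)) // /eps gevB !(act_gev (z' := y2)) // !gevX /=.
  by rewrite [RHS](gev_sub3 (z := x2) (z' := y2)) //= gevX gev0.
have L1 : lfree x1 Z1.
  by apply: lfree_sub; apply: ord3P => /=; [apply: lfree_lett | apply: supp0 | apply: lfree_lett].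
suff Z10 : bc Z1 = 0 by rewrite UZ1 -(lam_bc x2 Z1) Z10 lam0 /iota sub3_0.
apply/eqP; apply: contraT => nZ1.
have E0 : sub3 x2 (bc Eb) (bc Eb) (bc Z1) = 0.
  rewrite -bc_sub3 -[RHS]bc0; congr bc; rewrite -[RHS]U0 UZ1 /iota (gev_sub3 (z' := x2)) //.
  rewrite /eps gevB !(act_gev (z' := x2)) // !gevX /=.
  by apply: lfree_gev L1; apply: ord3P.
have [|Z' [LZ' nn E]] := peel_vanish (P := lfree x1) _ aEb aEb nZ1 (lfree_bc L1) E0.
  by move=> Z l; apply: lfree_fox.
have D1 : fox (etaz x2) x1 Z' = 0 by apply: fox_lfree.
move: nn E; rewrite D1 sub3_0 mul0r addr0 eqxx => -[n0|//] /fa_mulf_eq0[] /eqP.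
  by rewrite (negPf n0).
by rewrite (negPf (rh_bc_neq0 aEb nEb)).
Qed.
End SRight.

Section Reversal.
Variables (F : fieldType) (Q : realFieldType).
Implicit Types (p q : {poly {poly F}}) (e M : Q) (f g : FA F 3).
Local Notation w3 := (w3 Q).
Local Notation w5 e M := (sel5 e e 0 M 0 : 'I_5 -> Q).

Lemma vinv_rv p q V : vinv (swapXY p) (swapXY q) V -> vinv p q (rv V).
Proof.
rewrite /vinv => E; rewrite -[in RHS]E gev_rv; apply: eq_gev.
by apply: ord5P => //=; rewrite ?rvD ?rv_act ?rvX ?swapXYK.
Qed.

Lemma lfree_rv n (t : 'I_n) (u : FA F n) : lfree t u -> lfree t (rv u).
Proof. by move=> H; apply: supp_rv H => s; rewrite mem_rev. Qed.

(** By [vinv_vanish] the two one-sided relations lift from values to invariants, as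
    [c'(z) V = rv V' c(z)]. Coprimality then divides [V] by [c(z)] on the right. *)
Lemma top_invariant p q e M f g P1 P2 (a0 b0 W0 : FA F 3) :
    Cop p q -> (p != 0) || (q != 0) -> 0 < e -> e < M -> 1 < M ->
    inverse_pair f g P1 P2 -> f = a0 + act x2 p W0 -> g = b0 + act x2 q W0 ->
    Fil w3 e a0 -> Fil w3 e b0 -> Fil w3 M W0 ->
    act x2 q (comp w3 e a0) - act x2 p (comp w3 e b0) != 0 -> comp w3 M W0 != 0 ->
  exists V, [/\ vinv p q V, lfree y4 V /\ lfree y3 V, Hom (w5 e M) M V &
    gev idfun (sel5 (comp w3 e a0) (comp w3 e b0) (lett x2) (comp w3 M W0) 0) V =
      comp w3 M W0].
Proof.
move=> cpq pq0 e0 eM M1 iv fE gE Fa Fb FW nEb nh.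
have [c [V [c0 VV [V4 V3] HV VE]]] := top_right_multiple cpq pq0 e0 eM M1 iv fE gE Fa Fb FW nEb nh.
have sw0 r : swapXY r = 0 :> {poly {poly F}} -> r = 0.
  by move/(congr1 swapXY); rewrite swapXYK linear0.
have pq0' : (swapXY p != 0) || (swapXY q != 0).
  by case/orP: pq0 => n0; apply/orP; [left|right]; apply: contra n0 => /eqP/sw0 ->.
have cpq' := cop_swap cpq.
have fE' : rv f = rv a0 + act x2 (swapXY p) (rv W0) by rewrite fE rvD rv_act.
have gE' : rv g = rv b0 + act x2 (swapXY q) (rv W0) by rewrite gE rvD rv_act.
have [||c' [V' [c0' VV' [V4' V3'] HV' VE']]] := top_right_multiple cpq' pq0' e0 eM M1
  (inverse_pair_rv iv) fE' gE' (Fil_rv Fa) (Fil_rv Fb) (Fil_rv FW).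
- by rewrite !comp_rv -!rv_act -rvB rv_eq0.
- by rewrite comp_rv rv_eq0.
have {VE'} VE' : gev idfun (sel5 (comp w3 e a0) (comp w3 e b0) (lett x2) (comp w3 M W0) 0)
    (rv V') = zp x2 c' * comp w3 M W0.
  apply: (can_inj (@rvK _ _)); rewrite gev_rv rvK rvM rv_zp -comp_rv -VE'.
  by apply: eq_gev; apply: ord5P => //=; rewrite ?comp_rv ?rvX ?rv0.
have VrV := vinv_rv VV'.
have EV : zp y2 c' * V = rv V' * zp y2 c.
  have Ha (u : FA F 3) : Hom w3 e (comp w3 e u) by apply: Hom_comp.
  apply/eqP; rewrite -subr_eq0; apply/eqP.
  have van := vinv_vanish cpq pq0 e0 (Ha a0) (Ha b0) nEb (h := comp w3 M W0).
   apply: van.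
  - by rewrite /vinv gevB !gevM VrV VV !(gevz_zp (z' := y2)).
  - by apply: suppB; apply: lfreeM => //; [apply: lfree_zp|apply: lfree_rv|apply: lfree_zp].
  - by apply: suppB; apply: lfreeM => //; [apply: lfree_zp|apply: lfree_rv|apply: lfree_zp].
  by rewrite gevB !gevM VE VE' !(gevz_zp (z' := x2)) // mulrA subrr.
have M0 : M != 0 by rewrite gt_eqF // (lt_trans e0).
have aV : aug (etaz y2) (bc V) = 0 by apply: aug_bc_Hom HV M0.
have aV' : aug (etaz y2) (bc (rv V')) = 0 by apply: aug_bc_Hom (Hom_rv HV') M0.
move: EV; rewrite -act_map_polyC -actCl => EV.
have [r s|T [VT _]] := cop_act (p := c%:P) (q := map_poly polyC c') _ aV aV' EV.
  move=> rs; have [x [-> ->]] := cop_vars c0' c0 (esym rs).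
  by exists x.
rewrite actCl in VT.
have Hz : Hom (w5 e M) 0 (zp y2 c) by apply: Hom_zp.
have z0 : zp y2 c != 0 :> FA F 5 by apply: zp_neq0.
exists T; split.
- apply: (fa_mulIf z0); rewrite -VT -VV VT gevM (gevz_zp (z' := y2)) //.
- by split; apply: lfree_mulr z0 _; rewrite -VT.
- have HT : Hom (w5 e M) M (comp (w5 e M) M T) by apply: Hom_comp.
  congr Hom: HT; apply: (fa_mulIf z0); rewrite -VT.
  rewrite -(comp_id HV) VT -[X in comp _ X (T * _)]addr0 (comp_mul (u := T)).
    by rewrite (comp_id Hz).
    apply: (Fil_mul_zp (z := y2) (p := c)) => //; rewrite -VT; exact: HomFil HV.
  exact: HomFil Hz.
have z0' : zp x2 c != 0 :> FA F 3 by apply: zp_neq0.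
by apply: (fa_mulIf z0'); rewrite -VE VT gevM (gevz_zp (z' := x2)).
Qed.

(** Invariance under translation by the generic letter [y4] specializes to translation by any [w] in
    any free algebra. *)
Lemma invariant_reductor p q e M f g P1 P2 (a0 b0 W0 : FA F 3) :
    Cop p q -> (p != 0) || (q != 0) -> 0 < e -> e < M -> 1 < M ->
    inverse_pair f g P1 P2 -> f = a0 + act x2 p W0 -> g = b0 + act x2 q W0 ->
    Fil w3 e a0 -> Fil w3 e b0 -> Fil w3 M W0 ->
    act x2 q (comp w3 e a0) - act x2 p (comp w3 e b0) != 0 -> comp w3 M W0 != 0 ->
  exists T, [/\ Hom (sel3 e e 0) M T,
    forall n (z : 'I_n) (u v w : FA F n),
      sub3 z (u + act z p w) (v + act z q w) T = sub3 z u v T &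
    sub3 x2 (comp w3 e a0) (comp w3 e b0) T = comp w3 M W0].
Proof.
move=> cpq pq0 e0 eM M1 iv fE gE Fa Fb FW nEb nh.
have [V [VV [V4 V3] HV VE]] := top_invariant cpq pq0 e0 eM M1 iv fE gE Fa Fb FW nEb nh.
pose S : 'I_5 -> FA F 3 := sel5 (lett x0) (lett x1) (lett x2) 0 0.
have TE n (z : 'I_n) (u v : FA F n) :
    sub3 z u v (gev idfun S V) = gev idfun (sel5 u v (lett z) 0 0) V.
  rewrite /sub3 (gev_comp (phi'' := idfun)) //; apply: eq_gev.
  by apply: ord5P => /=; rewrite ?gevX ?gev0.
exists (gev idfun S V); split.
- by apply: Hom_gev HV; apply: ord5P => /=; try (exact: HomX); exact: supp0.
- move=> n z u v w; rewrite !TE.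
  rewrite (lfree_gev (U := sel5 u v (lett z) 0 0) (U' := sel5 u v (lett z) 0 w) _ V4);
    last by apply: ord5P.
  rewrite -[in RHS]VV (gev_comp (phi'' := idfun)) //; apply: lfree_gev V4.
  by apply: ord5P => //= _; rewrite ?gevD ?(act_gev (z' := z)) ?gevX.
rewrite TE -VE; apply: lfree_gev V3.
by apply: ord5P.
Qed.
End Reversal.

(** * Reduction of the degree *)

Lemma w3_ge0 (Q : realFieldType) (s : seq 'I_3) : 0 <= wtw (w3 Q) s.
Proof. by have [k ->] := wtw3_nat Q s; apply: ler0n. Qed.

Lemma fox_act_lett (F : comNzRingType) (p : {poly {poly F}}) (i j : 'I_3) : j != x2 ->
  fox (etaz x2) j (bc (act x2 p (lett i : FA F 3))) = zp x2 p * (i == j)%:R.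
Proof. by move=> j2; rewrite fox_act // bcX foxX. Qed.

Section Reduction.
Variables (F : fieldType) (Q : realFieldType).
Implicit Types (p q : {poly {poly F}}) (f g T : FA F 3).
Local Notation w3 := (w3 Q).

(* Makes (x + p.T, y + q.T, z) an automorphism, with inverse (x - p.T, y - q.T, z). *)
Definition transl_inv p q T := forall n (z : 'I_n) (u v w : FA F n),
  sub3 z (u + act z p w) (v + act z q w) T = sub3 z u v T.

Lemma Fil_lt_nat (k : nat) f : supp (fun s => wtw w3 s < k.+1%:R) f -> Fil w3 k%:R f.
Proof. by apply: suppW => s; have [m ->] := wtw3_nat Q s; rewrite ltr_nat ler_nat. Qed.

(** The inverse substitution turns [q.f - p.g] into [q.x - p.y], homogeneous of weight 1, and fixes
    polynomials in [z]. So weight 0 would force [p = q = 0]. *)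
Lemma not_pure p q f g P1 P2 : (p != 0) || (q != 0) -> inverse_pair f g P1 P2 ->
  ~ Hom w3 0 (act x2 q f - act x2 p g).
Proof.
move=> pq0 [_ _ Pf Pg] HE.
have wpos (l : 'I_3) : predT l -> l != x2 -> 0 < w3 l by move: l; apply: ord3P => //=.
have [c E] : exists c, act x2 q f - act x2 p g = zp x2 c.
  by apply: (Hom0_zp (L := predT) _ wpos _ HE) => // s _; apply: all_predT.
have {}E : act x2 q (lett x0) - act x2 p (lett x1) = zp x2 c :> FA F 3.
  by rewrite -Pf -Pg -!sub3_act -sub3B E /sub3 (gevz_zp (z' := x2)).
have H1 : Hom w3 1 (act x2 q (lett x0) - act x2 p (lett x1) : FA F 3).
  by apply: HomB; apply: act_Hom => //; [exact: (HomX _ (l := x0))|exact: (HomX _ (l := x1))].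
have H0 : Hom w3 0 (zp x2 c : FA F 3) by apply: Hom_zp.
have {}E : act x2 q (lett x0) - act x2 p (lett x1) = 0 :> FA F 3.
  by rewrite -(comp_id H1) E (comp_ne H0) //; apply/eqP; rewrite eq_sym oner_neq0.
have D j : j != x2 -> zp x2 q * (x0 == j)%:R - zp x2 p * (x1 == j)%:R = 0 :> FA {poly F} 3.
  by move=> j2; rewrite -!fox_act_lett // -foxB -bcB E bc0 fox0.
have := D x0 isT; rewrite eqxx mulr1 mulr0 subr0 => /zp_eq0 q0.
have := D x1 isT; rewrite eqxx mulr1 mulr0 sub0r => /eqP; rewrite oppr_eq0 => /eqP/zp_eq0 p0.
by rewrite p0 q0 eqxx in pq0.
Qed.

Lemma reduction (k : nat) f g P1 P2 :
    inverse_pair f g P1 P2 -> Fil w3 k.+2%:R f -> Fil w3 k.+2%:R g ->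
  exists p q T, [/\ transl_inv p q T, Fil w3 k.+1%:R (f - act x2 p (sub3 x2 f g T)) &
    Fil w3 k.+1%:R (g - act x2 q (sub3 x2 f g T))].
Proof.
move=> iv Ff Fg; set M := k.+2%:R in Ff Fg.
case: (classic (comp w3 M f = 0 /\ comp w3 M g = 0)) => [[f0 g0]|nfg].
  exists 0, 0, 0; split; first by move=> n z u v w; rewrite !sub3_0.
    by rewrite act0l subr0; apply/Fil_lt_nat/Fil_lt.
  by rewrite act0l subr0; apply/Fil_lt_nat/Fil_lt.
have M1 : 1 < M by rewrite ltr1n.
have [p [q [h [cpq pq0 Hh fh gh]]]] := top_gcd M1 Ff Fg (or_introl (let: And4 e _ _ _ := iv in e)).
pose E := act x2 q f - act x2 p g.
have FE : Fil w3 M E by apply: suppB; apply: act_Fil.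
have ME : comp w3 M E = 0.
  by rewrite compB !act_comp // fh gh -!actM mulrC subrr.
have LE := Fil_lt FE ME.
have nE : E != 0.
  by apply/eqP => E0; apply: (not_pure pq0 iv); rewrite -/E E0; apply: supp0.
have [e Fe ne] := top_exists w3 nE.
have e0 : 0 < e.
  rewrite ltNge; apply/negP => e0; apply: (not_pure pq0 iv); rewrite -/E.
  by apply: suppW Fe => s se; apply/eqP; rewrite eq_le w3_ge0 (le_trans se).
have eM : e < M.
  rewrite ltNge; apply: contra ne => Me; apply/eqP/proj_0.
  by apply: suppW LE => s sM; apply/negP => /eqP se; move: sM; rewrite se ltNge Me.
have w2 : w3 x2 = 0 by [].
have [a [b [w [fE gE Fa Fb Fw]]]] := strip_lin w2 cpq (ltW e0) Ff Fg Fe.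
have FwM : Fil w3 M w by apply: suppW Fw => s /andP[].
have EE : E = act x2 q a - act x2 p b.
  by rewrite /E fE gE !actD -!actM [q * p]mulrC opprD addrACA subrr addr0.
have nEb : act x2 q (comp w3 e a) - act x2 p (comp w3 e b) != 0.
  by rewrite -!act_comp // -compB -EE.
have fw : comp w3 M f = act x2 p (comp w3 M w) by rewrite fE compD (comp_lt Fa eM) add0r act_comp.
have gw : comp w3 M g = act x2 q (comp w3 M w) by rewrite gE compD (comp_lt Fb eM) add0r act_comp.
have nw : comp w3 M w != 0.
  by apply/eqP => w0; apply: nfg; rewrite fw gw w0 !act0.
have [T [HT Tinv TE]] := invariant_reductor cpq pq0 e0 eM M1 iv fE gE Fa Fb FwM nEb nw.
exists p, q, T; have -> : sub3 x2 f g T = sub3 x2 a b T by rewrite fE gE Tinv.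
have FU l : Fil w3 (sel3 e e 0 l) (sel3 a b (lett x2) l).
  by move: l; apply: ord3P => //=; apply: HomFil; apply: (HomX _ (l := x2)).
have FT : Fil w3 M (sub3 x2 a b T) by apply: Fil_gev FU _; apply: HomFil.
have cT : comp w3 M (sub3 x2 a b T) = comp w3 M w.
  rewrite -TE /sub3 (comp_gev _ FU (HomFil HT)) (comp_id HT); apply: eq_gev.
  by apply: ord3P => //=; apply: comp_id; apply: (HomX _ (l := x2)).
split=> //; apply/Fil_lt_nat/Fil_lt.
- by apply: suppB => //; apply: act_Fil.
- by rewrite compB act_comp // cT fw subrr.
- by apply: suppB => //; apply: act_Fil.
by rewrite compB act_comp // cT gw subrr.
Qed.
End Reduction.

(** * Tame substitutions *)

Section Tame.
Variables (F : fieldType).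

Definition elem_subst n (i : 'I_n) (c : F) (t : FA F n) : 'I_n -> FA F n :=
  fun l => if l == i then c *: lett i + t else lett l.

(** Each step composes on the outside, which matches a new head of the list in [tame]. *)
Inductive tame_subst n : ('I_n -> FA F n) -> Prop :=
| tame_subst_id U : U =1 lett -> tame_subst U
| tame_subst_step i c t U V : c != 0 -> lfree i t -> tame_subst U ->
    (forall l, V l = gev idfun (elem_subst i c t) (U l)) -> tame_subst V.

Lemma eq_tame_subst n (U V : 'I_n -> FA F n) : U =1 V -> tame_subst U -> tame_subst V.
Proof.
move=> E HU; case: HU E => [U' U'id|i c t U' V' c0 ti HU' VE] E.
  by apply: tame_subst_id => l; rewrite -E.
by apply: (tame_subst_step c0 ti HU') => l; rewrite -E.
Qed.

Lemma tame_subst_comp n (U V : 'I_n -> FA F n) :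
  tame_subst U -> tame_subst V -> tame_subst (fun l => gev idfun U (V l)).
Proof.
move=> HU HV; elim: HU => {U} [U Uid|i c t U U' c0 ti _ IH UE].
  by apply: eq_tame_subst HV => l; rewrite (eq_gev _ Uid) gev_id.
apply: (tame_subst_step c0 ti IH) => l.
by rewrite (gev_comp (phi'' := idfun)) //; apply: eq_gev.
Qed.

Lemma tame_elem_subst n (i : 'I_n) c t : c != 0 -> lfree i t -> tame_subst (elem_subst i c t).
Proof.
move=> c0 ti; apply: (tame_subst_step c0 ti (tame_subst_id (frefl _))) => l.
by rewrite gevX.
Qed.

Definition incl m : FA F 3 -> FA F (3 + m) := gev idfun (fun i => lett (lshift m i)).

Definition stab_subst m (f g : FA F 3) : 'I_(3 + m) -> FA F (3 + m) := fun l =>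
  match split l with
  | inl i => incl m (sel3 f g (lett x2) i)
  | inr k => lett (rshift 3 k)
  end.

Lemma stab_substL m f g i : stab_subst f g (lshift m i) = incl m (sel3 f g (lett x2) i).
Proof. by rewrite /stab_subst (unsplitK (inl i)). Qed.

Lemma stab_substR m f g k : @stab_subst m f g (rshift 3 k) = lett (rshift 3 k).
Proof. by rewrite /stab_subst (unsplitK (inr k)). Qed.

Lemma incl_sub3 m u v Z : incl m (sub3 x2 u v Z) = sub3 (lshift m x2) (incl m u) (incl m v) Z.
Proof. by rewrite /incl (gev_sub3 (z' := lshift m x2)). Qed.

Lemma inclE m Z : incl m Z = sub3 (lshift m x2) (lett (lshift m x0)) (lett (lshift m x1)) Z.
Proof. by apply: eq_gev; apply: ord3P. Qed.

Lemma stab_subst_incl m f g Z : gev idfun (@stab_subst m f g) (incl m Z) = incl m (sub3 x2 f g Z).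
Proof.
rewrite incl_sub3 inclE (gev_sub3 (z' := lshift m x2)) ?gevX ?stab_substL //.
by rewrite /incl gevX.
Qed.

(** Asked for all large [m], so that two pairs can be composed with a common number of extra
    variables. *)
Definition stable_pair f g := exists m0, forall m, (m0 <= m)%N -> tame_subst (@stab_subst m f g).

Lemma stable_pair_comp f g a b : stable_pair f g -> stable_pair a b -> stable_pair (sub3 x2 f g a) (sub3 x2 f g b).
Proof.
move=> [m0 H0] [m1 H1]; exists (maxn m0 m1) => m; rewrite geq_max => /andP[h0 h1].
apply: eq_tame_subst (tame_subst_comp (H0 _ h0) (H1 _ h1)) => l.
case: (split_ordP l) => i ->; rewrite ?stab_substL ?stab_substR ?gevX ?stab_substR // stab_subst_incl; congr incl.
by move: i; apply: ord3P => //=; rewrite /sub3 gevX.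
Qed.

Lemma stable_pair_tau p q T : transl_inv p q T -> stable_pair (lett x0 + act x2 p T) (lett x1 + act x2 q T).
Proof.
move=> Tinv; exists 1%N => -[//|m] _.
pose X := lshift m.+1 x0; pose Y := lshift m.+1 x1; pose Z := lshift m.+1 x2.
pose w : 'I_(3 + m.+1) := rshift 3 ord0.
pose A s : 'I_(3 + m.+1) -> FA F (3 + m.+1) := elem_subst w 1 (s *: incl m.+1 T).
pose B s : 'I_(3 + m.+1) -> FA F (3 + m.+1) := fun l =>
  if l == X then lett X + act Z p (s *: lett w)
  else if l == Y then lett Y + act Z q (s *: lett w) else lett l.
have Lw : lfree w (incl m.+1 T).
  by apply: lfree_sub => l; apply: lfree_lett; rewrite /w eq_rlshift.
have TA s : tame_subst (A s) by apply: tame_elem_subst; [rewrite oner_neq0 | apply: suppZ].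
have TB s : tame_subst (B s).
  have Lp l r : l != Z -> l != w -> lfree l (act Z r (s *: lett w : FA F (3 + m.+1))).
    by move=> lZ lw; apply: act_lfree => //; apply: suppZ; apply: lfree_lett.
  have T1 := tame_elem_subst (oner_neq0 F) (Lp X p isT isT).
  have T2 := tame_elem_subst (oner_neq0 F) (Lp Y q isT isT).
  apply: eq_tame_subst (tame_subst_comp T1 T2) => l; rewrite /B /elem_subst.
  case: (l =P Y) => [->|lY]; rewrite ?gevD ?gevZ ?gevX //=.
    rewrite (act_gev (z' := Z)) //.
    by rewrite gevZ gevX !scale1r.
  by case: (l =P X) => _; rewrite ?scale1r.
have AT s : gev idfun (A s) (incl m.+1 T) = incl m.+1 T.
  by rewrite inclE (gev_sub3 (z' := Z)) // !gevX.
have BT s : gev idfun (B s) (incl m.+1 T) = incl m.+1 T.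
  by rewrite inclE (gev_sub3 (z' := Z)) // !gevX; apply: Tinv.
(* All four factors fix [T]. The letter [w] loses [T] and regains it, while [x] becomes [x + p.w],
   then [x + p.(w + T)], and finally loses [p.w]; likewise [y] with [q]. *)
have := tame_subst_comp (TB (-1)) (tame_subst_comp (TA 1) (tame_subst_comp (TB 1) (TA (-1)))).
apply: eq_tame_subst => l.
have Aw s : A s w = lett w + s *: incl m.+1 T by rewrite /A /elem_subst eqxx scale1r.
have Al s l' : l' != w -> A s l' = lett l' by rewrite /A /elem_subst; case: eqP.
have Bl s l' : l' != X -> l' != Y -> B s l' = lett l' by rewrite /B; case: eqP => //; case: eqP.
have BX s : B s X = lett X + act Z p (s *: lett w) by [].
have BY s : B s Y = lett Y + act Z q (s *: lett w) by [].
have gact s (U : 'I_(3 + m.+1) -> FA F (3 + m.+1)) r u : U Z = lett Z ->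
    gev idfun U (act Z r (s *: u)) = act Z r (s *: gev idfun U u).
  by move=> UZ; rewrite (act_gev (z' := Z)) // gevZ.
have tX i (r : {poly {poly F}}) : (i = X /\ r = p \/ i = Y /\ r = q) ->
   gev idfun (B (-1)) (gev idfun (A 1) (gev idfun (B 1) (A (-1) i))) =
     lett i + act Z r (incl m.+1 T).
  move=> ir; rewrite Al; last by case: ir => -[-> _].
  rewrite gevX; have -> : B 1 i = lett i + act Z r (1 *: lett w) by case: ir => -[-> ->].
  rewrite gevD gevX Al; last by case: ir => -[-> _].
  rewrite gact ?gevX // Aw gevD gevX gact // gevD gevZ BT gevX (Bl _ w) //.
  have -> : B (-1) i = lett i + act Z r (-1 *: lett w) by case: ir => -[-> ->].
  by rewrite !scale1r scaleN1r !actD (actN _ _ (lett w)) addrA subrK.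
case: (split_ordP l) => i ->; rewrite ?stab_substL ?stab_substR.
  move: i; apply: ord3P.
  - rewrite (tX X p) /=; last by left.
    rewrite /incl gevD gevX.
    by rewrite (act_gev (z' := Z)).
  - rewrite (tX Y q) /=; last by right.
    rewrite /incl gevD gevX.
    by rewrite (act_gev (z' := Z)).
  by rewrite Al // gevX Bl // gevX Al // gevX Bl // /incl gevX.
case: (eqVneq (rshift 3 i) w) => [->|iw]; last first.
  by rewrite Al // gevX Bl // gevX Al // gevX Bl.
rewrite Aw !gevD !gevX !gevZ BT AT Aw gevD gevZ !BT gevX Bl //.
by rewrite scale1r /= scaleN1r addrK.
Qed.
End Tame.

(** * Matrices over F[s, t] *)

Lemma fresh_letters N n m (z : 'I_N) (k : 'I_n -> 'I_N) : (n + m < N)%N ->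
  exists k' : 'I_m -> 'I_N, [/\ injective k', forall j, k' j != z & forall i j, k i != k' j].
Proof.
move=> nmN; pose S := z |: [set k i | i : 'I_n].
have cS : (m <= #|~: S|)%N.
  have c1 : (#|S| <= n.+1)%N.
    rewrite cardsU1 -addn1 addnC; apply: leq_add; last exact: leq_b1.
    by rewrite (leq_trans (leq_imset_card _ _)) // card_ord.
  have := cardsC S; rewrite card_ord; lia.
pose k' j := enum_val (widen_ord cS j).
have k'S j : k' j \notin S by rewrite -in_setC; apply: enum_valP.
exists k'; split.
- by move=> i j /enum_val_inj/(congr1 val)/= /val_inj.
- by move=> j; apply: contra (k'S j) => /eqP ->; rewrite setU11.
by move=> i j; apply: contra (k'S j) => /eqP <-; rewrite setU1r // imset_f.
Qed.

Section Linear.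
Variable (F : fieldType).
Local Notation S := {poly {poly F}}.

Definition mx_subst N (z : 'I_N) n (k : 'I_n -> 'I_N) (M : 'M[S]_n) : 'I_N -> FA F N := fun l =>
  if [pick i | k i == l] is Some i then \sum_j act z (M i j) (lett (k j)) else lett l.

Section LinTheory.
Variables (N : nat) (z : 'I_N) (n : nat) (k : 'I_n -> 'I_N).
Hypotheses (kI : injective k) (kz : forall i, k i != z).
Implicit Types M : 'M[S]_n.

Lemma mx_substE M i : mx_subst z k M (k i) = \sum_j act z (M i j) (lett (k j)).
Proof. by rewrite /mx_subst; case: pickP => [j /eqP/kI -> //|/(_ i)]; rewrite eqxx. Qed.

Lemma mx_subst_out M l : (forall i, k i != l) -> mx_subst z k M l = lett l.
Proof. by rewrite /mx_subst; case: pickP => // i E /(_ i); rewrite E. Qed.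

Lemma mx_subst_ind M (U : 'I_N -> FA F N) :
    (forall i, U (k i) = \sum_j act z (M i j) (lett (k j))) ->
    (forall l, (forall i, k i != l) -> U l = lett l) ->
  U =1 mx_subst z k M.
Proof.
move=> U1 U2 l; case: (pickP (fun i => k i == l)) => [i /eqP <-|nl]; first by rewrite U1 mx_substE.
by have nl' i : k i != l by [rewrite nl]; rewrite U2 // mx_subst_out.
Qed.

Lemma act_sum (I : Type) (r : seq I) (P : pred I) (G : I -> FA F N) (p : S) :
  act z p (\sum_(i <- r | P i) G i) = \sum_(i <- r | P i) act z p (G i).
Proof. by apply: (big_morph (act z p)) => [u v|]; [exact: actD | exact: act0]. Qed.

Lemma act_suml (I : Type) (r : seq I) (P : pred I) (G : I -> S) (u : FA F N) :
  act z (\sum_(i <- r | P i) G i) u = \sum_(i <- r | P i) act z (G i) u.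
Proof.
by apply: (big_morph (fun p => act z p u)) => [p q|]; [exact: actDl | exact: act0l].
Qed.

Lemma mx_subst_mul M1 M2 l : gev idfun (mx_subst z k M2) (mx_subst z k M1 l) = mx_subst z k (M1 *m M2) l.
Proof.
move: l; apply: mx_subst_ind => [i|l nl]; last by rewrite mx_subst_out // gevX mx_subst_out.
rewrite mx_substE gev_sum; under [LHS]eq_bigr => j _.
  rewrite (act_gev (z' := z)) ?mx_subst_out // gevX mx_substE act_sum; under eq_bigr do rewrite -actM.
  over.
rewrite exchange_big /=; apply: eq_bigr => j _.
by rewrite mxE act_suml.
Qed.

Lemma mx_subst1 l : mx_subst z k 1%:M l = lett l.
Proof.
apply/esym; move: l; apply: mx_subst_ind => // i; rewrite (bigD1 i) //= mxE eqxx act1l big1 ?addr0 //.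
by move=> j ji; rewrite mxE eq_sym (negPf ji) act0l.
Qed.
End LinTheory.

(** The strict inequality leaves room for [z] beside the [n] letters of the matrix and [m] spare
    ones. Allowing every placement [k] lets a block of a matrix act on part of the letters. *)
Definition tame_mx n (M : 'M[S]_n) := exists m, forall N (z : 'I_N) (k : 'I_n -> 'I_N),
  injective k -> (forall i, k i != z) -> (n + m < N)%N -> tame_subst (mx_subst z k M).

Lemma tame_mx_mul n (M1 M2 : 'M[S]_n) : tame_mx M1 -> tame_mx M2 -> tame_mx (M1 *m M2).
Proof.
move=> [m1 H1] [m2 H2]; exists (maxn m1 m2) => N z k kI kz nN.
have L1 : tame_subst (mx_subst z k M1) by apply: H1 => //; lia.
have L2 : tame_subst (mx_subst z k M2) by apply: H2 => //; lia.
by apply: eq_tame_subst (tame_subst_comp L2 L1) => l; rewrite mx_subst_mul.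
Qed.

Lemma tame_mx1 n : tame_mx (1%:M : 'M_n).
Proof. by exists 0%N => N z k kI kz _; apply: tame_subst_id => l; apply: mx_subst1. Qed.

Lemma tame_mx_transvection n (i j : 'I_n) (c : S) : i != j -> tame_mx (1%:M + c *: delta_mx i j).
Proof.
move=> ij; exists 0%N => N z k kI kz _.
have Li : lfree (k i) (act z c (lett (k j)) : FA F N).
  by apply: act_lfree => //; apply: lfree_lett; apply: contra ij => /eqP/kI ->.
apply: eq_tame_subst (tame_elem_subst (oner_neq0 F) Li); apply: mx_subst_ind => // [i'|l nl]; last first.
  by rewrite /elem_subst eq_sym (negPf (nl i)).
rewrite /elem_subst (inj_eq kI) scale1r; under eq_bigr do rewrite !mxE actDl.
rewrite big_split /= (bigD1 i') //= eqxx act1l // big1 ?addr0 => [|j' jj]; last first.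
  by rewrite eq_sym (negPf jj) act0l.
case: (i' =P i) => [->|_] /=; last first.
  by rewrite big1 ?addr0 // => j' _; rewrite mulr0 act0l.
rewrite (bigD1 j) //= eqxx mulr1 big1 ?addr0 // => j' jj.
by rewrite (negPf jj) mulr0 act0l.
Qed.

Lemma tame_mx_scaling n (i : 'I_n) (c : F) : c != 0 ->
  tame_mx (1%:M + (c - 1)%:P%:P *: delta_mx i i).
Proof.
move=> c0; exists 0%N => N z k kI kz _.
have Li : lfree (k i) (0 : FA F N) by apply: supp0.
apply: eq_tame_subst (tame_elem_subst c0 Li); apply: mx_subst_ind => // [i'|l nl]; last first.
  by rewrite /elem_subst eq_sym (negPf (nl i)).
rewrite /elem_subst (inj_eq kI) addr0; under eq_bigr do rewrite !mxE actDl.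
rewrite big_split /= (bigD1 i') //= eqxx act1l // big1 ?addr0 => [|j' jj]; last first.
  by rewrite eq_sym (negPf jj) act0l.
case: (i' =P i) => [->|_] /=; last first.
  by rewrite big1 ?addr0 // => j' _; rewrite mulr0 act0l.
rewrite (bigD1 i) //= eqxx mulr1 big1 ?addr0 => [|j' jj].
  by rewrite actCCl scalerBl scale1r addrC subrK.
by rewrite (negPf jj) mulr0 act0l.
Qed.

(** The identity block is placed on spare letters, which it fixes, so both matrices define the same
    substitution. *)
Lemma tame_mx_stab n m (M : 'M[S]_n) : tame_mx (block_mx M 0 0 (1%:M : 'M_m)) -> tame_mx M.
Proof.
move=> [m0 H]; exists (m + m0)%N => N z k kI kz nN.
have [|k' [k'I k'z kk']] := @fresh_letters N n m z k; first by lia.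
pose K (i : 'I_(n + m)) := match split i with inl i => k i | inr j => k' j end.
have KL i : K (lshift m i) = k i by rewrite /K (unsplitK (inl i)).
have KR i : K (rshift n i) = k' i by rewrite /K (unsplitK (inr i)).
have KI : injective K.
  move=> i j; case: (split_ordP i) => i' ->; case: (split_ordP j) => j' ->; rewrite ?KL ?KR.
  - by move/kI ->.
  - by move/eqP; rewrite (negPf (kk' _ _)).
  - by move/esym/eqP; rewrite (negPf (kk' _ _)).
  by move/k'I ->.
have Kz i : K i != z by case: (split_ordP i) => i' ->; rewrite ?KL ?KR.
apply: eq_tame_subst (H N z K KI Kz _); last by lia.
apply: mx_subst_ind => // [i|l nl].
  rewrite -KL mx_substE // big_split_ord /= [X in _ + X]big1 ?addr0 => [|j _].
    by apply: eq_bigr => j _; rewrite block_mxEul KL.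
  by rewrite block_mxEur mxE act0l.
case: (pickP (fun j => k' j == l)) => [j /eqP <-|nl'].
  rewrite -KR mx_substE // big_split_ord /= big1 ?add0r => [|i _]; last by rewrite block_mxEdl mxE act0l.
  rewrite (bigD1 j) //= block_mxEdr mxE eqxx act1l big1 ?addr0 // => i ij.
  by rewrite block_mxEdr mxE eq_sym (negPf ij) act0l.
by apply: mx_subst_out => i; case: (split_ordP i) => i' ->; rewrite ?KL ?KR ?nl'.
Qed.

Lemma tame_mx_ext n m (M : 'M[S]_n) : tame_mx M -> tame_mx (block_mx (1%:M : 'M_m) 0 0 M).
Proof.
move=> [m0 H]; exists m0 => N z k kI kz nN.
pose k' i := k (rshift m i).
have k'I : injective k' by move=> i j /kI/rshift_inj.
apply: eq_tame_subst (H N z k' k'I (fun i => kz _) _); last by lia.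
apply: mx_subst_ind => // [i|l nl]; last by apply: mx_subst_out => i; apply: nl.
case: (split_ordP i) => j ->; rewrite big_split_ord /=; last first.
  rewrite big1 ?add0r => [|l _]; last by rewrite block_mxEdl mxE act0l.
  by rewrite mx_substE //; apply: eq_bigr => l _; rewrite block_mxEdr.
rewrite [X in _ + X]big1 ?addr0 => [|l _]; last by rewrite block_mxEur mxE act0l.
rewrite (bigD1 j) //= block_mxEul mxE eqxx act1l big1 ?addr0 => [|l lj].
  by apply: mx_subst_out => l; rewrite (inj_eq kI) eq_rlshift.
by rewrite block_mxEul mxE eq_sym (negPf lj) act0l.
Qed.

(** The product of such matrices adds the blocks [X], so it is enough to treat a single entry, which
    gives a transvection. *)
Lemma tame_mx_upper n m (X : 'M[S]_(n, m)) : tame_mx (block_mx 1%:M X 0 1%:M).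
Proof.
rewrite [X]matrix_sum_delta.
elim/big_ind: _ => [|X1 X2 H1 H2|i _]; first by rewrite -scalar_mx_block; apply: tame_mx1.
  have := tame_mx_mul H1 H2; rewrite mulmx_block !mul1mx !mulmx1 !mul0mx !mulmx0 !addr0 add0r.
  by rewrite addrC.
elim/big_ind: _ => [|X1 X2 H1 H2|j _]; first by rewrite -scalar_mx_block; apply: tame_mx1.
  have := tame_mx_mul H1 H2; rewrite mulmx_block !mul1mx !mulmx1 !mul0mx !mulmx0 !addr0 add0r.
  by rewrite addrC.
have := @tame_mx_transvection (n + m) (lshift m i) (rshift n j) (X i j); rewrite eq_lrshift => /(_ isT).
congr tame_mx; apply/matrixP => a b.
case: (split_ordP a) => a' ->; case: (split_ordP b) => b' ->;
  rewrite ?block_mxEul ?block_mxEur ?block_mxEdl ?block_mxEdr !mxE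
    ?eq_lshift ?eq_rshift ?eq_lrshift ?eq_rlshift ?andbF ?mulr0 ?addr0 ?add0r //.
Qed.

Lemma tame_mx_lower n m (X : 'M[S]_(m, n)) : tame_mx (block_mx (1%:M : 'M_n) 0 X 1%:M).
Proof.
rewrite [X]matrix_sum_delta.
elim/big_ind: _ => [|X1 X2 H1 H2|i _]; first by rewrite -scalar_mx_block; apply: tame_mx1.
  have := tame_mx_mul H1 H2; rewrite mulmx_block !mul1mx !mulmx1 !mul0mx !mulmx0 !addr0 add0r.
  done.
elim/big_ind: _ => [|X1 X2 H1 H2|j _]; first by rewrite -scalar_mx_block; apply: tame_mx1.
  have := tame_mx_mul H1 H2; rewrite mulmx_block !mul1mx !mulmx1 !mul0mx !mulmx0 !addr0 add0r.
  done.
have := @tame_mx_transvection (n + m) (rshift n i) (lshift m j) (X i j); rewrite eq_rlshift => /(_ isT).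
congr tame_mx; apply/matrixP => a b.
case: (split_ordP a) => a' ->; case: (split_ordP b) => b' ->;
  rewrite ?block_mxEul ?block_mxEur ?block_mxEdl ?block_mxEdr !mxE
    ?eq_lshift ?eq_rshift ?eq_lrshift ?eq_rlshift ?andbF ?mulr0 ?addr0 ?add0r //.
Qed.
End Linear.

(** * Euclidean reduction over [{poly F}] *)

Section Euclid.
Variable (F : fieldType).
Local Notation R := {poly F}.

(** Products of transvections, with the inverse product carried along since both are needed as tame
    factors. *)
Inductive elementary_mx n : 'M[R]_n -> 'M[R]_n -> Prop :=
| elementary_mx1 : elementary_mx 1%:M 1%:M
| elementary_mx_step i j c E E' : i != j -> elementary_mx E E' ->
    elementary_mx (E *m (1%:M + c *: delta_mx i j)) ((1%:M - c *: delta_mx i j) *m E').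

Lemma transvectionV n (i j : 'I_n) (c : R) : i != j ->
  (1%:M + c *: delta_mx i j) *m (1%:M - c *: delta_mx i j) = 1%:M.
Proof.
move=> ij; rewrite mulmxBr mulmx1 mulmxDl mul1mx -scalemxAl -scalemxAr mul_delta_mx_cond.
by rewrite eq_sym (negPf ij) mulr0n !scaler0 addr0 addrK.
Qed.

Lemma elementary_mx_inv n (E E' : 'M[R]_n) : elementary_mx E E' -> E *m E' = 1%:M.
Proof.
elim=> [|i j c {}E {}E' ij _ EE]; first by rewrite mulmx1.
by rewrite mulmxA -(mulmxA E) transvectionV // mulmx1.
Qed.

Lemma elementary_mx_mul n (E E' D D' : 'M[R]_n) : elementary_mx E E' -> elementary_mx D D' -> elementary_mx (E *m D) (D' *m E').
Proof.
move=> HE; elim=> [|i j c {}D {}D' ij _ IH]; first by rewrite mulmx1 mul1mx.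
by rewrite (mulmxA E) -(mulmxA (_ - _)); apply: elementary_mx_step.
Qed.

Lemma elementary_mx_transvection n (i j : 'I_n) c : i != j ->
  elementary_mx (1%:M + c *: delta_mx i j) (1%:M - c *: delta_mx i j).
Proof. by move=> ij; have := elementary_mx_step c ij (elementary_mx1 n); rewrite mul1mx mulmx1. Qed.

Lemma row_transvection n (v : 'rV[R]_n) i j c l :
  (v *m (1%:M + c *: delta_mx i j)) 0 l = v 0 l + c * v 0 i *+ (l == j).
Proof.
rewrite mulmxDr mulmx1 -scalemxAr !mxE; congr (_ + _).
rewrite (bigD1 i) //= big1 => [|k ki]; last by rewrite mxE (negPf ki) mulr0.
by rewrite mxE eqxx /= addr0 -mulrnAr mulr_natr.
Qed.

(** Replacing an entry by its remainder modulo a nonzero entry of at most the same size lowers the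
    sum of the sizes. This continues until at most one nonzero entry is left. *)
Lemma euclid_row n (v : 'rV[R]_n.+1) : exists E E' g, elementary_mx E E' /\ v *m E = g *: delta_mx 0 0.
Proof.
have [k] := ubnP (\sum_j size (v 0%R j))%N; elim: k v => // k IH v /ltnSE vk.
have step i j : i != j -> v 0 i != 0 -> v 0 j != 0 -> (size (v 0%R i) <= size (v 0%R j))%N ->
    exists E E' g, elementary_mx E E' /\ v *m E = g *: delta_mx 0 0.
  move=> ij vi vj ij'; pose D := 1%:M + - (v 0 j %/ v 0 i) *: delta_mx i j.
  have [|E [E' [g [HE gE]]]] := IH (v *m D).
    apply: leq_trans vk; rewrite [X in (_ < X)%N](bigD1 j) // [X in (X < _)%N](bigD1 j) //=.
    rewrite -addSn; apply: leq_add.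
      rewrite row_transvection eqxx mulr1n mulNr.
      rewrite [X in X - _](divp_eq (v 0 j) (v 0 i)) addrC addKr.
      by apply: leq_trans ij'; rewrite ltn_modp.
    apply: leq_sum => l lj; by rewrite row_transvection (negPf lj) mulr0n addr0.
  exists (D *m E), (E' *m (1%:M - - (v 0 j %/ v 0 i) *: delta_mx i j)), g; split.
    by apply: elementary_mx_mul => //; apply: elementary_mx_transvection.
  by rewrite mulmxA.
case: (pickP (fun ij => [&& ij.1 != ij.2, v 0 ij.1 != 0 & v 0 ij.2 != 0])) => [[i j] /and3P[]|no].
  move=> /= ij vi vj; case/orP: (leq_total (size (v 0 i)) (size (v 0 j))); first exact: step.
  by apply: step => //; rewrite eq_sym.
case: (pickP (fun i => v 0 i != 0)) => [i vi|v0]; last first.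
  exists 1%:M, 1%:M, 0; split; first exact: elementary_mx1.
  by rewrite mulmx1 scale0r; apply/rowP => l; rewrite mxE; have /negbFE/eqP := v0 l.
have vj j : j != i -> v 0 j = 0.
  by move=> ji; have /= := no (j, i); rewrite ji vi andbT => /negbFE/eqP.
case: (eqVneq i 0) => [i0|i0].
  exists 1%:M, 1%:M, (v 0 i); split; first exact: elementary_mx1.
  rewrite mulmx1; apply/rowP => l; rewrite !mxE eqxx /= -i0.
  by case: (eqVneq l i) => [->|/vj ->]; rewrite ?mulr1 ?mulr0.
have i0' : 0 != i by rewrite eq_sym.
(* Moves the only nonzero entry to column 0: column [i] is added to column 0, then column 0 is
   subtracted from column [i]. *)
exists ((1%:M + 1 *: delta_mx i 0) *m (1%:M + - 1 *: delta_mx 0 i)).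
exists ((1%:M - - 1 *: delta_mx 0 i) *m (1%:M - 1 *: delta_mx i 0)), (v 0 i); split.
  by apply: elementary_mx_mul; apply: elementary_mx_transvection.
apply/rowP => l; rewrite mulmxA !row_transvection !mxE !eqxx /= (vj 0) // add0r mulr1n !mul1r.
rewrite mulN1r; case: (eqVneq l 0) => [->|l0].
  by rewrite (negPf i0') (vj 0) // mulr0n mulr1n addr0 add0r mulr1.
rewrite mulr0n addr0 mulr0; case: (eqVneq l i) => [->|/vj ->]; first by rewrite mulr1n subrr.
by rewrite mulr0n addr0.
Qed.
End Euclid.

Section Whitehead.
Variable (F : fieldType).
Local Notation R := {poly F}.
Local Notation S := {poly R}.
Local Notation lift := (map_mx polyC).

Lemma lift_transvection n (i j : 'I_n) (c : R) :
  lift (1%:M + c *: delta_mx i j) = 1%:M + c%:P *: delta_mx i j.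
Proof. by rewrite map_mxD map_mx1 map_mxZ map_delta_mx. Qed.

Lemma tame_mx_GE n (E E' : 'M[R]_n) : elementary_mx E E' -> tame_mx (lift E) /\ tame_mx (lift E').
Proof.
elim=> [|i j c {}E {}E' ij _ [PE PE']]; first by rewrite map_mx1; split; apply: tame_mx1.
rewrite !map_mxM -scaleNr !lift_transvection.
by split; apply: tame_mx_mul => //; apply: tame_mx_transvection.
Qed.

(** Column operations bring the first row to [(g, 0, ..., 0)], and [g] is a unit, hence a nonzero
    constant of [F]. What remains is a lower unitriangular block matrix, a scaling and a smaller
    invertible matrix. *)
Lemma tame_mx_base n (M : 'M[R]_n) : M \in unitmx -> tame_mx (lift M).
Proof.
elim: n M => [|n IH] M uM.
  by have -> : lift M = 1%:M; [apply/matrixP => -[] | apply: tame_mx1].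
have [E [E' [g [HE gE]]]] := euclid_row (row 0 M).
have [PE PE'] := tame_mx_GE HE; have EE := elementary_mx_inv HE.
have [M' EM'] : {M' : 'M[R]_(1 + n) | M' = M *m E} by exists (M *m E).
have uM' : M' \in unitmx by rewrite EM' unitmx_mul uM; case: (mulmx1_unit EE).
have rM' (j : 'I_(1 + n)) : M' (lshift n (0 : 'I_1)) j = g * (j == lshift n (0 : 'I_1))%:R.
  have l0 : lshift n (0 : 'I_1) = 0 :> 'I_n.+1 by apply: val_inj.
  have := congr1 (fun u : 'rV_n.+1 => u 0 j) gE; rewrite -row_mul -EM' l0 !mxE.
  by [].
have M'E : M' = block_mx g%:M 0 (dlsubmx M') (drsubmx M').
  rewrite -[LHS]submxK; congr block_mx; apply/matrixP => i j; rewrite !mxE ord1 rM'.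
    by rewrite ord1 eqxx mulr1.
  by rewrite eq_rlshift mulr0.
set C := dlsubmx M' in M'E; set M2 := drsubmx M' in M'E.
have := uM'; rewrite unitmxE M'E det_lblock det_scalar1 unitrM => /andP[ug uM2].
have PM2 := tame_mx_ext 1 (IH M2 uM2).
have PC := @tame_mx_lower _ 1 n (lift (C *m (g^-1)%:M)).
have Pg : tame_mx (block_mx (g%:P)%:M 0 0 1%:M : 'M[S]_(1 + n)).
  have /andP[/size_poly1P[c c0 gc] _] := ug; have := @tame_mx_scaling F (1 + n) (lshift n (0 : 'I_1)) c c0.
  congr tame_mx; apply/matrixP => i j; case: (split_ordP i) => i' ->; case: (split_ordP j) => j' ->.
  - rewrite block_mxEul !mxE !ord1 eqxx gc.
    by rewrite mulr1 !rmorphB /= !polyC1 addrC subrK.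
  - by rewrite block_mxEur !mxE eq_lrshift eq_rlshift andbF mulr0 addr0.
  - by rewrite block_mxEdl !mxE eq_rlshift mulr0 addr0.
  by rewrite block_mxEdr !mxE eq_rshift eq_rlshift mulr0 addr0.
have -> : M = M' *m E' by rewrite EM' -mulmxA EE mulmx1.
rewrite map_mxM; apply: tame_mx_mul PE'.
have -> : lift M' = block_mx 1%:M 0 (lift (C *m (g^-1)%:M)) 1%:M *m
    (block_mx (g%:P)%:M 0 0 1%:M *m block_mx 1%:M 0 0 (lift M2)).
  rewrite !mulmx_block !(mul1mx, mulmx1, mul0mx, mulmx0, addr0, add0r).
  rewrite M'E map_block_mx map_mx0 map_scalar_mx; congr block_mx.
  rewrite -map_scalar_mx -map_mxM -mulmxA -scalar_mxM mulVr //.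
  by rewrite mulmx1.
exact: tame_mx_mul PC (tame_mx_mul Pg PM2).
Qed.
End Whitehead.

Lemma leq_sum_entry a b (f : 'I_a -> 'I_b -> nat) i j :
  (f i j <= \sum_i \sum_j f i j)%N.
Proof.
rewrite (bigD1 i) //=; apply: leq_trans (leq_addr _ _).
by rewrite (bigD1 j) //= leq_addr.
Qed.

(** * Higman's linearization *)

Section Higman.
Variable (F : fieldType).
Local Notation R := {poly F}.
Local Notation S := {poly R}.
Local Notation lift := (map_mx polyC).

(* The coefficients of the inverse of 1 + N 'X are the powers of - N. *)
Lemma unipotent_det0 (D : idomainType) n (N : 'M[D]_n.+1) :
  1%:M + 'X *: map_mx polyC N \in unitmx -> \det N = 0.
Proof.
move=> uN; pose B : 'M[{poly D}]_n.+1 := invmx (1%:M + 'X *: map_mx polyC N).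
pose C k := map_mx (coefp k) B.
have E : B + 'X *: (map_mx polyC N *m B) = 1%:M.
  by rewrite scalemxAl -[X in X + _]mul1mx -mulmxDl mulmxV.
have C0 : C 0%N = 1%:M.
  apply/matrixP => i j; have := congr1 (fun A : 'M[{poly D}]_n.+1 => (A i j)`_0) E.
  by rewrite !mxE coefD coefXM addr0 /= => ->; case: (i == j); rewrite ?coef1 ?coef0.
have CS k : C k.+1 = - N *m C k.
  apply/matrixP => i j; have := congr1 (fun A : 'M[{poly D}]_n.+1 => (A i j)`_k.+1) E.
  rewrite !mxE coefD coefXM /= coef_sum => /eqP.
  have -> : ((i == j)%:R : {poly D})`_k.+1 = 0 by case: (i == j); rewrite ?coef1 ?coef0.
  rewrite addr_eq0 => /eqP ->; rewrite -sumrN; apply: eq_bigr => l _.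
  by rewrite !mxE coefCM mulNr.
have CD k : \det (C k) = \det (- N) ^+ k.
  by elim: k => [|k IH]; rewrite ?C0 ?det1 // CS det_mulmx IH exprS.
pose k := (\sum_i \sum_j size (B i j))%N.
have Ck : C k = 0.
  apply/matrixP => i j; rewrite !mxE; apply: nth_default.
  exact: (leq_sum_entry (fun i j => size (B i j))).
have := CD k; rewrite Ck det0 => /esym/eqP; rewrite expf_eq0 => /andP[_].
by rewrite -scaleN1r detZ mulf_eq0 expf_eq0 oppr_eq0 oner_eq0 andbF => /eqP.
Qed.

(** A nonzero row [v] is killed by the singular matrix [N]. Conjugation by the elementary matrix
    that takes [v] to a multiple of the first basis row makes the first row of [N] zero, and a
    smaller matrix of the same kind splits off. *)
Lemma tame_mx_unipotent n (N : 'M[R]_n) : 1%:M + 'X *: lift N \in unitmx -> tame_mx (1%:M + 'X *: lift N).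
Proof.
elim: n N => [|n IH] N uN.
  by have -> : 1%:M + 'X *: lift N = 1%:M; [apply/matrixP => -[] | apply: tame_mx1].
have /eqP/det0P[v v0 vN] := unipotent_det0 uN.
have [E [E' [g [HE gE]]]] := euclid_row v.
have [PE PE'] := tame_mx_GE HE; have EE := elementary_mx_inv HE; have [uE uE'] := mulmx1_unit EE.
have E'E := mulmx1C EE.
have g0 : g != 0.
  apply: contraNneq v0 => g0; move: gE; rewrite g0 scale0r => vE.
  by rewrite -[v]mulmx1 -EE mulmxA vE mul0mx.
have [N' EN'] : {N' : 'M[R]_(1 + n) | N' = E' *m N *m E} by exists (E' *m N *m E).
have rN' (j : 'I_(1 + n)) : N' (lshift n (0 : 'I_1)) j = 0.
  have l0 : lshift n (0 : 'I_1) = 0 :> 'I_n.+1 by apply: val_inj.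
  have E0 : g *: row 0 N' = 0.
    rewrite EN' rowE scalemxAl -gE mulmxA mulmxA -(mulmxA v) EE mulmx1 vN.
    by rewrite mul0mx.
  have := congr1 (fun u : 'rV_n.+1 => u 0 j) E0; rewrite l0 !mxE => /eqP.
  by rewrite mulf_eq0 (negPf g0) => /eqP.
have N'E : N' = block_mx 0 0 (dlsubmx N') (drsubmx N').
  by rewrite -[LHS]submxK; congr block_mx; apply/matrixP => i j; rewrite !mxE ord1 rN'.
set C := dlsubmx N' in N'E; set N2 := drsubmx N' in N'E.
have NE : 1%:M + 'X *: lift N = lift E *m (1%:M + 'X *: lift N') *m lift E'.
  rewrite EN' mulmxDr mulmxDl mulmx1 -map_mxM EE map_mx1 -scalemxAr -scalemxAl -!map_mxM.
  by rewrite !mulmxA EE mul1mx -mulmxA EE mulmx1.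
have N'B : 1%:M + 'X *: lift N' =
    block_mx 1%:M 0 ('X *: lift C) 1%:M *m block_mx 1%:M 0 0 (1%:M + 'X *: lift N2).
  rewrite mulmx_block !(mul1mx, mulmx1, mul0mx, mulmx0, addr0, add0r).
  rewrite N'E map_block_mx scale_block_mx scalar_mx_block add_block_mx !map_mx0.
  by rewrite !scaler0 !addr0 add0r.
have uN2 : 1%:M + 'X *: lift N2 \in unitmx.
  move: uN; rewrite NE N'B !unitmx_mul => /andP[/andP[_ /andP[_ u]] _].
  by move: u; rewrite !unitmxE (@det_ublock _ 1 n) det1 mul1r.
rewrite NE; apply: tame_mx_mul PE'; apply: tame_mx_mul PE _.
rewrite N'B; exact: tame_mx_mul (@tame_mx_lower F 1 n _) (tame_mx_ext 1 (IH _ uN2)).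
Qed.

(** The bound [d.+2] on sizes means degree at most [d + 1] in the outer variable. In degree at most
    1 the constant term [M0] is the value of [M] at 0, hence invertible, and dividing by it leaves
    the case of [tame_mx_unipotent]. *)
Lemma tame_mx_unitmx n (M : 'M[S]_n) : M \in unitmx -> tame_mx M.
Proof.
move=> uM; have [d Hd] : exists d, forall i j, (size (M i j) <= d.+2)%N.
  exists (\sum_i \sum_j size (M i j))%N => i j.
  have := leq_sum_entry (fun i j => size (M i j)) i j; lia.
elim: d n M uM Hd => [|d IH] n M uM Hd.
  pose M0 := map_mx (coefp 0) M; pose M1 := map_mx (coefp 1) M.
  have ME : M = lift M0 + 'X *: lift M1.
    apply/matrixP => i j; rewrite !mxE /=; apply/polyP => -[|[|k]].
    - by rewrite coefD coefC coefXM addr0.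
    - by rewrite coefD coefC coefXM coefC add0r.
    rewrite coefD coefC coefXM coefC addr0; apply: nth_default.
    exact: leq_trans (Hd i j) _.
  have uM0 : M0 \in unitmx.
    have -> : M0 = map_mx (horner_eval 0) M.
      by apply/matrixP => i j; rewrite !mxE /= /horner_eval horner_coef0.
    by move: uM; rewrite !unitmxE det_map_mx => /(rmorph_unit (horner_eval 0)).
  have ME' : M = lift M0 *m (1%:M + 'X *: lift (invmx M0 *m M1)).
    by rewrite mulmxDr mulmx1 -scalemxAr -map_mxM mulmxA mulmxV // mul1mx.
  rewrite ME'; apply: tame_mx_mul; first exact: tame_mx_base.
  by apply: tame_mx_unipotent; move: uM; rewrite ME' unitmx_mul => /andP[].
(* Higman's trick: doubling the size lowers the degree in the outer variable. *)
pose A := lift (map_mx (coefp d.+2) M); pose M0 := M - 'X^(d.+2) *: A.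
pose M' := block_mx M0 ('X *: 1%:M) (- ('X^(d.+1) *: A)) (1%:M : 'M_n).
have MM' : block_mx M 0 0 (1%:M : 'M_n) = block_mx 1%:M (- ('X *: 1%:M)) 0 1%:M *m M' *m
    block_mx 1%:M 0 ('X^(d.+1) *: A) 1%:M.
  rewrite !mulmx_block !(mul1mx, mulmx1, mul0mx, mulmx0, addr0, add0r).
  rewrite mulNmx mulmxN opprK -scalemxAl mul1mx scalerA -exprS subrK.
  by rewrite subrr mul0mx addr0 addNr.
have uM' : M' \in unitmx.
  have : block_mx M 0 0 (1%:M : 'M_n) \in unitmx by rewrite unitmxE det_ublock det1 mulr1.
  by rewrite MM' !unitmx_mul => /andP[/andP[_ ->]].
apply: (@tame_mx_stab F n n); rewrite MM'; apply: tame_mx_mul (tame_mx_lower _); apply: tame_mx_mul; first exact: tame_mx_upper.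
apply: IH uM' _ => i j.
have sA k a b : (size (('X^k *: A) a b) <= k.+1)%N.
  rewrite !mxE; apply: leq_trans (size_polyMleq _ _) _.
  by rewrite size_polyXn size_polyC; case: (_ != 0); rewrite ?addn0 ?addn1.
case: (split_ordP i) => i' ->; case: (split_ordP j) => j' ->.
- rewrite block_mxEul; apply/leq_sizeP => k; rewrite leq_eqVlt => /orP[/eqP <-|lk].
    by rewrite !mxE coefB coefXnM ltnn subnn coefC subrr.
  have -> : M0 i' j' = M i' j' - ('X^(d.+2) *: A) i' j' by rewrite [LHS]mxE [X in _ + X]mxE.
  by rewrite coefB !nth_default ?subr0 ?(leq_trans (Hd _ _)) ?(leq_trans (sA _ _ _)).
- rewrite block_mxEur !mxE; case: (i' == j'); rewrite ?mulr1 ?mulr0 ?size_poly0 //.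
  by rewrite size_polyX.
- by rewrite block_mxEdl mxE size_polyN.
by rewrite block_mxEdr mxE; case: (i' == j'); rewrite ?size_poly1 ?size_poly0.
Qed.
End Higman.

(** * Stable tameness *)

Lemma sub3_comp (R : comNzRingType) n (z : 'I_n) (u v : FA R n) a b Z :
  sub3 z u v (sub3 x2 a b Z) = sub3 z (sub3 z u v a) (sub3 z u v b) Z.
Proof. exact: gev_sub3. Qed.

Section Affine.
Variables (F : fieldType) (Q : realFieldType).
Local Notation S := {poly {poly F}}.
Local Notation w3 := (w3 Q).
Implicit Types (f g : FA F 3) (M : 'M[S]_2).

Definition lin M (i : 'I_2) : FA F 3 := \sum_j act x2 (M i j) (lett (lshift 1 j)).

Lemma linE M i : lin M i = act x2 (M i 0) (lett x0) + act x2 (M i 1) (lett x1).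
Proof.
by rewrite /lin !big_ord_recl big_ord0 addr0; congr (act _ (M _ _) (lett _) + act _ (M _ _) (lett _));
  apply: val_inj.
Qed.

Lemma w3_Hom0 f : Hom w3 0 f -> exists c, f = zp x2 c.
Proof.
have wpos (l : 'I_3) : predT l -> l != x2 -> 0 < w3 l by move: l; apply: ord3P => //=.
by move=> Hf; apply: (Hom0_zp (L := predT) _ wpos _ Hf) => // s _; apply: all_predT.
Qed.

Lemma w3_Hom1 f : Hom w3 1 f ->
  exists p q, f = act x2 p (lett x0) + act x2 q (lett x1).
Proof.
move: f; apply: fa_suppind => [|f g [p [q ->]] [p' [q' ->]]|c s s1].
- by exists 0, 0; rewrite !act0l addr0.
- by exists (p + p'), (q + q'); rewrite !actDl addrACA.
suff [p [q ->]] : exists p q, mon F s = act x2 p (lett x0) + act x2 q (lett x1).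
  by exists (c%:P%:P * p), (c%:P%:P * q); rewrite !actM !actCCl scalerDr.
have E0 t : 1 + wtw w3 t = 1 -> exists d, mon F t = zp x2 d.
  move=> t0; apply: w3_Hom0; apply: supp_mon.
  by apply: (addrI 1); rewrite t0 addr0.
elim: s s1 => [|l s IH]; first by rewrite /wtw big_nil => /eqP; rewrite eq_sym oner_eq0.
rewrite /wtw big_cons mon_cons; move: l; apply: ord3P => /=.
- by move/E0 => [d ->]; exists d%:P, 0; rewrite act0l addr0 actCl.
- by move/E0 => [d ->]; exists 0, d%:P; rewrite act0l add0r actCl.
rewrite add0r => /IH[p [q ->]]; exists ('X * p), ('X * q).
by rewrite !actM !actX mulrDr.
Qed.

Lemma act_lett_inj (p q : S) :
  act x2 p (lett x0) + act x2 q (lett x1) = 0 :> FA F 3 -> p = 0 /\ q = 0.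
Proof.
move=> E; have D j : j != x2 -> zp x2 p * (x0 == j)%:R + zp x2 q * (x1 == j)%:R = 0 :> FA {poly F} 3.
  by move=> j2; rewrite -!fox_act_lett // -foxD -bcD E bc0 fox0.
have := D x0 isT; rewrite eqxx mulr1 mulr0 addr0 => /zp_eq0 ->.
by have := D x1 isT; rewrite eqxx mulr1 mulr0 add0r => /zp_eq0 ->.
Qed.

Lemma lin_inj M N : (forall i, lin M i = lin N i) -> M = N.
Proof.
move=> E; apply/matrixP => i j; have := E i; rewrite !linE => /eqP.
rewrite -subr_eq0 opprD addrACA -!actBl => /eqP/act_lett_inj[/eqP + /eqP].
rewrite !subr_eq0 => /eqP E0 /eqP E1.
by case: (@split_ordP 1 1 j) => j' ->; rewrite ord1;
  [rewrite (_ : lshift 1 0 = 0)|rewrite (_ : rshift 1 0 = 1)]; rewrite ?E0 ?E1 //; apply: val_inj.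
Qed.

Lemma Fil1_affine f : Fil w3 1 f -> exists c, f = comp w3 1 f + zp x2 c.
Proof.
move=> Ff; suff [c Ec] : exists c, f - comp w3 1 f = zp x2 c.
  by exists c; rewrite -Ec addrC subrK.
have H1 : Hom w3 1 (comp w3 1 f) by apply: Hom_comp.
apply: w3_Hom0; have : Fil w3 0%:R (f - comp w3 1 f).
  apply/Fil_lt_nat/Fil_lt; first by apply: FilB => //; apply: HomFil.
  by rewrite compB (comp_id H1) subrr.
by apply: suppW => s s0; apply/eqP; rewrite eq_le w3_ge0 andbT.
Qed.

Lemma stable_pair_lin M : M \in unitmx -> stable_pair (lin M 0) (lin M 1).
Proof.
move/tame_mx_unitmx => [m0 H]; exists m0 => m mm.
pose k (j : 'I_2) := lshift m (lshift 1 j : 'I_3).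
have kI : injective k by move=> i j /(congr1 val)/= /val_inj.
have kz i : k i != lshift m x2.
  by rewrite eq_lshift; case: i => -[|[|]].
apply: eq_tame_subst (H (3 + m)%N (lshift m x2) k kI kz _); last by lia.
move=> l; apply/esym; move: l; apply: mx_subst_ind => // [i|l nl].
  rewrite stab_substL (_ : sel3 _ _ _ _ = lin M i); last first.
    by case: (@split_ordP 1 1 i) => j ->; rewrite ord1 /=; congr lin; apply: val_inj.
  rewrite /incl /lin gev_sum; apply: eq_bigr => j _.
  by rewrite (act_gev (z' := lshift m x2)) // gevX.
case: (split_ordP l) nl => i -> nl; rewrite ?stab_substR // stab_substL.
move: i nl; apply: ord3P => nl; last by rewrite /= /incl gevX.
- by have := nl 0; rewrite eq_lshift; case/negP; apply/eqP/val_inj.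
by have := nl 1; rewrite eq_lshift; case/negP; apply/eqP/val_inj.
Qed.

Lemma stable_pair_transl (c d : {poly F}) : stable_pair (lett x0 + zp x2 c) (lett x1 + zp x2 d).
Proof.
exists 0%N => m _; pose X := lshift m x0; pose Y := lshift m x1; pose Z := lshift m x2.
have T1 : tame_subst (elem_subst X 1 (zp Z c)) by apply: tame_elem_subst; [apply: oner_neq0 | apply: lfree_zp].
have T2 : tame_subst (elem_subst Y 1 (zp Z d)) by apply: tame_elem_subst; [apply: oner_neq0 | apply: lfree_zp].
have E1 (i : 'I_(3 + m)) (t : FA F (3 + m)) : elem_subst i 1 t i = lett i + t by rewrite /elem_subst eqxx scale1r.
have E2 (i l : 'I_(3 + m)) (t : FA F (3 + m)) : l != i -> elem_subst i 1 t l = lett l.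
  by rewrite /elem_subst => /negPf ->.
apply: eq_tame_subst (tame_subst_comp T1 T2) => l; case: (split_ordP l) => i ->; rewrite ?stab_substR ?stab_substL; last first.
  by rewrite E2 ?eq_rlshift // gevX E2 ?eq_rlshift.
move: i; apply: ord3P; rewrite /= /incl ?gevD gevX ?(gevz_zp (z' := Z)) //.
- by rewrite E2 // gevX E1.
  by rewrite scale1r gevX E2.
by rewrite gevX.
Qed.

Lemma lin_pair f g : Hom w3 1 f -> Hom w3 1 g -> exists M, lin M 0 = f /\ lin M 1 = g.
Proof.
move=> /w3_Hom1[p [q ->]] /w3_Hom1[r [s ->]].
exists (\matrix_(i, j) if i == 0 then if j == 0 then p else q else if j == 0 then r else s).
by rewrite !linE !mxE.
Qed.

Lemma lin1 i : lin 1%:M i = lett (lshift 1 i : 'I_3).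
Proof.
rewrite /lin (bigD1 i) //= mxE eqxx act1l big1 ?addr0 // => j ji.
by rewrite mxE eq_sym (negPf ji) act0l.
Qed.

Lemma sub3_lin M N i : sub3 x2 (lin N 0) (lin N 1) (lin M i) = lin (M *m N) i.
Proof.
rewrite (linE M) sub3D !sub3_act /sub3 !gevX /= !linE !actD -!actM !mxE.
rewrite !big_ord_recl !big_ord0 !addr0 !actDl.
by have -> : lift 0 0 = 1 :> 'I_2; [apply: val_inj | rewrite addrACA].
Qed.

(** Taking the parts of weight 1 in [f(P1, P2) = x] and [g(P1, P2) = y] shows that the matrix of the
    linear parts of [f], [g] is invertible, whatever the degrees of [P1] and [P2]. *)
Lemma stable_pair_affine f g P1 P2 :
  inverse_pair f g P1 P2 -> Fil w3 1 f -> Fil w3 1 g -> stable_pair f g.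
Proof.
move=> [_ _ Pf Pg] Ff Fg.
have H1 u : Hom w3 1 (comp w3 1 (u : FA F 3)) by apply: Hom_comp.
have [M [Mf Mg]] := lin_pair (H1 f) (H1 g); have [N [N1 N2]] := lin_pair (H1 P1) (H1 P2).
have [c Ef] := Fil1_affine Ff; have [d Eg] := Fil1_affine Fg.
have key (i : 'I_2) (u : FA F 3) b : sub3 x2 P1 P2 u = lett (lshift 1 i : 'I_3) -> u = lin M i + zp x2 b ->
    lin (M *m N) i = lin 1%:M i.
  move=> Pu uE; have Hl : Hom w3 1 (lett (lshift 1 i : 'I_3) : FA F 3).
    have HX (l : 'I_3) : l != x2 -> Hom w3 1 (lett l : FA F 3).
      move: l; apply: ord3P => // _; first exact: (HomX _ (l := x0)).
      exact: (HomX _ (l := x1)).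
    by apply: HX; case: i Pu uE => -[|[|]].
  have H0 : Hom w3 0 (zp x2 b : FA F 3) by apply: Hom_zp.
  rewrite lin1 -(comp_id Hl) -Pu uE sub3D compD {2}/sub3 (gevz_zp (z' := x2)) //.
  rewrite (comp_ne H0) ?addr0; last by apply/eqP; rewrite eq_sym oner_neq0.
  rewrite -sub3_lin N1 N2 linE !sub3D !sub3_act /sub3 !gevX /= compD.
  by rewrite !act_comp.
have x0E : lshift 1 (0 : 'I_2) = x0 :> 'I_3 by apply: val_inj.
have x1E : lshift 1 (1 : 'I_2) = x1 :> 'I_3 by apply: val_inj.
have MN : M *m N = 1%:M.
  apply: lin_inj => i; case: (@split_ordP 1 1 i) => j ->; rewrite ord1.
    rewrite (_ : lshift 1 0 = 0); last exact: val_inj.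
    by apply: (key _ f c); [rewrite x0E | rewrite Mf].
  rewrite (_ : rshift 1 0 = 1); last exact: val_inj.
  by apply: (key _ g d); [rewrite x1E | rewrite Mg].
have [uM _] := mulmx1_unit MN.
have := stable_pair_comp (stable_pair_lin uM) (stable_pair_transl c d).
rewrite !sub3D /sub3 !gevX !(gevz_zp (z' := x2)) //=.
by rewrite Mf Mg -Ef -Eg.
Qed.

(** The invariance of [T] gives it the same value at the reduced pair as at [(f, g)]. Hence [(f, g)]
    is the reduced pair composed with the translation [t], and [(t P1, t P2)] is the inverse of the
    reduced pair. *)
Lemma inverse_pair_stable k f g P1 P2 :
  inverse_pair f g P1 P2 -> Fil w3 k%:R f -> Fil w3 k%:R g -> stable_pair f g.
Proof.
elim: k f g P1 P2 => [|[|k] IH] f g P1 P2 iv Ff Fg.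
- have F01 u : Fil w3 0%:R (u : FA F 3) -> Fil w3 1 u.
    by apply: suppW => s s0; apply: le_trans s0 ler01.
  exact: stable_pair_affine iv (F01 _ Ff) (F01 _ Fg).
- exact: stable_pair_affine iv Ff Fg.
have [p [q [T [Tinv Ff1 Fg1]]]] := reduction iv Ff Fg.
set f1 := f - _ in Ff1; set g1 := g - _ in Fg1.
pose t : FA F 3 -> FA F 3 := sub3 x2 (lett x0 + act x2 p T) (lett x1 + act x2 q T).
have f1T : sub3 x2 f1 g1 T = sub3 x2 f g T.
  by rewrite /f1 /g1 -!actN; apply: Tinv.
have tau u : sub3 x2 f1 g1 (t u) = sub3 x2 f g u.
  rewrite /t sub3_comp !sub3D !sub3_act f1T.
  by rewrite /sub3 !gevX /= !subrK.
have tT : t T = T by rewrite /t Tinv sub3_id.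
have [fP1 fP2 Pf Pg] := iv.
have ft : sub3 x2 (t P1) (t P2) f = lett x0 + act x2 p T.
  by rewrite /t -sub3_comp Pf /sub3 gevX.
have gt : sub3 x2 (t P1) (t P2) g = lett x1 + act x2 q T.
  by rewrite /t -sub3_comp Pg /sub3 gevX.
have Tt : sub3 x2 (t P1) (t P2) (sub3 x2 f g T) = T.
  by rewrite sub3_comp ft gt.
have iv1 : inverse_pair f1 g1 (t P1) (t P2).
  split; rewrite ?tau // sub3B sub3_act Tt ?ft ?gt; exact: addrK.
have := stable_pair_comp (IH _ _ _ _ iv1 Ff1 Fg1) (stable_pair_tau Tinv).
rewrite !sub3D !sub3_act f1T /sub3 !gevX /=.
by rewrite /f1 /g1 /sub3 !subrK.
Qed.
End Affine.

(** * Return to the concrete free algebra *)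

Section Transfer.
Variable F : fieldType.

Definition to_malg n : FA F n -> free_algebra F n := lext (fun s => \prod_(i <- s) fvar i).
Definition of_malg n (u : free_algebra F n) : FA F n :=
  \sum_(s <- malg_supp u) u@_(FMonom s) *: mon F s.

Lemma to_malgD n (u v : FA F n) : to_malg (u + v) = to_malg u + to_malg v. Proof. exact: lextD. Qed.
Lemma to_malgZ n c (u : FA F n) : to_malg (c *: u) = c *: to_malg u. Proof. exact: lextZ. Qed.
Lemma to_malg0 n : to_malg (0 : FA F n) = 0. Proof. exact: lext0. Qed.

Lemma to_malg_mon n (s : seq 'I_n) : to_malg (mon F s) = << FMonom s >>.
Proof.
rewrite /to_malg lext_mon; elim: s => [|i s IH]; first by rewrite big_nil malg_mon1.
by rewrite big_cons IH -[i :: s]/([:: i] ++ s) malg_monM; congr (_ * _);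
  congr << _ >>; apply: fmonom_val_inj; rewrite fmU.
Qed.

Lemma cf_to_malg n (u : FA F n) w : (to_malg u)@_w = cf (fmonom_val w) u.
Proof.
move: u; apply: fa_ind => [|u v Hu Hv|c s]; first by rewrite to_malg0 cf0 mcoeff0.
  by rewrite to_malgD mcoeffD cfD Hu Hv.
by rewrite to_malgZ to_malg_mon mcoeffZ mcoeffU cfZ cf_mon; congr (_ * _%:R).
Qed.

Lemma to_malg_inj n : injective (@to_malg n).
Proof. by move=> u v E; apply: fa_eq => s; rewrite -(cf_to_malg u (FMonom s)) E cf_to_malg. Qed.

Lemma of_malgK n : cancel (@of_malg n) (@to_malg n).
Proof.
move=> u; rewrite [RHS]malg_decomp /of_malg (big_morph (@to_malg n) (@to_malgD n) (to_malg0 n)).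
by apply: eq_bigr => s _; rewrite to_malgZ to_malg_mon.
Qed.

Lemma to_malg_lett n (i : 'I_n) : to_malg (lett i : FA F n) = fvar i.
Proof. by rewrite /to_malg lext_mon big_seq1. Qed.

Lemma to_malgM n (u v : FA F n) : to_malg (u * v) = to_malg u * to_malg v.
Proof.
move: u; apply: fa_ind => [|u u' Hu Hu'|c s]; first by rewrite mul0r to_malg0 mul0r.
  by rewrite mulrDl !to_malgD Hu Hu' mulrDl.
rewrite -scalerAl !to_malgZ -scalerAl; congr (_ *: _).
move: v; apply: fa_ind => [|v v' Hv Hv'|d t]; first by rewrite mulr0 to_malg0 mulr0.
  by rewrite mulrDr !to_malgD Hv Hv' mulrDr.
rewrite -fa_scaler -monM !to_malgZ -malg_scalerAr; congr (_ *: _).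
by rewrite /to_malg !lext_mon big_cat.
Qed.

Definition to_malgT n p (U : 'I_n -> FA F p) : n.-tuple (free_algebra F p) :=
  [tuple to_malg (U i) | i < n].

Lemma to_malg_gev n p (U : 'I_n -> FA F p) (u : FA F n) :
  fsubst (to_malgT U) (to_malg u) = to_malg (gev idfun U u).
Proof.
move: u; apply: fa_rind => [u v Hu Hv|c u Hu||u l Hu].
- by rewrite to_malgD raddfD gevD to_malgD /= Hu Hv.
- by rewrite to_malgZ linearZ gevZ to_malgZ /= Hu.
- by rewrite gev1 -!mon0 !to_malg_mon !malg_mon1 rmorph1.
by rewrite to_malgM rmorphM /= Hu gevM to_malgM to_malg_lett fsubstX tnth_mktuple gevX.
Qed.

Lemma automorphism_to_malg n (U U' : 'I_n -> FA F n) :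
    (forall i, gev idfun U (U' i) = lett i) -> (forall i, gev idfun U' (U i) = lett i) ->
  automorphism (to_malgT U).
Proof.
move=> UU' U'U; exists (fsubst (to_malgT U')) => u; rewrite -[u]of_malgK !to_malg_gev; congr to_malg.
  by rewrite (gev_comp (phi'' := idfun)) // (eq_gev _ U'U) gev_id.
by rewrite (gev_comp (phi'' := idfun)) // (eq_gev _ UU') gev_id.
Qed.

Lemma elem_subst_inv n (i : 'I_n) c (t : FA F n) : c != 0 -> lfree i t ->
  forall j, gev idfun (elem_subst i c t) (elem_subst i c^-1 (- (c^-1 *: t)) j) = lett j.
Proof.
move=> c0 ti j; have gt : gev idfun (elem_subst i c t) t = t.
  rewrite -[RHS]gev_id; apply: lfree_gev ti => l li; by rewrite /elem_subst (negPf li).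
rewrite {2}/elem_subst; case: (eqVneq j i) => [->|ji]; last by rewrite gevX /elem_subst (negPf ji).
rewrite gevD gevN !gevZ gevX gt /elem_subst eqxx /= scalerDr scalerA mulVf // scale1r.
by rewrite addrK.
Qed.

Lemma elementary_elem_subst n (i : 'I_n) c t : c != 0 -> lfree i t -> elementary (to_malgT (elem_subst i c t)).
Proof.
move=> c0 ti; split; last first.
  by exists i => j ji; rewrite tnth_mktuple /elem_subst (negPf ji) to_malg_lett.
apply: (automorphism_to_malg (U' := elem_subst i c^-1 (- (c^-1 *: t)))); first exact: elem_subst_inv.
move=> j; have := @elem_subst_inv n i c^-1 (- (c^-1 *: t)) _ _ j.
rewrite invrK invr_eq0 scalerN opprK scalerA mulfV // scale1r; apply=> //.
by apply: suppN; apply: suppZ.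
Qed.

Lemma tame_to_malg n (U : 'I_n -> FA F n) : tame_subst U -> tame (to_malgT U).
Proof.
elim=> {U} [U Uid|i c t U V c0 ti _ [s se sE] VE].
  exists [::] => // u; rewrite -[u]of_malgK to_malg_gev (eq_gev _ Uid) gev_id //.
exists (to_malgT (elem_subst i c t) :: s).
  by move=> e; rewrite inE => /orP[/eqP ->|/se //]; apply: elementary_elem_subst.
move=> u /=; rewrite -sE -[u]of_malgK !to_malg_gev (gev_comp (phi'' := idfun)) //; congr to_malg.
exact: eq_gev.
Qed.

Lemma Fil_exists (Q : realFieldType) (f : FA F 3) : exists k : nat, Fil (w3 Q) k%:R f.
Proof.
move: f; apply: fa_ind => [|f g [k Hf] [l Hg]|c s]; first by exists 0%N; apply: supp0.
  exists (maxn k l); apply: suppD.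
    by apply: suppW Hf => s sk; apply: le_trans sk _; rewrite ler_nat leq_maxl.
  by apply: suppW Hg => s sk; apply: le_trans sk _; rewrite ler_nat leq_maxr.
have [k E] := wtw3_nat Q s; exists k; apply: suppZ; apply: supp_mon.
by rewrite E.
Qed.
End Transfer.

Theorem theorem1p2 (F : fieldType) (f : free_algebra F 3) :
  z_coordinate f -> stably_tame_coordinate f.
Proof.
move=> /z_coordinateP[g aut]; exists [tuple g; fvar ord_max].
pose f' := of_malg f; pose g' := of_malg g.
have zE : ord_max = x2 by apply: val_inj.
have tE : [tuple f; g; fvar ord_max] = to_malgT (sel3 f' g' (lett x2)).
  apply: eq_from_tnth; apply: ord3P; rewrite tnth_mktuple /= ?of_malgK ?to_malg_lett -?zE //.
have -> : [tuple of f :: [tuple g; fvar ord_max]] = [tuple f; g; fvar ord_max].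
  exact: val_inj.
split=> //; have [psi psiK Kpsi] := aut.
have subE u : to_malg (sub3 x2 f' g' u) = fsubst [tuple f; g; fvar ord_max] (to_malg u).
  by rewrite tE to_malg_gev.
have subI u v : sub3 x2 f' g' u = sub3 x2 f' g' v -> u = v.
  by move/(congr1 (@to_malg _ _)); rewrite !subE => /(can_inj psiK)/to_malg_inj.
pose P1 := of_malg (psi (to_malg (lett x0))); pose P2 := of_malg (psi (to_malg (lett x1))).
have fP1 : sub3 x2 f' g' P1 = lett x0 by apply: to_malg_inj; rewrite subE of_malgK Kpsi.
have fP2 : sub3 x2 f' g' P2 = lett x1 by apply: to_malg_inj; rewrite subE of_malgK Kpsi.
(* The two identities not yet known are checked after the injective substitution of [(f, g, z)],
   where they follow from [fP1] and [fP2]. *)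
have iv : inverse_pair f' g' P1 P2.
  split=> //; apply: subI; rewrite sub3_comp fP1 fP2 sub3_id /sub3 gevX //.
have [k Fk] := Fil_exists rat f'; have [l Fl] := Fil_exists rat g'.
have [m0 H] : stable_pair f' g'.
  apply: (inverse_pair_stable (k := maxn k l) iv).
    by apply: suppW Fk => s sk; apply: le_trans sk _; rewrite ler_nat leq_maxl.
  by apply: suppW Fl => s sk; apply: le_trans sk _; rewrite ler_nat leq_maxr.
exists m0; have := tame_to_malg (H m0 (leqnn _)); congr tame; apply: eq_from_tnth => i.
rewrite tnth_mktuple; case: (split_ordP i) => j ->.
  rewrite stab_substL tnth_lshift tnth_map tE tnth_mktuple /finclude /incl -to_malg_gev; congr fsubst.
  by apply: eq_from_tnth => l'; rewrite !tnth_mktuple to_malg_lett.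
by rewrite stab_substR tnth_rshift tnth_mktuple to_malg_lett.
Qed.
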